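(* Let $(X,d,\ll,\leq,\tau)$ be a locally strictly timelike geodesically connected Lorentzian pre-length space and let $K\in\mathbb{R}$. If $X$ has timelike curvature bounded below (respectively above) by $K$, then $X$ satisfies future timelike $K$-monotonicity comparison from below (respectively above).
   Context: A causal space is a set $X$ with two transitive relations $\ll,\leq$ such that $\leq$ is reflexive and $p\ll q$ implies $p\leq q$. A Lorentzian pre-length space $(X,d,\ll,\leq,\tau)$ is a causal space with a metric $d$ and a map $\tau\colon X\times X\to[0,\infty]$ that is lower semicontinuous with respect to $d$, satisfies $\tau(p,r)\geq\tau(p,q)+\tau(q,r)$ for $p\leq q\leq r$, and $\tau(p,q)>0\Leftrightarrow p\ll q$. A non-constant locally Lipschitz curve $\gamma\colon I\to X$ is future directed causal (timelike) if $\gamma(t_1)\leq\gamma(t_2)$ ($\gamma(t_1)\ll\gamma(t_2)$) for all $t_1<t_2$. $L_\tau(\gamma)$ is the infimum of $\sum_i\tau(\gamma(t_i),\gamma(t_{i+1}))$ over partitions. A distance realizer (maximal geodesic) from $p$ to $q$ is a future directed causal curve from $p$ to $q$ with $L_\tau(\gamma)=\tau(p,q)$. An open set $U$ is strictly timelike geodesically connected if for all $x\ll y$ in $U$ there is a future directed maximal geodesic in $U$ from $x$ to $y$, and any such maximal geodesic in $U$ is timelike. $X$ is locally strictly timelike geodesically connected if it is covered by such sets. Model spaces: $\mathbb{R}^n_m$ is $\mathbb{R}^n$ with $b(v,w)=-\sum_{i\leq m}v_iw_i+\sum_{i>m}v_iw_i$. $\mathbb{L}^2(K)$ is the two-dimensional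 Lorentzian model space of constant curvature $K$: the universal cover of $\{v\in\mathbb{R}^3_1:b(v,v)=1/K\}$ for $K>0$, the universal cover of $\{v\in\mathbb{R}^3_2:b(v,v)=-1/|K|\}$ for $K<0$, and $\mathbb{R}^2_1$ for $K=0$; $\bar\tau$ is its time separation. $D_K=\pi/\sqrt{-K}$ for $K<0$, $D_K=\infty$ for $K\geq0$. A triangle satisfies timelike size bounds for $K$ if its longest side-length is $<D_K$. A timelike (geodesic) triangle consists of $p_1\ll p_2\ll p_3$ with finite mutual time separations and future directed causal distance realizers (sides) from $p_i$ to $p_j$, $i<j$; $[p,q]$ denotes a side. A comparison triangle in $\mathbb{L}^2(K)$ is a triple of points with the same causal order and the same time separations (it exists under size bounds, uniquely up to isometry). A point $q$ on the side from $p_i$ to $p_j$ corresponds to the point $\bar q$ on the side from $\bar p_i$ to $\bar p_j$ with $\bar\tau(\bar p_i,\bar q)=\tau(p_i,q)$. Timelike curvature bounds: $X$ has timelike curvature bounded below (above) by $K$ if it is covered by open sets $U$ such that (1) $\tau$ is finite and continuous on $U\times U$; (2) $U$ is strictly timelike geodesically connected; (3) for every timelike triangle in $U$ satisfying timelike size bounds for $K$, all points $q_1,q_2$ on its sides and corresponding points $\bar q_1,\bar q_2$ on a comparison triangle in $\mathbb{L}^2(K)$, $\tau(q_1,q_2)\leq\bar\tau(\bar q_1,\bar q_2)$ (respectively $\geq$). $K$-comparison angle: if $x,y,z$ are pairwise causally related with finite time separations (satisfying timelike size bounds for $K$), and $y,z$ are timelike related to $x$, then $\tilde\measuredangle^K_x(y,z)=\operatorname{arcosh}|\langle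 u,v\rangle|$, where $u,v$ are the unit timelike initial velocities at $\bar x$ of the geodesics from $\bar x$ to $\bar y$ and $\bar z$ in a comparison triangle $\bar x,\bar y,\bar z$ in $\mathbb{L}^2(K)$. $X$ satisfies future timelike $K$-monotonicity comparison from below (above) if every point has a neighborhood $U$ such that (i) $\tau|_{U\times U}$ is finite and continuous; (ii) $U$ is strictly timelike geodesically connected; (iii) whenever $x\ll y\ll z$ form a timelike geodesic triangle in $U$ whose side-lengths satisfy timelike size bounds for $K$, and $z'\in[x,z]$, $y'\in[x,y]$ with $y'\neq x\neq z'$ and $z'$ causally related to $y'$, then $\tilde\measuredangle_x^K(y',z')\geq\tilde\measuredangle_x^K(y,z)$ (respectively $\tilde\measuredangle_x^K(y',z')\leq\tilde\measuredangle_x^K(y,z)$). *)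

(* Defs.v *)
From HB Require Import structures.
From mathcomp Require Import all_boot all_order all_algebra.
From mathcomp Require Import all_classical all_reals all_analysis.
From mathcomp Require Import ring lra.

Set Implicit Arguments.
Unset Strict Implicit.
Unset Printing Implicit Defensive.

Import Order.TTheory GRing.Theory Num.Theory.
Import numFieldNormedType.Exports.

Local Open Scope classical_set_scope.
Local Open Scope ring_scope.

Record causal_space (X : Type) := CausalSpace {
  chron : X -> X -> Prop;
  caus : X -> X -> Prop; 
  chron_trans : forall p q r, chron p q -> chron q r -> chron p r;
  caus_trans : forall p q r, caus p q -> caus q r -> caus p r;
  caus_refl : forall p, caus p p;
  chron_caus : forall p q, chron p q -> caus p q
}.

Record lorentzian_prelength (R : realType) (X : metricType R) :=
  LorentzianPrelength {
  lpl_causal :> causal_space X;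
  tau : X -> X -> \bar R;
  tau_ge0 : forall p q, (0 <= tau p q)%E;
  tau_lsc : lower_semicontinuous (fun pq : X * X => tau pq.1 pq.2);
  tau_rtriangle : forall p q r,
    caus lpl_causal p q -> caus lpl_causal q r ->
    (tau p q + tau q r <= tau p r)%E;
  tau_chron : forall p q, (0 < tau p q)%E <-> chron lpl_causal p q
}.

(* "Non-constant" is read as: not constant on any nondegenerate subinterval
   (and the domain itself is nondegenerate).  If plateaus were allowed, then
   stopping a maximal geodesic for a while would give a maximal geodesic that
   is not timelike, and no set containing two points x << y could be strictly
   timelike geodesically connected. *)
Definition nonconstant_on (R : realType) (X : Type) (I : set R)
    (g : R -> X) : Prop :=
  (exists s t, [/\ I s, I t & s < t]) /\
  (forall s t, I s -> I t -> s < t -> exists2 u, s <= u <= t & g u <> g s).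

Definition locally_lipschitz_on (R : realType) (X : metricType R) (I : set R)
    (g : R -> X) : Prop :=
  forall t, I t -> exists k : R, exists2 V, nbhs t V &
    forall s s', V s -> V s' -> I s -> I s' ->
      mdist (g s) (g s') <= k * `|s - s'|.

Definition causal_curve (R : realType) (X : metricType R)
    (L : lorentzian_prelength X) (I : set R) (g : R -> X) : Prop :=
  [/\ is_interval I, nonconstant_on I g, locally_lipschitz_on I g &
      forall t1 t2, I t1 -> I t2 -> t1 < t2 -> caus L (g t1) (g t2)].

Definition timelike_curve (R : realType) (X : metricType R)
    (L : lorentzian_prelength X) (I : set R) (g : R -> X) : Prop :=
  [/\ is_interval I, nonconstant_on I g, locally_lipschitz_on I g &
      forall t1 t2, I t1 -> I t2 -> t1 < t2 -> chron L (g t1) (g t2)].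

Definition tau_length (R : realType) (X : metricType R)
    (L : lorentzian_prelength X) (a b : R) (g : R -> X) : \bar R :=
  ereal_inf [set e | exists2 s : seq R, itv_partition a b s &
    e = (\sum_(0 <= i < size s)
           tau L (g (nth b (a :: s) i)) (g (nth b (a :: s) i.+1)))%E].

Definition maximal_geodesic (R : realType) (X : metricType R)
    (L : lorentzian_prelength X) (p q : X) (a b : R) (g : R -> X) : Prop :=
  [/\ causal_curve L [set` `[a, b]] g, g a = p, g b = q &
      tau_length L a b g = tau L p q].

Definition maximal_geodesic_in (R : realType) (X : metricType R)
    (L : lorentzian_prelength X) (U : set X) (p q : X) (a b : R)
    (g : R -> X) : Prop :=
  maximal_geodesic L p q a b g /\ g @` [set` `[a, b]] `<=` U.

Definition strictly_timelike_geodesically_connected (R : realType)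
    (X : metricType R) (L : lorentzian_prelength X) (U : set X) : Prop :=
  [/\ open U,
      (forall x y, U x -> U y -> chron L x y ->
         exists a b g, maximal_geodesic_in L U x y a b g) &
      (forall x y a b g, U x -> U y -> chron L x y ->
         maximal_geodesic_in L U x y a b g ->
         timelike_curve L [set` `[a, b]] g)].

Definition locally_strictly_timelike_geodesically_connected (R : realType)
    (X : metricType R) (L : lorentzian_prelength X) : Prop :=
  forall p : X, exists2 U : set X, U p & strictly_timelike_geodesically_connected L U.

Definition tau_finite_continuous_on (R : realType) (X : metricType R)
    (L : lorentzian_prelength X) (U : set X) : Prop :=
  (forall p q, U p -> U q -> (tau L p q < +oo)%E) /\
  {within U `*` U, continuous (fun pq : X * X => tau L pq.1 pq.2)}.

Definition side_in (R : realType) (X : metricType R)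
    (L : lorentzian_prelength X) (U : set X) (p q : X) (S : set X) : Prop :=
  exists a b g, maximal_geodesic_in L U p q a b g /\ S = g @` [set` `[a, b]].

Definition timelike_triangle_in (R : realType) (X : metricType R)
    (L : lorentzian_prelength X) (U : set X) (p1 p2 p3 : X)
    (S12 S23 S13 : set X) : Prop :=
  [/\ chron L p1 p2 /\ chron L p2 p3,
      [/\ (tau L p1 p2 < +oo)%E, (tau L p2 p3 < +oo)%E &
          (tau L p1 p3 < +oo)%E],
      side_in L U p1 p2 S12, side_in L U p2 p3 S23 & side_in L U p1 p3 S13].

Definition model_diameter (R : realType) (K : R) : \bar R :=
  if K < 0 then (pi / Num.sqrt (- K))%:E else +oo%E.

Definition timelike_size_bounds (R : realType) (X : metricType R)
    (L : lorentzian_prelength X) (K : R) (p1 p2 p3 : X) : Prop :=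
  [/\ (tau L p1 p2 < model_diameter K)%E,
      (tau L p2 p3 < model_diameter K)%E &
      (tau L p1 p3 < model_diameter K)%E].

(* L^2(K): the universal cover of each hyperquadric is realized as R x R, with
   coordinates (t, x), together with the covering map [model_map K].  For
   K = 0, R^2_1 is the plane v_2 = 0 of R^3_1.  In all three cases the metric
   is the one induced by [model_map K] from the ambient R^3_m, and the time
   orientation is the one in which t increases. *)

Definition bform (R : realType) (m n : nat) (v w : 'rV[R]_n) : R :=
  - (\sum_(i < n | (i < m)%N) v 0 i * w 0 i)
  + \sum_(i < n | (m <= i)%N) v 0 i * w 0 i.

Definition cosh (R : realType) (x : R) : R := (expR x + expR (- x)) / 2.
Definition sinh (R : realType) (x : R) : R := (expR x - expR (- x)) / 2.
Definition arcosh (R : realType) (x : R) : R :=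
  ln (x + Num.sqrt (x ^+ 2 - 1)).

Definition model_index (R : realType) (K : R) : nat := if K < 0 then 2%N else 1%N.

Definition model_form (R : realType) (K : R) (v w : 'rV[R]_3) : R :=
  bform (model_index K) v w.

Definition row3 (R : realType) (a b c : R) : 'rV[R]_3 :=
  \row_(i < 3) nth 0 [:: a; b; c] i.

Definition model_map (R : realType) (K : R) (p : R * R) : 'rV[R]_3 :=
  let: (t, x) := p in
  let r := (Num.sqrt `|K|)^-1 in
  if K == 0 then row3 t x 0
  else if 0 < K then
    r *: row3 (sinh t) (cosh t * cos x) (cosh t * sin x)
  else r *: row3 (cosh x * cos t) (cosh x * sin t) (sinh x).

Lemma model_map_quadric (R : realType) (K : R) (p : R * R) : K != 0 ->
  model_form K (model_map K p) (model_map K p) = K^-1.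
Proof.
have ch (y : R) : cosh y ^+ 2 - sinh y ^+ 2 = 1.
  rewrite /cosh /sinh -[RHS](expRxMexpNx_1 y).
  by field.
case: p => t x K0; rewrite /model_form /bform /model_index /model_map (negPf K0).
set r := (Num.sqrt `|K|)^-1.
have r2 : r ^+ 2 = `|K|^-1 by rewrite exprVn sqr_sqrtr.
have [Kp|Kn] := boolP (0 < K).
- rewrite ltNge ltW//= [X in _ + X]big_mkcond [X in - X]big_mkcond/= !big_ord_recl !big_ord0 !mxE/=.
  rewrite gtr0_norm// in r2; rewrite -r2 -[RHS]mulr1.
  have -> : 1 = cosh t ^+ 2 * (cos x ^+ 2 + sin x ^+ 2) - sinh t ^+ 2.
    by rewrite cos2Dsin2 mulr1 ch.
  ring.
- have {}Kn : K < 0 by rewrite lt_neqAle K0 leNgt.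
  rewrite Kn [X in _ + X]big_mkcond [X in - X]big_mkcond/= !big_ord_recl !big_ord0 !mxE/=.
  rewrite ltr0_norm// invrN in r2; rewrite -[K^-1]opprK -r2 -[r ^+ 2]mulr1.
  have -> : 1 = cosh x ^+ 2 * (cos t ^+ 2 + sin t ^+ 2) - sinh x ^+ 2.
    by rewrite cos2Dsin2 mulr1 ch.
  ring.
Qed.

Definition model_diff (R : realType) (K : R) (p v : R * R) : 'rV[R]_3 :=
  v.1 *: derive1 (fun t => model_map K (t, p.2)) p.1 +
  v.2 *: derive1 (fun x => model_map K (p.1, x)) p.2.

Definition ambient_curve (R : realType) (K : R) (c : R -> R * R) (s : R) :
  'rV[R]_3 := model_map K (c s).

(* A C^1 arc parametrized by [0, 1]; every C^1 map on [0, 1] is the restriction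
   of a C^1 map on R. *)
Definition future_causal_arc (R : realType) (K : R) (c : R -> R * R) : Prop :=
  let t := fst \o c in let x := snd \o c in
  let v := derive1 (ambient_curve K c) in
  [/\ (forall s, derivable t s 1 /\ derivable x s 1),
      continuous (derive1 t), continuous (derive1 x) &
      forall s, 0 <= s <= 1 -> 0 < derive1 t s /\ model_form K (v s) (v s) <= 0].

Definition arc_length (R : realType) (K : R) (c : R -> R * R) : R :=
  let v := derive1 (ambient_curve K c) in
  \int[lebesgue_measure]_(s in `[0, 1]) Num.sqrt (- model_form K (v s) (v s)).

(* [future_causal_path K p q l]: some piecewise C^1 future directed causal
   curve from p to q has Lorentzian length l. *)
Inductive future_causal_path (R : realType) (K : R) :
    R * R -> R * R -> R -> Prop :=
| path_arc (c : R -> R * R) : future_causal_arc K c ->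
    future_causal_path K (c 0) (c 1) (arc_length K c)
| path_cat (p q r : R * R) (l l' : R) :
    future_causal_path K p q l -> future_causal_path K q r l' ->
    future_causal_path K p r (l + l').

Definition model_caus (R : realType) (K : R) (p q : R * R) : Prop :=
  p = q \/ exists l, future_causal_path K p q l.

Definition model_tau (R : realType) (K : R) (p q : R * R) : \bar R :=
  ereal_sup [set e | e = 0%E \/
    exists2 l : R, future_causal_path K p q l & e = l%:E].

(* A unit speed timelike geodesic on [0, l].  The Levi-Civita covariant
   derivative of the velocity is the tangential part of the ambient
   acceleration, so the geodesic equation says that the latter is normal. *)
Definition model_timelike_geodesic (R : realType) (K : R) (c : R -> R * R)
    (l : R) : Prop :=
  let t := fst \o c in let x := snd \o c in
  let g := ambient_curve K c in
  0 < l /\ forall s, 0 <= s <= l ->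
  [/\ derivable t s 1 /\ derivable x s 1,
      derivable (derive1 t) s 1 /\ derivable (derive1 x) s 1,
      model_form K (derive1 g s) (derive1 g s) = -1 &
      forall v, model_form K (derive1n 2 g s) (model_diff K (c s) v) = 0].

Definition on_model_side (R : realType) (K : R) (p q r : R * R) : Prop :=
  exists c l s, [/\ model_timelike_geodesic K c l, c 0 = p, c l = q,
                    0 <= s <= l & c s = r].

(* The causal order is only required to be preserved: if x << y <= z,
   tau y z = 0 and tau x y = tau x z, then the comparison points of y and z
   coincide even when y and z do not.  Timelike relations are preserved and
   reflected since the time separations agree. *)
Definition comparison_pair (R : realType) (X : metricType R)
    (L : lorentzian_prelength X) (K : R) (p q : X) (p' q' : R * R) : Prop :=
  [/\ model_tau K p' q' = tau L p q, model_tau K q' p' = tau L q p,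
      (caus L p q -> model_caus K p' q') & (caus L q p -> model_caus K q' p')].

Definition comparison_triangle (R : realType) (X : metricType R)
    (L : lorentzian_prelength X) (K : R) (p1 p2 p3 : X)
    (p1' p2' p3' : R * R) : Prop :=
  [/\ comparison_pair L K p1 p2 p1' p2', comparison_pair L K p2 p3 p2' p3' &
      comparison_pair L K p1 p3 p1' p3'].

Definition corresponding_on_side (R : realType) (X : metricType R)
    (L : lorentzian_prelength X) (K : R) (p q : X) (S : set X)
    (p' q' : R * R) (r : X) (r' : R * R) : Prop :=
  [/\ S r, on_model_side K p' q' r' & model_tau K p' r' = tau L p r].

Definition corresponding_points (R : realType) (X : metricType R)
    (L : lorentzian_prelength X) (K : R) (p1 p2 p3 : X) (S12 S23 S13 : set X)
    (p1' p2' p3' : R * R) (r : X) (r' : R * R) : Prop :=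
  [\/ corresponding_on_side L K p1 p2 S12 p1' p2' r r',
      corresponding_on_side L K p2 p3 S23 p2' p3' r r' |
      corresponding_on_side L K p1 p3 S13 p1' p3' r r'].

Definition is_comparison_angle (R : realType) (X : metricType R)
    (L : lorentzian_prelength X) (K : R) (x y z : X) (w : R) : Prop :=
  exists x' y' z' cy ly cz lz,
  [/\ comparison_triangle L K x y z x' y' z',
      [/\ model_timelike_geodesic K cy ly, cy 0 = x' & cy ly = y'],
      [/\ model_timelike_geodesic K cz lz, cz 0 = x' & cz lz = z'] &
      w = arcosh `|model_form K (derive1 (ambient_curve K cy) 0)
                                (derive1 (ambient_curve K cz) 0)| ].

(* Meaningful for pairwise causally related x, y, z within the size bounds,
   with y and z timelike related to x; then [is_comparison_angle] holds for
   exactly one real number. *)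
Definition comparison_angle (R : realType) (X : metricType R)
    (L : lorentzian_prelength X) (K : R) (x y z : X) : R :=
  xget 0 [set w | is_comparison_angle L K x y z w].

Definition timelike_curvature_bounded (R : realType) (X : metricType R)
    (cmp : \bar R -> \bar R -> Prop) (L : lorentzian_prelength X) (K : R) :
    Prop :=
  forall p : X, exists U : set X,
  [/\ open U /\ U p, tau_finite_continuous_on L U,
      strictly_timelike_geodesically_connected L U &
      forall p1 p2 p3 S12 S23 S13 p1' p2' p3' q1 q2 q1' q2',
        timelike_triangle_in L U p1 p2 p3 S12 S23 S13 ->
        timelike_size_bounds L K p1 p2 p3 ->
        comparison_triangle L K p1 p2 p3 p1' p2' p3' ->
        corresponding_points L K p1 p2 p3 S12 S23 S13 p1' p2' p3' q1 q1' ->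
        corresponding_points L K p1 p2 p3 S12 S23 S13 p1' p2' p3' q2 q2' ->
        cmp (tau L q1 q2) (model_tau K q1' q2')].

Definition timelike_curvature_bounded_below (R : realType) (X : metricType R)
    (L : lorentzian_prelength X) (K : R) : Prop :=
  timelike_curvature_bounded (fun s s' => (s <= s')%E) L K.

Definition timelike_curvature_bounded_above (R : realType) (X : metricType R)
    (L : lorentzian_prelength X) (K : R) : Prop :=
  timelike_curvature_bounded (fun s s' => (s >= s')%E) L K.

Definition future_timelike_monotonicity (R : realType) (X : metricType R)
    (cmp : R -> R -> Prop) (L : lorentzian_prelength X) (K : R) : Prop :=
  forall p : X, exists U : set X,
  [/\ nbhs p U, tau_finite_continuous_on L U,
      strictly_timelike_geodesically_connected L U &
      forall x y z Sxy Syz Sxz y' z',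
        timelike_triangle_in L U x y z Sxy Syz Sxz ->
        timelike_size_bounds L K x y z ->
        Sxz z' -> Sxy y' -> y' <> x -> x <> z' ->
        caus L y' z' \/ caus L z' y' ->
        cmp (comparison_angle L K x y' z') (comparison_angle L K x y z)].

Definition future_timelike_monotonicity_below (R : realType)
    (X : metricType R) (L : lorentzian_prelength X) (K : R) : Prop :=
  future_timelike_monotonicity (fun w' w => w' >= w) L K.

Definition future_timelike_monotonicity_above (R : realType)
    (X : metricType R) (L : lorentzian_prelength X) (K : R) : Prop :=
  future_timelike_monotonicity (fun w' w => w' <= w) L K.

(* Main.v *)
(* Write [m(s)] for the squared chord of a geodesic segment of length [s] in the
   model space.  In a comparison hinge at [x] with legs [a], [b] and angle [w]
   the squared chord of the third side is
   [m(a - b) - 2 sn(a) sn(b) (cosh w - 1)], which decreases in [w]; and it equals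
   [m] of the time separation of the two endpoints as soon as these are causally
   related and closer than the diameter.  Hence comparing the angles at [x] of
   [x, y', z'] and [x, y, z] amounts to comparing [tau y' z'] with the time
   separation of the corresponding points on the comparison triangle of
   [x, y, z], which is what the curvature bound does.

   The time separation of the model space is computed in the conformal null
   coordinates [u], [v] of the universal cover.  Seen from a point [p], new null
   coordinates [F], [G] vanishing at [p] turn the metric into
   [- dF dG / (1 - K F G / 4)^2], uniformly in [K].  Along a causal path the
   arithmetic-geometric mean inequality bounds the speed by the derivative of a
   function of [F G] alone, with equality on the curves with [F / G] constant. *)

Require Import Defs.
From mathcomp Require Import all_boot all_order all_algebra.
From mathcomp Require Import all_classical all_reals all_analysis.
From mathcomp Require Import ring lra.

Set Implicit Arguments.
Unset Strict Implicit.
Unset Printing Implicit Defensive.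

Import Order.TTheory GRing.Theory Num.Theory.
Import numFieldNormedType.Exports.

Local Open Scope classical_set_scope.
Local Open Scope ring_scope.

(** * Hyperbolic functions and the Gudermannian *)

Section hyperbolic.
Context {R : realType}.
Implicit Types x y k : R.

(** [comparison_angle] is picked by [xget] from a relation that admits every comparison triangle and
    every choice of geodesics. The hinge formula therefore has to be justified twice: explicit
    geodesics from the origin realize it, and any other witnesses must give the same value. The
    second half is delicate for [K < 0], since [model_timelike_geodesic] asks neither for a future
    direction nor for a length below the diameter; that the parameter length is the separation of
    the endpoints has to be deduced. Geodesics are handled in the ambient space, where they are
    linear combinations of position and initial velocity; the squared chord, unlike the separation,
    is affine in the hyperbolic cosine of the angle. But the chord forgets the order of its
    endpoints, and a bound from below says nothing where [tau] vanishes. So null related points are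
    the obstacle from below, and comparison points in the reverse order are the obstacle from above;
    finiteness of [tau] on the diagonal excludes the latter. *)

Lemma cosh_gt0 x : 0 < cosh x.
Proof. by rewrite /cosh divr_gt0// addr_gt0 ?expR_gt0. Qed.

Lemma cosh2Bsinh2 x : cosh x ^+ 2 - sinh x ^+ 2 = 1.
Proof. rewrite /cosh /sinh -[RHS](expRxMexpNx_1 x); by field. Qed.

Lemma sinh0 : sinh 0 = 0 :> R.
Proof. by rewrite /sinh oppr0 subrr mul0r. Qed.

Lemma cosh0 : cosh 0 = 1 :> R.
Proof. by rewrite /cosh oppr0 expR0; field. Qed.

Lemma sinhN x : sinh (- x) = - sinh x.
Proof. by rewrite /sinh opprK; field. Qed.

Lemma coshN x : cosh (- x) = cosh x.
Proof. by rewrite /cosh opprK addrC. Qed.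

Lemma coshD x y : cosh (x + y) = cosh x * cosh y + sinh x * sinh y.
Proof. by rewrite /cosh /sinh opprD !expRD; field. Qed.

Global Instance is_derive_cosh x : is_derive x 1 (@cosh R) (sinh x).
Proof.
rewrite /cosh /sinh; apply: is_derive_eq.
by rewrite /GRing.scale/=; field.
Qed.

Global Instance is_derive_sinh x : is_derive x 1 (@sinh R) (cosh x).
Proof.
rewrite /cosh /sinh; apply: is_derive_eq.
by rewrite /GRing.scale/=; field.
Qed.

Lemma ltr_sinh : {mono (@sinh R) : x y / x < y}.
Proof.
apply: leW_mono; apply: le_mono => x y xy.
by rewrite /sinh ltr_pM2r// ltrB// ltr_expR// ltrN2.
Qed.

Lemma sinh_inj : injective (@sinh R).
Proof.
move=> x y e; have [xy|xy|//] := ltgtP x y.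
  by move: xy; rewrite -ltr_sinh e ltxx.
by move: xy; rewrite -ltr_sinh e ltxx.
Qed.

Lemma sinh_gt0 x : (0 < sinh x) = (0 < x).
Proof. by rewrite -{1}sinh0 ltr_sinh. Qed.

Lemma cosh_ge1 x : 1 <= cosh x.
Proof.
have := cosh2Bsinh2 x; have := cosh_gt0 x => c0 e.
have := sqr_ge0 (sinh x); nra.
Qed.

Lemma continuous_sinh : continuous (@sinh R).
Proof.
by move=> x; apply/differentiable_continuous/derivable1_diffP; exact: ex_derive.
Qed.

Lemma continuous_cosh : continuous (@cosh R).
Proof.
by move=> x; apply/differentiable_continuous/derivable1_diffP; exact: ex_derive.
Qed.

Definition asinh y : R := ln (y + Num.sqrt (1 + y ^+ 2)).

Lemma oneDsqr_gt0 y : 0 < 1 + y ^+ 2.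
Proof. by rewrite ltr_wpDr// sqr_ge0. Qed.

Lemma sqrt_oneDsqr_gt0 y : 0 < y + Num.sqrt (1 + y ^+ 2).
Proof.
have : Num.sqrt (y ^+ 2) < Num.sqrt (1 + y ^+ 2).
  by rewrite ltr_sqrt ?oneDsqr_gt0// ltrDr.
rewrite sqrtr_sqr => h.
have := ler_norm (- y); rewrite normrN; lra.
Qed.

Lemma asinhK : cancel asinh (@sinh R).
Proof.
move=> y; have p := sqrt_oneDsqr_gt0 y; have q := oneDsqr_gt0 y.
rewrite /sinh /asinh expRN lnK ?posrE//.
have := sqr_sqrtr (ltW q); set s := Num.sqrt _ in p * => s2.
by field: s2; rewrite gt_eqF.
Qed.

Lemma sinhK : cancel (@sinh R) asinh.
Proof. by move=> x; apply: sinh_inj; rewrite asinhK. Qed.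

Lemma cosh_asinh y : cosh (asinh y) = Num.sqrt (1 + y ^+ 2).
Proof.
rewrite -{2}(asinhK y) -(cosh2Bsinh2 (asinh y)) subrK sqrtr_sqr.
by rewrite gtr0_norm// cosh_gt0.
Qed.

Global Instance is_derive_asinh y :
  is_derive y 1 asinh (Num.sqrt (1 + y ^+ 2))^-1.
Proof.
have := @is_derive_inverse R (@sinh R) asinh (cosh (asinh y)) (asinh y).
rewrite asinhK => h; rewrite -cosh_asinh; apply: h.
- by near=> z; exact: sinhK.
- by near=> z; exact: continuous_sinh.
- by rewrite gt_eqF// cosh_gt0.
Unshelve. all: by end_near. Qed.

Lemma cosh_arcosh k : 1 <= k -> cosh (arcosh k) = k.
Proof.
move=> k1; have q : 0 <= k ^+ 2 - 1 by nra.
have := sqr_sqrtr q; have := sqrtr_ge0 (k ^+ 2 - 1).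
rewrite /cosh /arcosh; set s := Num.sqrt _ => s0 s2.
have p : 0 < k + s by lra.
rewrite expRN lnK ?posrE//.
by field: s2; rewrite gt_eqF.
Qed.

Lemma le_arcosh k k' : 1 <= k -> k <= k' -> arcosh k <= arcosh k'.
Proof.
move=> k1 kk'; have s0 := sqrtr_ge0 (k ^+ 2 - 1).
have ss : Num.sqrt (k ^+ 2 - 1) <= Num.sqrt (k' ^+ 2 - 1).
  by apply: ler_wsqrtr; nra.
by rewrite /arcosh ler_ln ?posrE; lra.
Qed.

(* The Gudermannian: it maps the time of de Sitter space, or the space coordinate
   of anti-de Sitter space, to the conformal one. *)
Definition gd x : R := atan (sinh x).
Definition gdi y : R := asinh (tan y).

Lemma gd_lt x : `|gd x| < pi / 2.
Proof. by rewrite ltr_norml atan_gtNpi2 atan_ltpi2. Qed.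

Lemma gdK : cancel gd gdi.
Proof. by move=> x; rewrite /gdi /gd atanK sinhK. Qed.

Lemma gdiK y : `|y| < pi / 2 -> gd (gdi y) = y.
Proof. by rewrite ltr_norml => h; rewrite /gd asinhK tanK// in_itv. Qed.

Lemma tan_gd x : tan (gd x) = sinh x.
Proof. exact: atanK. Qed.

Lemma cos_gd x : cos (gd x) = (cosh x)^-1.
Proof.
rewrite /gd cos_atan -(cosh2Bsinh2 x) subrK sqrtr_sqr.
by rewrite gtr0_norm// cosh_gt0.
Qed.

Lemma sin_gd x : sin (gd x) = sinh x / cosh x.
Proof.
have := tan_gd x; rewrite /tan cos_gd invrK => <-.
by rewrite -mulrA divff ?mulr1// gt_eqF// cosh_gt0.
Qed.

Lemma cos_gt0_strip y : `|y| < pi / 2 -> 0 < cos y.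
Proof. by rewrite ltr_norml; exact: cos_gt0_pihalf. Qed.

Lemma cosh_gdi y : `|y| < pi / 2 -> cosh (gdi y) = (cos y)^-1.
Proof. by move=> h; rewrite -[in RHS](gdiK h) cos_gd invrK. Qed.

Global Instance is_derive_gd x : is_derive x 1 gd (cosh x)^-1.
Proof.
rewrite /gd; apply: is_derive_eq; rewrite -(cosh2Bsinh2 x) subrK.
by field; rewrite gt_eqF// cosh_gt0.
Qed.

Lemma is_derive_gdi y : `|y| < pi / 2 -> is_derive y 1 gdi (cos y)^-1.
Proof.
move=> h; have c0 := cos_gt0_strip h.
have dt : is_derive y 1 (@tan R) ((cos y)^-2).
  by apply: is_derive_tan; rewrite gt_eqF.
have := @is_derive1_comp R asinh (@tan R) y _ _ (is_derive_asinh _) dt.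
rewrite -cosh_asinh -/(gdi y) (cosh_gdi h) invrK => H.
rewrite (_ : (cos y)^-1 = cos y * (cos y)^-2)//.
by field; rewrite gt_eqF.
Qed.

Lemma lt_gd x y : x < y -> gd x < gd y.
Proof. by move=> xy; apply: lt_atan; rewrite ltr_sinh. Qed.

End hyperbolic.

(** * Conformal null coordinates on the model spaces *)

Section ambient.
Context {R : realType}.
Implicit Types (K s : R) (p q v : R * R).

(** The curvature radius. At [K = 0] it is the inverse of [0], that is [0], so the flat case has its
    own branch in the formulas built from it. *)
Definition crad K : R := (Num.sqrt `|K|)^-1.

Lemma crad_gt0 K : K != 0 -> 0 < crad K.
Proof. by move=> K0; rewrite invr_gt0 sqrtr_gt0 normr_gt0. Qed.

Lemma crad2 K : crad K ^+ 2 = `|K|^-1.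
Proof. by rewrite exprVn sqr_sqrtr. Qed.

Lemma row3E (a b c : R) (i : 'I_3) : row3 a b c 0 i = [:: a; b; c]`_i.
Proof. by rewrite mxE. Qed.

Lemma row3_lin (k l a b c a' b' c' : R) :
  k *: row3 a b c + l *: row3 a' b' c' =
  row3 (k * a + l * a') (k * b + l * b') (k * c + l * c').
Proof.
by apply/rowP => i; rewrite !mxE; case: i => [[|[|[|]]]].
Qed.

Lemma row3D (a b c a' b' c' : R) :
  row3 a b c + row3 a' b' c' = row3 (a + a') (b + b') (c + c').
Proof. by apply/rowP => i; rewrite !mxE; case: i => [[|[|[|]]]]. Qed.

Lemma row3Z (k a b c : R) : k *: row3 a b c = row3 (k * a) (k * b) (k * c).
Proof. by apply/rowP => i; rewrite !mxE; case: i => [[|[|[|]]]]. Qed.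

Lemma row3_eta (v : 'rV[R]_3) : v = row3 (v 0 0) (v 0 1) (v 0 2).
Proof.
by apply/rowP => i; rewrite !mxE; case: i => [[|[|[|]]]]//= i; congr (v 0 _); apply/val_inj.
Qed.

Lemma model_form3 K (a b c a' b' c' : R) :
  model_form K (row3 a b c) (row3 a' b' c') =
  - (a * a') + (if K < 0 then -1 else 1) * (b * b') + c * c'.
Proof.
rewrite /model_form /bform /model_index; case: (K < 0);
  rewrite [X in _ + X]big_mkcond [X in - X]big_mkcond/= !big_ord_recl
    !big_ord0 !mxE/=; ring.
Qed.

Lemma is_derive_row3 (f g h : R -> R) s (f' g' h' : R) :
  is_derive s 1 f f' -> is_derive s 1 g g' -> is_derive s 1 h h' ->
  is_derive s 1 (fun s => row3 (f s) (g s) (h s)) (row3 f' g' h').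
Proof.
move=> df dg dh.
have dM : derivable (fun s => row3 (f s) (g s) (h s)) s 1.
  apply/derivable_mxP => i j; rewrite ord1.
  rewrite (_ : (fun x => _) = fun x => [:: f x; g x; h x]`_j); last first.
    by apply/funext => x; rewrite row3E.
  by case: j => [[|[|[|]]]]//= _; exact: ex_derive.
apply: DeriveDef => //; rewrite derive_mx//; apply/rowP => j; rewrite !mxE.
rewrite (_ : (fun x => _) = fun x => [:: f x; g x; h x]`_j); last first.
  by apply/funext => x; rewrite row3E.
by case: j => [[|[|[|]]]]//= _; exact: derive_val.
Qed.

(** [tvec] and [xvec] are the partial derivatives of [model_map] in [t] and [x], in closed form so
    that computations with [model_form] become polynomial identities. *)
Definition tvec K p : 'rV[R]_3 :=
  if K == 0 then row3 1 0 0 else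
  if 0 < K then crad K *: row3 (cosh p.1) (sinh p.1 * cos p.2) (sinh p.1 * sin p.2)
  else crad K *: row3 (- (cosh p.2 * sin p.1)) (cosh p.2 * cos p.1) 0.

Definition xvec K p : 'rV[R]_3 :=
  if K == 0 then row3 0 1 0 else
  if 0 < K then crad K *: row3 0 (- (cosh p.1 * sin p.2)) (cosh p.1 * cos p.2)
  else crad K *: row3 (sinh p.2 * cos p.1) (sinh p.2 * sin p.1) (cosh p.2).

Lemma is_derive_ambient K (c : R -> R * R) s (t' x' : R) :
  is_derive s 1 (fst \o c) t' -> is_derive s 1 (snd \o c) x' ->
  is_derive s 1 (ambient_curve K c) (t' *: tvec K (c s) + x' *: xvec K (c s)).
Proof.
(* With [c] an explicit pair the [let] in [model_map] reduces. *)
have -> : c = fun s => ((fst \o c) s, (snd \o c) s).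
  by apply/funext => y /=; case: (c y).
move: (fst \o c) (snd \o c) => t x.
rewrite (_ : fst \o _ = t)// (_ : snd \o _ = x)// => dt dx.
rewrite /ambient_curve /model_map /tvec /xvec.
have [K0|K0] := eqVneq K 0.
  rewrite row3_lin.
  by apply: is_derive_row3; apply: is_derive_eq; rewrite ?mulr1 ?mulr0 ?addr0 ?add0r.
have [Kp|Kp] := ltP 0 K => /=.
  rewrite (_ : (fun _ => _) = fun s =>
    row3 (crad K * sinh (t s)) (crad K * (cosh (t s) * cos (x s)))
     (crad K * (cosh (t s) * sin (x s)))); last first.
    by apply/funext => y/=; rewrite row3Z.
  rewrite !row3Z row3D; apply: is_derive_row3; apply: is_derive_eq;
    rewrite /GRing.scale/=; ring.
rewrite (_ : (fun _ => _) = fun s =>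
  row3 (crad K * (cosh (x s) * cos (t s))) (crad K * (cosh (x s) * sin (t s)))
   (crad K * sinh (x s))); last first.
  by apply/funext => y/=; rewrite row3Z.
rewrite !row3Z row3D; apply: is_derive_row3; apply: is_derive_eq;
  rewrite /GRing.scale/=; ring.
Qed.

Lemma derive1_val (V : normedModType R) (f : R -> V) s d :
  is_derive s 1 f d -> derive1 f s = d.
Proof. by move=> h; rewrite derive1E; exact: derive_val. Qed.

Lemma derivable_is_derive1 (f : R -> R) s :
  derivable f s 1 -> is_derive s 1 f (derive1 f s).
Proof. by move=> h; rewrite derive1E; exact: derivableP. Qed.

Lemma model_diffE K p v : model_diff K p v = v.1 *: tvec K p + v.2 *: xvec K p.
Proof.
rewrite /model_diff; congr (_ *: _ + _ *: _); apply: derive1_val.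
- have := @is_derive_ambient K (fun t => (t, p.2)) p.1 1 0
    (is_derive_id _ _) (is_derive_cst _ _ _).
  by rewrite scale1r scale0r addr0; case: (p).
- have := @is_derive_ambient K (fun x => (p.1, x)) p.2 0 1
    (is_derive_cst _ _ _) (is_derive_id _ _).
  by rewrite scale1r scale0r add0r; case: (p).
Qed.

(** Conformal time, space and factor. The metric is [crad^2 (- dt^2 + cosh(t)^2 dx^2)] for [K > 0]
    and [crad^2 (- cosh(x)^2 dt^2 + dx^2)] for [K < 0]; only the coordinate with constant
    coefficient is changed. *)
Definition ceta K p : R := if 0 < K then gd p.1 else p.1.
Definition cxi K p : R := if K < 0 then gd p.2 else p.2.
Definition cfac K p : R :=
  if K == 0 then 1 else crad K * cosh (if 0 < K then p.1 else p.2).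

Lemma cfac_gt0 K p : 0 < cfac K p.
Proof.
by rewrite /cfac; case: eqVneq => // K0; rewrite mulr_gt0 ?crad_gt0 ?cosh_gt0.
Qed.

Definition deta K p (t' : R) : R := if 0 < K then (cosh p.1)^-1 * t' else t'.
Definition dxi K p (x' : R) : R := if K < 0 then (cosh p.2)^-1 * x' else x'.

Lemma is_derive_ceta K c s (t' : R) : is_derive s 1 (fst \o c) t' ->
  is_derive s 1 (ceta K \o c) (deta K (c s) t').
Proof.
rewrite /ceta /deta => h; case: ifP => _ //.
rewrite (_ : _ \o _ = gd \o (fst \o c))//.
by apply: is_derive_eq.
Qed.

Lemma is_derive_cxi K c s (t' : R) : is_derive s 1 (snd \o c) t' ->
  is_derive s 1 (cxi K \o c) (dxi K (c s) t').
Proof.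
rewrite /cxi /dxi => h; case: ifP => _ //.
rewrite (_ : _ \o _ = gd \o (snd \o c))//.
by apply: is_derive_eq.
Qed.

(** [gd] has derivative [1 / cosh], which turns the coefficient [1] of the changed coordinate into
    [cosh^2], the coefficient of the other one. *)
Lemma model_form_conf K p (t' x' : R) (w := t' *: tvec K p + x' *: xvec K p) :
  model_form K w w = - (cfac K p ^+ 2 * (deta K p t' ^+ 2 - dxi K p x' ^+ 2)).
Proof.
rewrite /w /tvec /xvec /cfac /deta /dxi.
have [->|K0] := eqVneq K 0.
  by rewrite !ltxx row3_lin model_form3 ltxx; ring.
have [Kp|Kp] := ltP 0 K.
  rewrite ltNge (ltW Kp)/= !row3Z row3D model_form3 ltNge (ltW Kp)/=.
  have e := cos2Dsin2 p.2; have h := cosh2Bsinh2 p.1.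
  have c0 : cosh p.1 != 0 by rewrite gt_eqF ?cosh_gt0.
  move: (cosh p.1) (sinh p.1) (cos p.2) (sin p.2) h e c0 => C S k l h e c0.
  (* [ring] ignores the relations between these functions, so the expression is regrouped until they
     can be rewritten. The same device recurs below. *)
  transitivity (crad K ^+ 2 * (- (t' ^+ 2 * C ^+ 2) + t' ^+ 2 * S ^+ 2 * (k ^+ 2 + l ^+ 2) + x' ^+ 2 * C ^+ 2 * (k ^+ 2 + l ^+ 2))); first by ring.
  rewrite e (_ : S ^+ 2 = C ^+ 2 - 1); first by field.
  by rewrite -h; ring.
have {}Kp : K < 0 by rewrite lt_neqAle K0.
rewrite Kp/= !row3Z row3D model_form3 Kp/=.
have e := cos2Dsin2 p.1; have h := cosh2Bsinh2 p.2.
have c0 : cosh p.2 != 0 by rewrite gt_eqF ?cosh_gt0.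
move: (cosh p.2) (sinh p.2) (cos p.1) (sin p.1) h e c0 => C S k l h e c0.
transitivity (crad K ^+ 2 * (- (t' ^+ 2 * C ^+ 2 * (k ^+ 2 + l ^+ 2)) - x' ^+ 2 * S ^+ 2 * (k ^+ 2 + l ^+ 2) + x' ^+ 2 * C ^+ 2)); first by ring.
rewrite e (_ : S ^+ 2 = C ^+ 2 - 1); first by field.
  by rewrite -h; ring.
Qed.

End ambient.

(** * Integrals and derivatives along the unit interval *)

Section arc_calculus.
Context {R : realType}.
Implicit Types (h F G : R -> R) (s x : R).

Lemma is_derive_continuous (f : R -> R) (x d : R) :
  is_derive x 1 f d -> {for x, continuous f}.
Proof.
by move=> h; apply/differentiable_continuous/derivable1_diffP; exact: ex_derive.
Qed.

Lemma continuous_compR (f g : R -> R) : continuous f -> continuous g ->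
  continuous (fun s => g (f s)).
Proof. by move=> cf cg s; apply: continuous_comp; [exact: cf | exact: cg]. Qed.

Lemma Rintegral_derive h F : continuous h ->
  (forall s, 0 <= s <= 1 -> is_derive s 1 F (h s)) ->
  \int[lebesgue_measure]_(s in `[0, 1]) h s = F 1 - F 0.
Proof.
move=> ch dF; rewrite /Rintegral (@continuous_FTC2 R h F)//.
- exact: continuous_subspaceT.
- have cF s : 0 <= s <= 1 -> {for s, continuous F}.
    by move=> /dF /is_derive_continuous.
  split.
  + by move=> x; rewrite in_itv/= => /andP[x0 x1]; have [] := dF x; rewrite ?ltW.
  + by apply: cvg_at_right_filter; apply: cF; rewrite lexx ler01.
  + by apply: cvg_at_left_filter; apply: cF; rewrite lexx ler01.
- move=> x; rewrite in_itv/= => /andP[x0 x1].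
  by apply: derive1_val; apply: dF; rewrite !ltW.
Qed.

Lemma continuous_primitive h : continuous h ->
  exists F, forall s, 0 <= s <= 1 -> is_derive s 1 F (h s).
Proof.
(* Integrating from [-1], inside [[-1, 2]], makes [0] and [1] interior points, so that the
   derivative is two-sided there. *)
move=> ch; pose H x := \int[lebesgue_measure]_(t in [set` `[-1, x]]) h t.
exists H => s.
move=> /andP[s0 s1].
have [||||df fE] := @continuous_FTC1_closed R h (-1) s 2.
- by apply: (le_lt_trans s1); rewrite ltr1n.
- apply: continuous_compact_integrable; first exact: segment_compact.
  exact: continuous_subspaceT.
- by rewrite (lt_le_trans _ s0)// ltrN10.
- exact: ch.
- by rewrite -fE derive1E; exact: DeriveDef df erefl.
Qed.

Lemma ler_derive F G (f g : R -> R) :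
  (forall s, 0 <= s <= 1 -> is_derive s 1 F (f s)) ->
  (forall s, 0 <= s <= 1 -> is_derive s 1 G (g s)) ->
  (forall s, 0 <= s <= 1 -> f s <= g s) ->
  forall a b, 0 <= a -> a <= b -> b <= 1 -> F b - F a <= G b - G a.
Proof.
move=> dF dG fg a b a0 ab b1.
suff : (G - F) a <= (G - F) b by rewrite !fctE; lra.
have d s : a <= s <= b -> is_derive s 1 (G - F) (g s - f s).
  move=> /andP[as_ sb].
  have s01 : 0 <= s <= 1 by rewrite (le_trans a0)// (le_trans sb).
  by have := dF _ s01; have := dG _ s01 => *; exact: is_deriveB.
apply: (@ger0_derive1_le_cc _ (G - F) a b) => //.
- by move=> x; rewrite in_itv/= => /andP[ax xb]; have [] := d x; rewrite ?ltW.
- move=> x; rewrite in_itv/= => /andP[ax xb].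
  have axb : a <= x <= b by rewrite !ltW.
  rewrite (derive1_val (d x axb)) subr_ge0 fg// (le_trans a0 (ltW ax))/=.
  by rewrite (le_trans (ltW xb)).
- apply: derivable_within_continuous => x; rewrite in_itv/= => axb.
  by have [] := d x.
- by rewrite in_itv/= lexx.
- by rewrite in_itv/= lexx ab.
Qed.

(** Comparing [F] with a primitive of [h] avoids integrating [f], so neither continuity nor
    integrability of [f] has to be checked. *)
Lemma ler_Rintegral_derive h F (f : R -> R) : continuous h ->
  (forall s, 0 <= s <= 1 -> is_derive s 1 F (f s)) ->
  (forall s, 0 <= s <= 1 -> h s <= f s) ->
  \int[lebesgue_measure]_(s in `[0, 1]) h s <= F 1 - F 0.
Proof.
move=> ch dF hf; have [H dH] := continuous_primitive ch.
by rewrite (Rintegral_derive ch dH); apply: (ler_derive dH dF hf).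
Qed.

End arc_calculus.

(** * Causal arcs in null coordinates *)

Section arcs.
Context {R : realType}.
Implicit Types (K s : R) (p q : R * R) (c : R -> R * R).

(* The metric is [- cfac ^ 2 d(nu) d(nv)]. *)
Definition nu K p : R := ceta K p - cxi K p.
Definition nv K p : R := ceta K p + cxi K p.

Definition Jle K p q : Prop := nu K p <= nu K q /\ nv K p <= nv K q.

Lemma Jle_trans K p q r : Jle K p q -> Jle K q r -> Jle K p r.
Proof.
by move=> [a b] [c d]; split; [exact: le_trans a c | exact: le_trans b d].
Qed.

(** The image in the conformal plane is a strip bounded in time for [K > 0] and in space for
    [K < 0]. With this sign [nu + csign * nv] is, up to sign, twice the bounded coordinate in both
    cases. *)
Definition csign K : R := if 0 < K then 1 else -1.

Lemma gd_inj : injective (@gd R).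
Proof. exact: can_inj (@gdK R). Qed.

Lemma null_coord_inj K p q : nu K p = nu K q -> nv K p = nv K q -> p = q.
Proof.
rewrite /nu /nv => a b.
have e : ceta K p = ceta K q by lra.
have x : cxi K p = cxi K q by lra.
move: p q e x {a b} => [t x] [t' x']; rewrite /ceta /cxi.
case: (0 < K); case: (K < 0) => /= e i; congr (_, _);
  by [exact: e | exact: i | exact: gd_inj e | exact: gd_inj i].
Qed.

Lemma strip K p : K != 0 -> `|nu K p + csign K * nv K p| < pi.
Proof.
move=> K0; rewrite /nu /nv /csign /ceta /cxi.
have [Kp|Kp] := ltP 0 K.
  rewrite (_ : _ + _ = 2 * gd p.1); last by ring.
  by rewrite normrM ger0_norm// mulrC -ltr_pdivlMr// gd_lt.
have -> : K < 0 by rewrite lt_neqAle K0.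
rewrite (_ : _ + _ = - (2 * gd p.2)); last by ring.
by rewrite normrN normrM ger0_norm// mulrC -ltr_pdivlMr// gd_lt.
Qed.

Lemma cfacE K p : K != 0 ->
  cfac K p = crad K / cos ((nu K p + csign K * nv K p) / 2).
Proof.
move=> K0; rewrite /cfac (negPf K0) /nu /nv /csign /ceta /cxi.
have [Kp|Kp] := ltP 0 K.
  by rewrite (_ : _ / 2 = gd p.1) ?cos_gd ?invrK//; field.
have -> : K < 0 by rewrite lt_neqAle K0.
by rewrite (_ : _ / 2 = - gd p.2) ?cosN ?cos_gd ?invrK//; field.
Qed.

(** For a future causal velocity the conformal time increases and [U' V'] is nonnegative, so neither
    null derivative can be negative. The length estimates see an arc only through this lemma. *)
Lemma arc_null_coords K c : future_causal_arc K c ->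
  exists U' V' : R -> R,
  [/\ forall s, is_derive s 1 (nu K \o c) (U' s),
      forall s, is_derive s 1 (nv K \o c) (V' s),
      forall s, 0 <= s <= 1 -> [/\ 0 <= U' s, 0 <= V' s & 0 < U' s + V' s],
      continuous (fun s => cfac K (c s) * Num.sqrt (U' s * V' s)) &
      forall s, Num.sqrt (- model_form K (derive1 (ambient_curve K c) s)
                            (derive1 (ambient_curve K c) s)) =
                cfac K (c s) * Num.sqrt (U' s * V' s)].
Proof.
move=> [dc ct cx fc].
pose t' := derive1 (fst \o c); pose x' := derive1 (snd \o c).
have dt s : is_derive s 1 (fst \o c) (t' s) by apply: derivable_is_derive1; case: (dc s).
have dx s : is_derive s 1 (snd \o c) (x' s) by apply: derivable_is_derive1; case: (dc s).
pose e' s := deta K (c s) (t' s); pose i' s := dxi K (c s) (x' s).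
have de s : is_derive s 1 (ceta K \o c) (e' s) by exact: is_derive_ceta.
have di s : is_derive s 1 (cxi K \o c) (i' s) by exact: is_derive_cxi.
have dA s : derive1 (ambient_curve K c) s = t' s *: tvec K (c s) + x' s *: xvec K (c s).
  by apply: derive1_val; exact: is_derive_ambient.
have ctc : continuous (fst \o c) by move=> s; exact: is_derive_continuous (dt s).
have cxc : continuous (snd \o c) by move=> s; exact: is_derive_continuous (dx s).
have ce : continuous e'.
  move=> s; rewrite /e' /deta; case: (0 < K); last exact: ct.
  apply: cvgM; last exact: ct.
  apply: cvgV; first by rewrite gt_eqF// cosh_gt0.
  exact: (continuous_compR ctc continuous_cosh).
have ci : continuous i'.
  move=> s; rewrite /i' /dxi; case: (K < 0); last exact: cx.
  apply: cvgM; last exact: cx.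
  apply: cvgV; first by rewrite gt_eqF// cosh_gt0.
  exact: (continuous_compR cxc continuous_cosh).
have cc : continuous (fun s => cfac K (c s)).
  move=> s; rewrite /cfac; case: (K == 0); first exact: cvg_cst.
  apply: cvgM; first exact: cvg_cst.
  case: (0 < K) => /=.
    exact: (continuous_compR ctc continuous_cosh).
  exact: (continuous_compR cxc continuous_cosh).
exists (fun s => e' s - i' s), (fun s => e' s + i' s); split.
- by move=> s; exact: is_deriveB.
- by move=> s; exact: is_deriveD.
- move=> s /fc; rewrite dA model_form_conf => -[t0 f0].
  have e0 : 0 < e' s.
    rewrite /e' /deta; case: (0 < K); last exact: t0.
    by rewrite mulr_gt0// invr_gt0 cosh_gt0.
  have : 0 <= cfac K (c s) ^+ 2 * (e' s ^+ 2 - i' s ^+ 2) by rewrite -oppr_le0.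
  rewrite pmulr_rge0 ?exprn_gt0 ?cfac_gt0// => ei.
  split; nra.
- move=> s; apply: cvgM; first exact: cc.
  have cm : continuous (fun s => (e' s - i' s) * (e' s + i' s)).
    by move=> y; apply: cvgM; [apply: cvgB | apply: cvgD]; [exact: ce | exact: ci | exact: ce | exact: ci].
  exact: (continuous_compR cm (@sqrt_continuous R)).
- move=> s; rewrite dA model_form_conf opprK sqrtrM ?sqr_ge0//.
  rewrite sqrtr_sqr gtr0_norm ?cfac_gt0//; congr (_ * Num.sqrt _).
  by rewrite /e' /i'; ring.
Qed.

Lemma arc_length_ge0 K c : 0 <= arc_length K c.
Proof. by apply: Rintegral_ge0 => // s _; exact: sqrtr_ge0. Qed.

(** The strict growth of [nu + nv], twice the conformal time, rules out closed causal paths; it is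
    why the separation of two ordered model points vanishes in the opposite direction. *)
Lemma path_Jle K p q l : future_causal_path K p q l ->
  [/\ Jle K p q, nu K p + nv K p < nu K q + nv K q & 0 <= l].
Proof.
elim=> [c fc|{}p r {}q l1 l2 _ [h1 g1 k1] _ [h2 g2 k2]]; last first.
  split; [exact: Jle_trans h1 h2 | exact: lt_trans g1 g2 | exact: addr_ge0].
have [U' [V' [dU dV pos _ _]]] := arc_null_coords fc.
have mono (f f' : R -> R) : (forall s, is_derive s 1 f (f' s)) ->
    (forall s, 0 <= s <= 1 -> 0 <= f' s) -> f 0 <= f 1.
  move=> df f0; rewrite -subr_ge0.
  have := @ler_derive R (cst 0) f (cst 0) f' (fun s _ => is_derive_cst _ _ _)
     (fun s _ => df s) f0 0 1 (lexx _) ler01 (lexx _).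
  by rewrite subrr.
split; last exact: arc_length_ge0.
  split; [apply: (mono _ _ dU) | apply: (mono _ _ dV)] => s /pos[]//.
have d s : is_derive s 1 ((nu K \o c) + (nv K \o c)) (U' s + V' s).
  exact: is_deriveD.
apply: (@gtr0_derive1_lt_cc _ ((nu K \o c) + (nv K \o c)) 0 1) => //.
- by move=> x; rewrite in_itv/= => /andP[x0 x1]; rewrite (derive1_val (d x)); case: (pos x) => //; rewrite !ltW.
- by apply: derivable_within_continuous => x _; have [] := d x.
- by rewrite in_itv/= lexx ler01.
- by rewrite in_itv/= lexx ler01.
Qed.

End arcs.

(** * Null coordinates seen from a base point *)

Section stereographic.
Context {R : realType}.
Implicit Types (K a b u v W : R) (p q r : R * R).

Lemma mul2_cos_cos (x y : R) : 2 * (cos x * cos y) = cos (x + y) + cos (x - y).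
Proof. by rewrite !cosD cosN sinN; ring. Qed.

Lemma mul2_sin_sin (x y : R) : 2 * (sin x * sin y) = cos (x - y) - cos (x + y).
Proof. by rewrite !cosD cosN sinN; ring. Qed.

(** For [K != 0] this is the affine function of [tan ((u + csign K * b) / 2)] that vanishes at
    [u = a], scaled so that its derivative there is the conformal factor of the base point. Its
    poles bound [base_dia]. *)
Definition stereo K a b u : R :=
  if K == 0 then u - a
  else 2 * crad K * sin ((u - a) / 2) / cos ((u + csign K * b) / 2).

Definition dstereo K a b u : R :=
  if K == 0 then 1
  else crad K * cos ((a + csign K * b) / 2) / cos ((u + csign K * b) / 2) ^+ 2.

Lemma cos_half_gt0 (x : R) : `|x| < pi -> 0 < cos (x / 2).
Proof. by move=> h; apply: cos_gt0_strip; rewrite normrM (ger0_norm (_ : 0 <= 2^-1))// ltr_pM2r. Qed.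

Lemma mul_crad2 K : K != 0 -> K * crad K ^+ 2 = csign K.
Proof.
move=> K0; rewrite crad2 /csign; have [Kp|Kp] := ltP 0 K.
  by rewrite gtr0_norm// divff.
by rewrite ler0_norm// invrN mulrN divff.
Qed.

Lemma csign_swap K a b : cos ((b + csign K * a) / 2) = cos ((a + csign K * b) / 2).
Proof.
rewrite /csign; case: ifP => _; first by congr cos; ring.
by rewrite -cosN; congr cos; ring.
Qed.

Lemma is_derive_stereo K a b u :
  (K != 0 -> `|u + csign K * b| < pi) ->
  is_derive u 1 (stereo K a b) (dstereo K a b u).
Proof.
rewrite /stereo /dstereo; case: eqVneq => [_ _|K0 /(_ isT) h].
  by apply: is_derive_eq; rewrite ?subr0 ?addr0.
have c0 := cos_half_gt0 h.
have dn : is_derive u 1 (fun u => (cos ((u + csign K * b) / 2))^-1)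
   (2^-1 * sin ((u + csign K * b) / 2) / cos ((u + csign K * b) / 2) ^+ 2).
  have dc : is_derive u 1 (fun u => cos ((u + csign K * b) / 2))
     (- (2^-1 * sin ((u + csign K * b) / 2))).
    by apply: is_derive_eq; rewrite /GRing.scale/=; ring.
  have := is_deriveV (lt0r_neq0 c0) dc.
  move=> h'; apply: is_derive_eq; rewrite /GRing.scale/=.
  by field; rewrite gt_eqF.
have ds : is_derive u 1 (fun u => 2 * crad K * sin ((u - a) / 2))
   (crad K * cos ((u - a) / 2)).
  by apply: is_derive_eq; rewrite /GRing.scale/=; field.
have := is_deriveM ds dn => h'; apply: is_derive_eq; rewrite /GRing.scale/=.
have -> : cos ((a + csign K * b) / 2) =
  cos ((u + csign K * b) / 2) * cos ((u - a) / 2)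
   + sin ((u + csign K * b) / 2) * sin ((u - a) / 2).
  by rewrite -cosB; congr cos; field.
by field; rewrite gt_eqF.
Qed.

(** The formula for [1 - K F G / 4] cleared of denominators. Product-to-sum formulas turn both sides
    into cosines; the sign [csign] decides which pair of them cancels. *)
Lemma stereo_identity K a b u v :
  cos ((u + csign K * b) / 2) * cos ((v + csign K * a) / 2)
  - csign K * (sin ((u - a) / 2) * sin ((v - b) / 2)) =
  cos ((a + csign K * b) / 2) * cos ((u + csign K * v) / 2).
Proof.
apply: (@mulfI _ 2) => //; rewrite mulrBr [2 * (csign K * _)]mulrCA.
rewrite !mul2_cos_cos mul2_sin_sin /csign; case: ifP => _.
  rewrite mul1r; set x1 := cos _; set x2 := cos _; set x3 := cos _.
  set x4 := cos _; set y1 := cos _; set y2 := cos _.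
  have -> : x1 = y1 by congr cos; ring.
  have -> : x2 = x3 by congr cos; ring.
  have -> : x4 = y2 by rewrite /x4 -cosN; congr cos; ring.
  by ring.
set x1 := cos _; set x2 := cos _; set x3 := cos _.
set x4 := cos _; set y1 := cos _; set y2 := cos _.
have -> : x1 = x4 by congr cos; ring.
have -> : x2 = y1 by congr cos; ring.
have -> : x3 = y2 by rewrite /x3 -cosN; congr cos; ring.
by ring.
Qed.

(* The part of the universal cover where the coordinates seen from the point with
   null coordinates [a], [b] are finite.  For [K >= 0] it contains the causal future of
   that point; for [K < 0] it cuts it off at the cone of the first conjugate point. *)
Definition base_dia K a b q : Prop := K != 0 ->
  `|nu K q + csign K * b| < pi /\ `|nv K q + csign K * a| < pi.

(** States that [a], [b] are null coordinates of a point. The base is given by numbers so that it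
    can be shifted to [a - e], [b - e] in [path_length_le]. *)
Definition base_strip K a b : Prop := K != 0 -> `|a + csign K * b| < pi.

Lemma base_strip_swap K a b : base_strip K a b -> K != 0 -> `|b + csign K * a| < pi.
Proof.
move=> h /h; rewrite /csign; case: ifP => _; first by rewrite !mul1r addrC.
by rewrite !mulN1r distrC.
Qed.

Lemma base_dia_le K a b q r : base_strip K a b -> a <= nu K q -> b <= nv K q ->
  Jle K q r -> base_dia K a b r -> base_dia K a b q.
Proof.
move=> sab aq bq [uqr vqr] h K0; move: (h K0) (sab K0) (base_strip_swap sab K0).
rewrite !ltr_norml => -[/andP[h1 h2] /andP[h3 h4]] /andP[h5 h6] /andP[h7 h8].
by split; apply/andP; split; lra.
Qed.

Definition stereo1 K a b q := stereo K a b (nu K q).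
Definition stereo2 K a b q := stereo K b a (nv K q).

Lemma stereo_ge0 K a b u : base_strip K a b -> a <= u ->
  (K != 0 -> `|u + csign K * b| < pi) -> 0 <= stereo K a b u.
Proof.
rewrite /base_strip /stereo; case: eqVneq => [_ _ au _|K0 /(_ isT) sab au /(_ isT) uab].
  by rewrite subr_ge0.
rewrite divr_ge0//; last by rewrite ltW// cos_half_gt0.
rewrite mulr_ge0//; first by rewrite mulr_ge0// ltW// crad_gt0.
apply: sin_ge0_pi; move: sab uab; rewrite !ltr_norml => /andP[? ?] /andP[? ?].
by rewrite divr_ge0 ?subr_ge0//=; lra.
Qed.

Lemma stereo_gt0 K a b u : base_strip K a b -> a < u ->
  (K != 0 -> `|u + csign K * b| < pi) -> 0 < stereo K a b u.
Proof.
rewrite /base_strip /stereo; case: eqVneq => [_ _ au _|K0 /(_ isT) sab au /(_ isT) uab].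
  by rewrite subr_gt0.
rewrite divr_gt0//; last by rewrite cos_half_gt0.
rewrite mulr_gt0//; first by rewrite mulr_gt0// crad_gt0.
apply: sin_gt0_pi; move: sab uab; rewrite !ltr_norml => /andP[? ?] /andP[? ?].
by rewrite divr_gt0 ?subr_gt0//=; lra.
Qed.

Lemma dstereo_gt0 K a b u : base_strip K a b ->
  (K != 0 -> `|u + csign K * b| < pi) -> 0 < dstereo K a b u.
Proof.
rewrite /base_strip /dstereo; case: eqVneq => [//|K0 /(_ isT) sab /(_ isT) uab].
by rewrite divr_gt0 ?exprn_gt0 ?mulr_gt0 ?crad_gt0 ?cos_half_gt0.
Qed.

Lemma stereo_mul_cos K a b q : K != 0 -> base_strip K a b -> base_dia K a b q ->
  1 - K * (stereo1 K a b q * stereo2 K a b q) / 4 =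
  cos ((a + csign K * b) / 2) * cos ((nu K q + csign K * nv K q) / 2) /
  (cos ((nu K q + csign K * b) / 2) * cos ((nv K q + csign K * a) / 2)).
Proof.
move=> K0 sab /(_ K0)[uq vq].
rewrite -stereo_identity /stereo1 /stereo2 /stereo (negPf K0) -(mul_crad2 K0).
have := cos_half_gt0 uq; have := cos_half_gt0 vq.
rewrite (mul_crad2 K0) => h1 h2.
by rewrite -[X in _ - X * (_ * _)](mul_crad2 K0); field; rewrite !gt_eqF.
Qed.

Lemma stereo_mul_lt1 K a b q : base_strip K a b -> base_dia K a b q ->
  0 < 1 - K * (stereo1 K a b q * stereo2 K a b q) / 4.
Proof.
move=> sab dq; have [->|K0] := eqVneq K 0; first by rewrite !mul0r subr0.
rewrite stereo_mul_cos//; have [uq vq] := dq K0.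
by rewrite divr_gt0// mulr_gt0// cos_half_gt0 ?sab ?strip.
Qed.

(* In the coordinates [stereo1], [stereo2] the metric is
   [- dF dG / (1 - K F G / 4) ^ 2]. *)
Lemma dstereo_mul K a b q : base_strip K a b -> base_dia K a b q ->
  dstereo K a b (nu K q) * dstereo K b a (nv K q) =
  (cfac K q * (1 - K * (stereo1 K a b q * stereo2 K a b q) / 4)) ^+ 2.
Proof.
move=> sab dq; have [->|K0] := eqVneq K 0.
  by rewrite /dstereo /cfac !eqxx !mul0r subr0 !mulr1 expr1n.
rewrite stereo_mul_cos// cfacE// /dstereo (negPf K0) csign_swap.
have [uq vq] := dq K0.
have := cos_half_gt0 uq; have := cos_half_gt0 vq.
have := cos_half_gt0 (strip q K0) => h1 h2 h3.
by field; rewrite !gt_eqF.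
Qed.

(* The inverse of the tangent of curvature [K], so that
   [artan K (sqrt (F G) / 2)] is half the time separation. *)
Definition artan K W : R :=
  if K == 0 then W else
  if 0 < K then crad K / 2 * ln ((1 + W / crad K) / (1 - W / crad K))
  else crad K * atan (W / crad K).

Lemma artan_dom K W : 0 < K -> 0 < 1 - K * W ^+ 2 -> `|W / crad K| < 1.
Proof.
move=> K0 h; have r0 := crad_gt0 (lt0r_neq0 K0).
have e : K = (crad K ^+ 2)^-1 by rewrite crad2 gtr0_norm// invrK.
rewrite -(@expr_lt1 _ 2)//= real_normK ?num_real// expr_div_n.
by move: h; rewrite {1}e subr_gt0 mulrC.
Qed.

Lemma is_derive_artan K W : 0 < 1 - K * W ^+ 2 ->
  is_derive W 1 (artan K) (1 - K * W ^+ 2)^-1.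
Proof.
rewrite /artan; have [->|K0] := eqVneq K 0.
  by move=> _; rewrite mul0r subr0 invr1; exact: is_derive_id.
have [Kp|Kp] := ltP 0 K => h.
  have := artan_dom Kp h; rewrite ltr_norml => /andP[h1 h2].
  have r0 := crad_gt0 K0.
  have n0 : 0 < 1 - W / crad K by rewrite subr_gt0.
  have p0 : 0 < 1 + W / crad K by rewrite -ltrBlDl sub0r.
  have dn : is_derive W 1 (fun W => (1 - W / crad K)^-1)
      ((crad K)^-1 / (1 - W / crad K) ^+ 2).
    have dc : is_derive W 1 (fun W => 1 - W / crad K) (- (crad K)^-1).
      by apply: is_derive_eq; rewrite /GRing.scale/=; ring.
    have := @is_deriveV R (fun W => 1 - W / crad K) _ _ _ (lt0r_neq0 n0) dc.
    move=> h'; apply: is_derive_eq; rewrite /GRing.scale/=.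
    by rewrite mulrNN mulrC -exprVn.
  have dp : is_derive W 1 (fun W => 1 + W / crad K) (crad K)^-1.
    by apply: is_derive_eq; rewrite /GRing.scale/=; ring.
  have dm := is_deriveM dp dn.
  have dl : is_derive ((1 + W / crad K) * (1 - W / crad K)^-1) 1 (@ln R)
      ((1 + W / crad K) * (1 - W / crad K)^-1)^-1.
    by apply: is_derive1_ln; rewrite divr_gt0.
  have dcomp := @is_derive1_comp R (@ln R) _ W _ _ dl dm.
  rewrite (_ : (fun W0 => _) = (fun x => crad K / 2 * (@ln R \o (fun W => (1 + W / crad K) * (1 - W / crad K)^-1)) x))//.
  apply: is_derive_eq; rewrite /GRing.scale/=.
  have e : K = (crad K ^+ 2)^-1 by rewrite crad2 gtr0_norm// invrK.
  rewrite [X in _ = (1 - X * _)^-1]e.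
  have k1 : crad K - W != 0.
    rewrite (_ : crad K - W = crad K * (1 - W / crad K)) ?mulf_neq0 ?gt_eqF//.
    by field; rewrite gt_eqF.
  have k2 : crad K + W != 0.
    rewrite (_ : crad K + W = crad K * (1 + W / crad K)) ?mulf_neq0 ?gt_eqF//.
    by field; rewrite gt_eqF.
  field; rewrite k1 k2 (gt_eqF r0)/=.
  rewrite (_ : crad K ^+ 2 - W ^+ 2 = (crad K - W) * (crad K + W)) ?mulf_neq0//.
  by ring.
have {}Kp : K < 0 by rewrite lt_neqAle K0.
have r0 := crad_gt0 K0.
have e : K = - (crad K ^+ 2)^-1 by rewrite crad2 ltr0_norm// invrK opprK.
apply: is_derive_eq; rewrite /GRing.scale/= [X in _ = (1 - X * _)^-1]e.
field; rewrite (gt_eqF r0)/= mulN1r opprK.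
by rewrite gt_eqF// ltr_pwDl ?exprn_gt0 ?sqr_ge0.
Qed.

Lemma artan0 K : artan K 0 = 0.
Proof.
rewrite /artan; case: eqVneq => // _; case: ifP => _.
  by rewrite mul0r subr0 addr0 divr1 ln1 mulr0.
by rewrite mul0r atan0 mulr0.
Qed.

Lemma artan_ge0 K W : 0 <= W -> 0 < 1 - K * W ^+ 2 -> 0 <= artan K W.
Proof.
move=> W0 h; rewrite /artan; case: eqVneq => // K0.
have r0 := crad_gt0 K0.
have [Kp|Kp] := ltP 0 K.
  have := artan_dom Kp h; rewrite ltr_norml => /andP[h1 h2].
  rewrite mulr_ge0 ?divr_ge0 ?(ltW r0)// ln_ge0//.
  rewrite ler_pdivlMr ?subr_gt0// mul1r lerD2l.
  have : 0 <= W / crad K by rewrite divr_ge0// ltW.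
  by lra.
rewrite mulr_ge0 ?(ltW r0)// -(@atan0 R); apply: le_atan.
by rewrite divr_ge0// ltW.
Qed.

End stereographic.

(** * Upper bound for the length of causal paths *)

Section upper_bound.
Context {R : realType}.
Implicit Types (K a b s t : R) (p q r : R * R) (c : R -> R * R).

(** On a curve with [F / G] constant the metric is [- dS^2 / (1 - K S^2 / 4)^2] with
    [S = sqrt (F G)], and the length from the base is [2 artan K (S / 2)]. *)
Definition sep K a b q : R :=
  2 * artan K (Num.sqrt (stereo1 K a b q * stereo2 K a b q) / 2).

Lemma stereo_mul_ge0 K a b q : base_strip K a b -> base_dia K a b q ->
  a <= nu K q -> b <= nv K q -> 0 <= stereo1 K a b q * stereo2 K a b q.
Proof.
move=> sab dq aq bq; apply: mulr_ge0; apply: stereo_ge0 => //.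
- by move=> /dq[].
- exact: base_strip_swap.
- by move=> /dq[].
Qed.

Lemma sqrt_half_sqr K (P : R) : 0 <= P ->
  1 - K * (Num.sqrt P / 2) ^+ 2 = 1 - K * P / 4.
Proof. by move=> P0; rewrite expr_div_n sqr_sqrtr//; field. Qed.

Lemma sep_ge0 K a b q : base_strip K a b -> base_dia K a b q ->
  a <= nu K q -> b <= nv K q -> 0 <= sep K a b q.
Proof.
move=> sab dq aq bq; rewrite mulr_ge0// artan_ge0 ?divr_ge0 ?sqrtr_ge0//.
by rewrite sqrt_half_sqr ?stereo_mul_ge0// stereo_mul_lt1.
Qed.

Lemma ler_of_sqr (x y : R) : 0 <= x -> y ^+ 2 <= x ^+ 2 -> y <= x.
Proof.
move=> x0 h; have [y0|/ltW y0] := leP y 0; first exact: le_trans y0 x0.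
by rewrite -(@ler_pXn2r _ 2)// nnegrE.
Qed.

Lemma arc_Jle K c s t : future_causal_arc K c -> 0 <= s -> s <= t -> t <= 1 ->
  Jle K (c s) (c t).
Proof.
move=> fc s0 st t1; have [U' [V' [dU dV pos _ _]]] := arc_null_coords fc.
have mono (f f' : R -> R) : (forall s, is_derive s 1 f (f' s)) ->
    (forall s, 0 <= s <= 1 -> 0 <= f' s) -> f s <= f t.
  move=> df f0; rewrite -subr_ge0.
  have := @ler_derive R (cst 0) f (cst 0) f' (fun s _ => is_derive_cst _ _ _)
     (fun s _ => df s) f0 s t s0 st t1.
  by rewrite subrr.
by split; [apply: (mono _ _ dU) | apply: (mono _ _ dV)] => y /pos[].
Qed.

Lemma arc_length_le K c a b : future_causal_arc K c -> base_strip K a b ->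
  a < nu K (c 0) -> b < nv K (c 0) -> base_dia K a b (c 1) ->
  sep K a b (c 0) + arc_length K c <= sep K a b (c 1).
Proof.
move=> fc sab a0 b0 d1; rewrite -lerBrDl.
have [U' [V' [dU dV pos ch speed]]] := arc_null_coords fc.
rewrite /arc_length; under eq_Rintegral do rewrite speed.
pose F s := stereo1 K a b (c s); pose G s := stereo2 K a b (c s).
pose F' s := dstereo K a b (nu K (c s)); pose G' s := dstereo K b a (nv K (c s)).
have as_ s : 0 <= s <= 1 -> a < nu K (c s).
  by move=> /andP[s0 s1]; apply: lt_le_trans a0 _; case: (arc_Jle fc (lexx _) s0 s1).
have bs s : 0 <= s <= 1 -> b < nv K (c s).
  by move=> /andP[s0 s1]; apply: lt_le_trans b0 _; case: (arc_Jle fc (lexx _) s0 s1).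
have ds s : 0 <= s <= 1 -> base_dia K a b (c s).
  move=> s01; have [s0 s1] := andP s01.
  apply: (@base_dia_le _ _ _ _ _ (c 1)) => //; rewrite ?ltW ?as_ ?bs//.
  exact: arc_Jle fc s0 s1 (lexx _).
have sba := base_strip_swap sab.
have Fp s : 0 <= s <= 1 -> 0 < F s.
  by move=> s01; apply: stereo_gt0 => //; [exact: as_ | move=> /(ds _ s01)[]].
have Gp s : 0 <= s <= 1 -> 0 < G s.
  by move=> s01; apply: stereo_gt0 => //; [exact: bs | move=> /(ds _ s01)[]].
have F'p s : 0 <= s <= 1 -> 0 < F' s.
  by move=> s01; apply: dstereo_gt0 => // /(ds _ s01)[].
have G'p s : 0 <= s <= 1 -> 0 < G' s.
  by move=> s01; apply: dstereo_gt0 => // /(ds _ s01)[].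
have dF s : 0 <= s <= 1 -> is_derive s 1 F (F' s * U' s).
  move=> s01; have dst : is_derive ((nu K \o c) s) 1 (stereo K a b) (F' s).
    by apply: is_derive_stereo => /(ds _ s01)[].
  by have := is_derive1_comp dst (dU s).
have dG s : 0 <= s <= 1 -> is_derive s 1 G (G' s * V' s).
  move=> s01; have dst : is_derive ((nv K \o c) s) 1 (stereo K b a) (G' s).
    by apply: is_derive_stereo => /(ds _ s01)[].
  by have := is_derive1_comp dst (dV s).
pose S s := Num.sqrt (F s * G s); pose D s := 1 - K * (F s * G s) / 4.
have Sp s : 0 <= s <= 1 -> 0 < S s.
  by move=> s01; rewrite sqrtr_gt0 mulr_gt0 ?Fp ?Gp.
have Dp s : 0 <= s <= 1 -> 0 < D s.
  by move=> s01; apply: stereo_mul_lt1 => //; exact: ds.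
have dT s : 0 <= s <= 1 -> is_derive s 1 (fun s => sep K a b (c s))
   ((F' s * U' s * G s + F s * (G' s * V' s)) / (2 * S s * D s)).
  move=> s01.
  have dFG := is_deriveM (dF s s01) (dG s s01).
  have FG0 : 0 < (F * G) s by rewrite mulr_gt0 ?Fp ?Gp.
  have dsq := is_derive1_comp (is_derive1_sqrt FG0) dFG.
  have dsq2 : is_derive s 1 (fun s => S s / 2)
     ((F' s * U' s * G s + F s * (G' s * V' s)) / (4 * S s)).
    rewrite (_ : (fun s => _) = (fun s => 2^-1 * (Num.sqrt \o (F * G)) s)); last first.
      by apply/funext => y /=; rewrite mulrC.
    apply: is_derive_eq; rewrite /GRing.scale/= -/(S s).

    by field; rewrite gt_eqF// Sp.
  have dom : 1 - K * (S s / 2) ^+ 2 = D s.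
    by rewrite /S sqrt_half_sqr// ltW// mulr_gt0 ?Fp ?Gp.
  have dA : is_derive (S s / 2) 1 (artan K) (D s)^-1.
    by rewrite -dom; apply: is_derive_artan; rewrite dom Dp.
  have dAc := @is_derive1_comp R (artan K) (fun s => S s / 2) s _ _ dA dsq2.
  rewrite (_ : (fun s => sep _ _ _ _) = (fun s => 2 * (artan K \o (fun s => S s / 2)) s))//.
  apply: is_derive_eq; rewrite /GRing.scale/=.
  by field; rewrite !gt_eqF ?Sp ?Dp.
apply: (@ler_Rintegral_derive R _ (fun s => sep K a b (c s)) _ ch dT) => s s01.
have [u0 v0 _] := pos s s01.
have Fs := Fp s s01; have Gs := Gp s s01; have Ss := Sp s s01; have Ds := Dp s s01.
have F's := F'p s s01; have G's := G'p s s01.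
rewrite ler_pdivlMr; last by rewrite !mulr_gt0.
apply: ler_of_sqr.
  by rewrite addr_ge0// !mulr_ge0// ltW.
have e1 : S s ^+ 2 = F s * G s by rewrite sqr_sqrtr// ltW// mulr_gt0.
have e2 : (cfac K (c s) * D s) ^+ 2 = F' s * G' s.
  by rewrite /F' /G' (dstereo_mul sab (ds s s01)).
have e3 := sqr_sqrtr (mulr_ge0 u0 v0).
have -> : (cfac K (c s) * Num.sqrt (U' s * V' s) * (2 * S s * D s)) ^+ 2
  = 4 * (cfac K (c s) * D s) ^+ 2 * Num.sqrt (U' s * V' s) ^+ 2 * S s ^+ 2.
  by ring.
rewrite e1 e2 e3 -subr_ge0.
(* The defect in the arithmetic-geometric mean inequality is the square of [G dF - F dG]. *)
have -> : (F' s * U' s * G s + F s * (G' s * V' s)) ^+ 2 -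
  4 * (F' s * G' s) * (U' s * V' s) * (F s * G s) =
  (F' s * U' s * G s - F s * (G' s * V' s)) ^+ 2 by ring.
exact: sqr_ge0.
Qed.

(** The base does not depend on the path, so the bounds for consecutive pieces telescope. *)
Lemma path_length_le_base K p q l : future_causal_path K p q l ->
  forall a b, base_strip K a b -> a < nu K p -> b < nv K p ->
  base_dia K a b q -> sep K a b p + l <= sep K a b q.
Proof.
elim=> [c fc a b sab a0 b0 d1|{}p r {}q l1 l2 p1 IH1 p2 IH2 a b sab ap bp dq].
  exact: arc_length_le.
have [J1 _ _] := path_Jle p1; have [J2 _ _] := path_Jle p2.
have ar : a < nu K r by apply: lt_le_trans ap _; case: J1.
have br : b < nv K r by apply: lt_le_trans bp _; case: J1.
have dr : base_dia K a b r by apply: base_dia_le J2 dq => //; rewrite ltW.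
have h1 := IH1 a b sab ap bp dr; have h2 := IH2 a b sab ar br dq.
by rewrite addrA; lra.
Qed.

Definition dia K p q := base_dia K (nu K p) (nv K p) q.
Definition msep K p q := sep K (nu K p) (nv K p) q.

Lemma base_strip_pt K p : base_strip K (nu K p) (nv K p).
Proof. by move=> K0; exact: strip. Qed.

Lemma cvg_stereo K a b u : (K != 0 -> `|u + csign K * b| < pi) ->
  (fun e : R => stereo K (a - e) (b - e) u) e @[e --> (0 : R)^'+] --> stereo K a b u.
Proof.
move=> h.
have id0 : (fun e : R => e) e @[e --> (0 : R)^'+] --> (0 : R).
  by apply: cvg_at_right_filter; exact: cvg_id.
have sub0 (x : R) : (fun e : R => x - e) e @[e --> (0 : R)^'+] --> x.
  by rewrite -[X in _ --> X]subr0; apply: cvgB; [exact: cvg_cst | exact: id0].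
move: h; rewrite /stereo; case: eqVneq => [_ _|K0 /(_ isT) h].
  by apply: cvgB; [exact: cvg_cst | exact: sub0].
apply: cvgM; first apply: cvgM; first exact: cvg_cst.
  apply: (@cvg_comp _ _ _ (fun e => (u - (a - e)) / 2) sin _ (nbhs ((u - a) / 2))).
    apply: cvgM; last exact: cvg_cst.
    by apply: cvgB; [exact: cvg_cst | exact: sub0].
  exact: continuous_sin.
apply: cvgV; first by rewrite gt_eqF// cos_half_gt0.
apply: (@cvg_comp _ _ _ (fun e => (u + csign K * (b - e)) / 2) cos _ (nbhs ((u + csign K * b) / 2))).
  apply: cvgM; last exact: cvg_cst.
  apply: cvgD; first exact: cvg_cst.
  by apply: cvgM; [exact: cvg_cst | exact: sub0].
exact: continuous_cos.
Qed.

Lemma near_lt_norm (x y k : R) : `|x| < y ->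
  \forall e \near (0 : R)^'+, `|x + k * e| < y.
Proof.
move=> h.
have id0 : (fun e : R => e) e @[e --> (0 : R)^'+] --> (0 : R).
  by apply: cvg_at_right_filter; exact: cvg_id.
have c : `|x + k * e| @[e --> (0 : R)^'+] --> `|x|.
  rewrite -[X in `|X|]addr0 -[X in x + X](mulr0 k).
  apply: cvg_norm; apply: cvgD; first exact: cvg_cst.
  by apply: cvgM; [exact: cvg_cst | exact: id0].
exact: (cvgr_lt _ c _ h).
Qed.

(* The base point is moved slightly to the past, so that the square root in
   [sep] is differentiable all along the path. *)
Lemma path_length_le K p q l : future_causal_path K p q l -> dia K p q ->
  l <= msep K p q.
Proof.
move=> pq dq; have [[Ju Jv] _ _] := path_Jle pq.
set a := nu K p; set b := nv K p.
have dq1 : K != 0 -> `|nu K q + csign K * b| < pi by move=> /dq[].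
have dq2 : K != 0 -> `|nv K q + csign K * a| < pi by move=> /dq[].
have cv : sep K (a - e) (b - e) q @[e --> (0 : R)^'+] --> msep K p q.
  have c1 := cvg_stereo (a := a) dq1; have c2 := cvg_stereo (a := b) dq2.
  apply: cvgM; first exact: cvg_cst.
  have dom : 0 < 1 - K * (Num.sqrt (stereo1 K a b q * stereo2 K a b q) / 2) ^+ 2.
    rewrite sqrt_half_sqr; first exact: stereo_mul_lt1 (@base_strip_pt K p) dq.
    by apply: stereo_mul_ge0 => //; exact: base_strip_pt.
  apply: (@cvg_comp _ _ _ (fun e => Num.sqrt (stereo1 K (a - e) (b - e) q * stereo2 K (a - e) (b - e) q) / 2) (artan K) _
    (nbhs (Num.sqrt (stereo1 K a b q * stereo2 K a b q) / 2))); last first.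
    exact: is_derive_continuous (is_derive_artan dom).
  apply: cvgM; last exact: cvg_cst.
  apply: (@cvg_comp _ _ _ (fun e => stereo1 K (a - e) (b - e) q * stereo2 K (a - e) (b - e) q) Num.sqrt _
    (nbhs (stereo1 K a b q * stereo2 K a b q))); last exact: sqrt_continuous.
  by apply: cvgM; [exact: c1 | exact: c2].
apply: (cvgr_to_ge cv).
have n1 : \forall e \near (0 : R)^'+, K != 0 -> `|nu K q + csign K * (b - e)| < pi.
  have [K0|K0] := eqVneq K 0; first exact: nearW.
  have := near_lt_norm (- csign K) (dq1 K0); apply: filterS => e h _.
  by move: h; rewrite mulNr -addrA -mulrBr.
have n2 : \forall e \near (0 : R)^'+, K != 0 -> `|nv K q + csign K * (a - e)| < pi.
  have [K0|K0] := eqVneq K 0; first exact: nearW.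
  have := near_lt_norm (- csign K) (dq2 K0); apply: filterS => e h _.
  by move: h; rewrite mulNr -addrA -mulrBr.
have n3 : \forall e \near (0 : R)^'+, base_strip K (a - e) (b - e).
  have [K0|K0] := eqVneq K 0; first by apply: nearW => e; rewrite /base_strip K0 eqxx.
  have := near_lt_norm (- (1 + csign K)) (base_strip_pt p K0); apply: filterS => e h _.
  move: h; have -> : a - e + csign K * (b - e) = a + csign K * b + - (1 + csign K) * e by ring.
  exact.
near=> e.
have e0 : 0 < e by near: e; exact: nbhs_right_gt.
have sab : base_strip K (a - e) (b - e) by near: e; exact: n3.
have dab1 : K != 0 -> `|nu K q + csign K * (b - e)| < pi by near: e; exact: n1.
have dab2 : K != 0 -> `|nv K q + csign K * (a - e)| < pi by near: e; exact: n2.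
have dab : base_dia K (a - e) (b - e) q.
  by move=> K0; split; [exact: dab1 | exact: dab2].
have ap : a - e < nu K p by rewrite ltrBlDr ltrDl.
have bp : b - e < nv K p by rewrite ltrBlDr ltrDl.
have dp : base_dia K (a - e) (b - e) p.
  by apply: base_dia_le dab => //; exact: ltW.
have := path_length_le_base pq sab ap bp dab; apply: le_trans.
by rewrite lerDr sep_ge0// ltW.
Unshelve. all: by end_near. Qed.

End upper_bound.

(** * Existence of causal paths *)

Section path_existence.
Context {R : realType}.
Implicit Types (K a b s t : R) (p q r : R * R) (c : R -> R * R).

Definition of_conf K (e x : R) : R * R :=
  (if 0 < K then gdi e else e, if K < 0 then gdi x else x).

Lemma ceta_of_conf K e x : (0 < K -> `|e| < pi / 2) -> ceta K (of_conf K e x) = e.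
Proof. by rewrite /ceta /of_conf/=; case: (0 < K) => //= h; rewrite gdiK// h. Qed.

Lemma cxi_of_conf K e x : (K < 0 -> `|x| < pi / 2) -> cxi K (of_conf K e x) = x.
Proof. by rewrite /cxi /of_conf/=; case: (K < 0) => //= h; rewrite gdiK// h. Qed.

(** [future_causal_arc] demands derivatives on the whole line, hence the strip bounds for every [s]
    and not only on [[0, 1]]; this dictates the parametrizations chosen below. *)
Lemma conf_arc K (E X E' X' : R -> R) :
  (forall s, is_derive s 1 E (E' s)) -> continuous E' ->
  (forall s, is_derive s 1 X (X' s)) -> continuous X' ->
  (0 < K -> forall s, `|E s| < pi / 2) -> (K < 0 -> forall s, `|X s| < pi / 2) ->
  (forall s, 0 <= s <= 1 -> 0 < E' s /\ `|X' s| <= E' s) ->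
  let c s := of_conf K (E s) (X s) in
  [/\ future_causal_arc K c, forall s, nu K (c s) = E s - X s,
      forall s, nv K (c s) = E s + X s,
      continuous (fun s => cfac K (c s) * Num.sqrt ((E' s - X' s) * (E' s + X' s))) &
      arc_length K c = \int[lebesgue_measure]_(s in `[0, 1])
        (cfac K (c s) * Num.sqrt ((E' s - X' s) * (E' s + X' s)))].
Proof.
move=> dE cE dX cX sE sX pos c.
have ce s : ceta K (c s) = E s by apply: ceta_of_conf => /sE.
have cx s : cxi K (c s) = X s by apply: cxi_of_conf => /sX.
have hu s : nu K (c s) = E s - X s by rewrite /nu ce cx.
have hv s : nv K (c s) = E s + X s by rewrite /nv ce cx.
have cEc : continuous E by move=> s; exact: is_derive_continuous (dE s).
have cXc : continuous X by move=> s; exact: is_derive_continuous (dX s).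
pose t' s := if 0 < K then (cos (E s))^-1 * E' s else E' s.
pose x' s := if K < 0 then (cos (X s))^-1 * X' s else X' s.
have dt s : is_derive s 1 (fst \o c) (t' s).
  rewrite /t' /c /of_conf; case: (ltP 0 K) => [Kp|Kp] /=; last exact: dE.
  rewrite (_ : _ \o _ = gdi \o E)//.
  by have h := is_derive_gdi (sE Kp s); have := is_derive1_comp h (dE s).
have dx s : is_derive s 1 (snd \o c) (x' s).
  rewrite /x' /c /of_conf; case: (ltP K 0) => [Kp|Kp] /=; last exact: dX.
  rewrite (_ : _ \o _ = gdi \o X)//.
  by have h := is_derive_gdi (sX Kp s); have := is_derive1_comp h (dX s).
have t'E : derive1 (fst \o c) = t' by apply/funext => s; exact: derive1_val.
have x'E : derive1 (snd \o c) = x' by apply/funext => s; exact: derive1_val.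
have fc : future_causal_arc K c.
  split.
  - by move=> s; split; [have [] := dt s | have [] := dx s].
  - rewrite t'E /t'; case: (ltP 0 K) => [Kp|Kp] //= s.
    apply: cvgM; last exact: cE.
    apply: cvgV; first by rewrite gt_eqF// cos_gt0_strip// sE.
    exact: (continuous_compR cEc (@continuous_cos R)).
  - rewrite x'E /x'; case: (ltP K 0) => [Kp|Kp] //= s.
    apply: cvgM; last exact: cX.
    apply: cvgV; first by rewrite gt_eqF// cos_gt0_strip// sX.
    exact: (continuous_compR cXc (@continuous_cos R)).
  - move=> s s01; have [E0 EX] := pos s s01.
    rewrite t'E; split.
      rewrite /t'; case: (ltP 0 K) => [Kp|Kp] //=.
      by rewrite mulr_gt0// invr_gt0 cos_gt0_strip// sE.
    rewrite (derive1_val (is_derive_ambient K (dt s) (dx s))) model_form_conf oppr_le0.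
    apply: mulr_ge0; first exact: sqr_ge0.
    have -> : deta K (c s) (t' s) = E' s.
      rewrite /deta /t' /c /of_conf/=; case: (ltP 0 K) => [Kp|Kp] //=.
      have := cos_gt0_strip (sE Kp s) => h.
      by rewrite cosh_gdi ?sE// invrK mulrA divff ?mul1r// gt_eqF.
    have -> : dxi K (c s) (x' s) = X' s.
      rewrite /dxi /x' /c /of_conf/=; case: (ltP K 0) => [Kp|Kp] //=.
      have := cos_gt0_strip (sX Kp s) => h.
      by rewrite cosh_gdi ?sX// invrK mulrA divff ?mul1r// gt_eqF.
    by rewrite subr_ge0 -(real_normK (num_real (X' s))) ler_pXn2r ?nnegrE// ltW.
have [U' [V' [dU dV _ ch sp]]] := arc_null_coords fc.
have hU s : U' s = E' s - X' s.
  have := derive1_val (dU s).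
  have -> : nu K \o c = E - X by apply/funext => y; exact: hu.
  by rewrite (derive1_val (is_deriveB (dE s) (dX s))).
have hV s : V' s = E' s + X' s.
  have := derive1_val (dV s).
  have -> : nv K \o c = E + X by apply/funext => y; exact: hv.
  by rewrite (derive1_val (is_deriveD (dE s) (dX s))).
have e : (fun s => cfac K (c s) * Num.sqrt (U' s * V' s)) =
         (fun s => cfac K (c s) * Num.sqrt ((E' s - X' s) * (E' s + X' s))).
  by apply/funext => s; rewrite hU hV.
split => //; first by rewrite -e.
by rewrite /arc_length; under eq_Rintegral do rewrite sp hU hV.
Qed.

(** The path is the straight segment in the conformal plane. An affine parameter would leave the
    strip outside [[0, 1]], so the bounded coordinate runs as [gd] of an affine function and the
    other one is affine in it. *)
Lemma Jle_path K p q : Jle K p q -> p <> q -> exists l, future_causal_path K p q l.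
Proof.
move=> [Ju Jv] pq.
set e0 := ceta K p; set e1 := ceta K q; set x0 := cxi K p; set x1 := cxi K q.
move: (Ju) (Jv); rewrite /nu /nv -/e0 -/e1 -/x0 -/x1 => hu hv.
have e01 : e0 < e1.
  rewrite lt_neqAle; apply/andP; split; last by lra.
  apply/eqP => e; apply: pq; apply: (@null_coord_inj _ K);
    rewrite /nu /nv -/e0 -/e1 -/x0 -/x1; lra.
have Np : nu K p = e0 - x0 by [].
have Nq : nu K q = e1 - x1 by [].
have Vp : nv K p = e0 + x0 by [].
have Vq : nv K q = e1 + x1 by [].
suff [E [X [E' [X' [[dE cE] [dX cX] [sE sX] pos [E0 E1 X0 X1]]]]]] :
  exists E X E' X' : R -> R, [/\ (forall s, is_derive s 1 E (E' s)) /\ continuous E',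
  (forall s, is_derive s 1 X (X' s)) /\ continuous X',
  (0 < K -> forall s, `|E s| < pi / 2) /\ (K < 0 -> forall s, `|X s| < pi / 2),
  (forall s, 0 <= s <= 1 -> 0 < E' s /\ `|X' s| <= E' s) &
  [/\ E 0 = e0, E 1 = e1, X 0 = x0 & X 1 = x1]].
  have /= [fc cu cv _ _] := conf_arc dE cE dX cX sE sX pos.
  exists (arc_length K (fun s => of_conf K (E s) (X s))).
  have -> : p = (fun s => of_conf K (E s) (X s)) 0.
    by apply: (@null_coord_inj _ K); rewrite ?cu ?cv ?Np ?Vp ?E0 ?X0.
  have -> : q = (fun s => of_conf K (E s) (X s)) 1.
    by apply: (@null_coord_inj _ K); rewrite ?cu ?cv ?Nq ?Vq ?E1 ?X1.
  exact: path_arc.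
have dlin (y0 y1 : R) s : is_derive s 1 (fun s => y0 + (y1 - y0) * s) (y1 - y0).
  by apply: is_derive_eq; rewrite /GRing.scale/=; ring.
have dgd (y0 y1 : R) s : is_derive s 1 (fun s => gd (y0 + (y1 - y0) * s))
    ((cosh (y0 + (y1 - y0) * s))^-1 * (y1 - y0)).
  by have := is_derive1_comp (is_derive_gd _) (dlin y0 y1 s).
have cgd (y0 y1 : R) : continuous (fun s => (cosh (y0 + (y1 - y0) * s))^-1 * (y1 - y0)).
  move=> s; apply: cvgM; last exact: cvg_cst.
  apply: cvgV; first by rewrite gt_eqF// cosh_gt0.
  apply: (@continuous_compR _ (fun s => y0 + (y1 - y0) * s)); last exact: continuous_cosh.
  by move=> y; exact: is_derive_continuous (dlin _ _ y).
have ccst (k : R) : continuous (fun _ : R => k) by move=> s; exact: cvg_cst.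
have daff (f : R -> R) (k l m d : R) s : is_derive s 1 f d ->
    is_derive s 1 (fun s => k + l * (f s - m)) (l * d).
  by move=> df; apply: is_derive_eq; rewrite /GRing.scale/=; ring.
have sl : `|(x1 - x0) / (e1 - e0)| <= 1.
  rewrite normrM normfV ler_pdivrMr ?normr_gt0 ?gt_eqF ?subr_gt0// mul1r.
  by rewrite [leRHS]gtr0_norm ?subr_gt0// ler_norml; lra.
have [Kp|Kp|K0] := ltgtP 0 K.
- have e0E : e0 = gd p.1 by rewrite /e0 /ceta Kp.
  have e1E : e1 = gd q.1 by rewrite /e1 /ceta Kp.
  have t01 : p.1 < q.1.
    rewrite ltNge; apply/negP; rewrite le_eqVlt => /predU1P[h|/lt_gd h];
      move: e01; rewrite e0E e1E; first by rewrite h ltxx.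
    by rewrite ltNge (ltW h).
  exists (fun s => gd (p.1 + (q.1 - p.1) * s)),
    (fun s => x0 + (x1 - x0) / (e1 - e0) * (gd (p.1 + (q.1 - p.1) * s) - e0)),
    (fun s => (cosh (p.1 + (q.1 - p.1) * s))^-1 * (q.1 - p.1)),
    (fun s => (x1 - x0) / (e1 - e0) * ((cosh (p.1 + (q.1 - p.1) * s))^-1 * (q.1 - p.1))).
  split; [split; [exact: dgd | exact: cgd] | split | split | | split].
  + by move=> s; exact: daff.
  + by move=> s; apply: cvgM; [exact: cvg_cst | exact: cgd].
  + by move=> _ s; exact: gd_lt.
  + by [].
  + move=> s _.
    have h : 0 < (cosh (p.1 + (q.1 - p.1) * s))^-1 * (q.1 - p.1).
      by rewrite mulr_gt0 ?invr_gt0 ?cosh_gt0 ?subr_gt0.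
    split=> //; rewrite normrM (gtr0_norm h) ler_piMl//; exact: ltW.
  + by rewrite mulr0 addr0.
  + by rewrite mulr1 subrKC.
  + by rewrite mulr0 addr0 -e0E subrr mulr0 addr0.
  + by rewrite mulr1 subrKC -e1E divfK ?subrKC// gt_eqF// subr_gt0.
- have x0E : x0 = gd p.2 by rewrite /x0 /cxi Kp.
  have x1E : x1 = gd q.2 by rewrite /x1 /cxi Kp.
  (* On a vertical segment the space coordinate is constant and cannot serve as parameter. *)
  have [x01|x01] := eqVneq p.2 q.2.
    exists (fun s => e0 + (e1 - e0) * s), (fun s => x0), (fun s => e1 - e0), (fun s => 0).
    split; [split; [exact: dlin | exact: ccst] | split; [by move=> s; exact: is_derive_cst | exact: ccst] |
      split; [by [] | by move=> _ s; rewrite x0E; exact: gd_lt] | | split].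
    + by move=> s _; rewrite normr0 ltW ?subr_gt0.
    + by rewrite mulr0 addr0.
    + by rewrite mulr1 subrKC.
    + by [].
    + by rewrite x0E x1E x01.
  have sg : 0 < (x1 - x0) * (q.2 - p.2).
    move: x01; rewrite neq_lt => /orP[h|h]; have := lt_gd h; rewrite -x0E -x1E => h'.
      by rewrite mulr_gt0 ?subr_gt0.
    by rewrite nmulr_rgt0 subr_lt0.
  have x10 : x1 - x0 != 0 by apply: contraTneq sg => ->; rewrite mul0r ltxx.
  exists (fun s => e0 + (e1 - e0) / (x1 - x0) * (gd (p.2 + (q.2 - p.2) * s) - x0)),
    (fun s => gd (p.2 + (q.2 - p.2) * s)),
    (fun s => (e1 - e0) / (x1 - x0) * ((cosh (p.2 + (q.2 - p.2) * s))^-1 * (q.2 - p.2))),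
    (fun s => (cosh (p.2 + (q.2 - p.2) * s))^-1 * (q.2 - p.2)).
  split; [split | split | split | | split].
  + by move=> s; exact: daff.
  + by move=> s; apply: cvgM; [exact: cvg_cst | exact: cgd].
  + exact: dgd.
  + exact: cgd.
  + by [].
  + by move=> _ s; exact: gd_lt.
  + move=> s _; set y := (cosh _)^-1.
    have y0 : 0 < y by rewrite invr_gt0 cosh_gt0.
    clearbody y.
    have e10 : 0 < e1 - e0 by rewrite subr_gt0.
    have h : 0 < (e1 - e0) / (x1 - x0) * (y * (q.2 - p.2)).
      rewrite (_ : _ * _ = (e1 - e0) * y * ((x1 - x0) * (q.2 - p.2)) / (x1 - x0) ^+ 2).
        have sq : 0 < (x1 - x0) ^+ 2 by rewrite lt_def sqrf_eq0 x10 sqr_ge0.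
        apply: divr_gt0 => //; apply: mulr_gt0 => //; exact: mulr_gt0.
      by field.
    split=> //.
    have h2 : `|x1 - x0| <= e1 - e0 by rewrite ler_norml; lra.
    rewrite -[leRHS]gtr0_norm// !normrM normfV (gtr0_norm y0) (gtr0_norm e10).
    by rewrite ler_peMl ?mulr_ge0 ?(ltW y0)// ler_pdivlMr ?normr_gt0// mul1r.
  + by rewrite mulr0 addr0 -x0E subrr mulr0 addr0.
  + by rewrite mulr1 subrKC -x1E divfK ?subrKC.
  + by rewrite mulr0 addr0.
  + by rewrite mulr1 subrKC.
- exists (fun s => e0 + (e1 - e0) * s), (fun s => x0 + (x1 - x0) * s), (fun s => e1 - e0), (fun s => x1 - x0).
  split; [split; [exact: dlin | exact: ccst] | split; [exact: dlin | exact: ccst] | split | | split].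
  + by [].
  + by [].
  + by move=> s _; rewrite subr_gt0 e01 ler_norml; split=> //; lra.
  + by rewrite mulr0 addr0.
  + by rewrite mulr1 subrKC.
  + by rewrite mulr0 addr0.
  + by rewrite mulr1 subrKC.
Qed.

End path_existence.

(** * Inverse stereographic coordinates and longest paths *)

Section geodesic_paths.
Context {R : realType}.
Implicit Types (K a b s t F G : R) (p q r : R * R).

(** The value of [tan ((u + csign K * b) / 2)] at the point where [stereo] equals [F], found by
    expanding [sin ((u - a) / 2)] as in [sin_half_sub]. *)
Definition istereo_arg K a b F : R :=
  (F / (2 * crad K) + sin ((a + csign K * b) / 2)) / cos ((a + csign K * b) / 2).

Definition istereo K a b F : R :=
  if K == 0 then a + F else - (csign K * b) + 2 * atan (istereo_arg K a b F).

Definition distereo K a b F : R :=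
  if K == 0 then 1
  else (crad K * cos ((a + csign K * b) / 2) * (1 + istereo_arg K a b F ^+ 2))^-1.

Lemma istereo_dia K a b F : K != 0 -> `|istereo K a b F + csign K * b| < pi.
Proof.
move=> K0; rewrite /istereo (negPf K0) addrAC addNr add0r normrM ger0_norm//.
have : `|atan (istereo_arg K a b F)| < pi / 2 by rewrite ltr_norml atan_gtNpi2 atan_ltpi2.
lra.
Qed.

Lemma sin_half_sub K a b u : sin ((u - a) / 2) =
  sin ((u + csign K * b) / 2) * cos ((a + csign K * b) / 2) -
  cos ((u + csign K * b) / 2) * sin ((a + csign K * b) / 2).
Proof. by rewrite -sinB; congr sin; ring. Qed.

Lemma stereoE K a b u : K != 0 -> base_strip K a b -> `|u + csign K * b| < pi ->
  tan ((u + csign K * b) / 2) = istereo_arg K a b (stereo K a b u).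
Proof.
move=> K0 /(_ K0) /cos_half_gt0 c0 /cos_half_gt0 c1; have r0 := crad_gt0 K0.
rewrite /istereo_arg /stereo (negPf K0) (sin_half_sub K a b) /tan.
by field; rewrite !gt_eqF.
Qed.

Lemma stereo_inj K a b u u' : base_strip K a b ->
  (K != 0 -> `|u + csign K * b| < pi) -> (K != 0 -> `|u' + csign K * b| < pi) ->
  stereo K a b u = stereo K a b u' -> u = u'.
Proof.
move=> sab; have [K0|K0 /(_ isT) du /(_ isT) du' e] := eqVneq K 0.
  by rewrite /stereo K0 eqxx => _ _ /subIr.
have hh (x : R) : `|x| < pi -> x / 2 \in `](- (pi / 2)), (pi / 2)[.
  by rewrite ltr_norml in_itv/= => /andP[? ?]; lra.
have := stereoE K0 sab du; rewrite e -(stereoE K0 sab du').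
by move=> /(tan_inj (hh _ du) (hh _ du')); lra.
Qed.

Lemma istereoK K a b F : base_strip K a b -> stereo K a b (istereo K a b F) = F.
Proof.
move=> sab; have [K0|K0] := eqVneq K 0.
  by rewrite /stereo /istereo K0 eqxx addrAC subrr add0r.
have du := istereo_dia a b F K0.
have c0 := cos_half_gt0 (sab K0); have r0 := crad_gt0 K0.
have := stereoE K0 sab du.
have -> : tan ((istereo K a b F + csign K * b) / 2) = istereo_arg K a b F.
  rewrite /istereo (negPf K0) addrAC addNr add0r mulrC mulrA mulVf// mul1r.
  exact: atanK.
move: (stereo K a b _) => F' e.
have : F / (2 * crad K) = F' / (2 * crad K).
  move: e; rewrite /istereo_arg => /(congr1 (fun x => x * cos ((a + csign K * b) / 2))).
  by rewrite !divfK ?gt_eqF// => /addIr.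
move=> h; apply: (@mulIf _ (2 * crad K)^-1); last exact/esym.
by rewrite invr_eq0 mulf_neq0// gt_eqF.
Qed.

Lemma stereoK K a b u : base_strip K a b ->
  (K != 0 -> `|u + csign K * b| < pi) -> istereo K a b (stereo K a b u) = u.
Proof.
move=> sab du; apply: (@stereo_inj K a b) => //; last by rewrite istereoK.
exact: istereo_dia.
Qed.

Lemma stereo_base K a b : stereo K a b a = 0.
Proof. by rewrite /stereo !subrr mul0r sin0 mulr0 mul0r; case: ifP. Qed.

Lemma lt_istereo K a b F G : base_strip K a b -> F < G ->
  istereo K a b F < istereo K a b G.
Proof.
move=> sab FG; rewrite /istereo; case: eqVneq => [_|K0]; first by rewrite ltrD2l.
rewrite ltrD2l ltr_pM2l//; apply: lt_atan.
by rewrite ltr_pM2r ?invr_gt0 ?cos_half_gt0 ?sab// ltrD2r ltr_pM2r// invr_gt0 mulr_gt0// crad_gt0.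
Qed.

Lemma istereo_gt K a b F : base_strip K a b -> 0 < F -> a < istereo K a b F.
Proof. by move=> sab F0; rewrite -[ltLHS](stereoK (b := b) sab sab) stereo_base lt_istereo. Qed.

Lemma distereo_gt0 K a b F : base_strip K a b -> 0 < distereo K a b F.
Proof.
move=> sab; rewrite /distereo; case: eqVneq => // K0.
by rewrite invr_gt0 !mulr_gt0 ?crad_gt0 ?cos_half_gt0 ?sab// oneDsqr_gt0.
Qed.

Lemma distereoE K a b F : base_strip K a b ->
  dstereo K a b (istereo K a b F) * distereo K a b F = 1.
Proof.
move=> sab; rewrite /dstereo /distereo /istereo; case: eqVneq => [_|K0]; first by rewrite mulr1.
rewrite addrAC addNr add0r [2 * _]mulrC mulfK// cos_atan.
rewrite exprVn sqr_sqrtr ?ltW ?oneDsqr_gt0// invrK divff//.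
have c0 := cos_half_gt0 (sab K0); have r0 := crad_gt0 K0.
by rewrite !mulf_neq0 ?gt_eqF ?oneDsqr_gt0.
Qed.

Lemma is_derive_istereo K a b F : base_strip K a b ->
  is_derive F 1 (istereo K a b) (distereo K a b F).
Proof.
move=> sab; rewrite /istereo /distereo; case: eqVneq => [_|K0].
  by have := is_deriveD (is_derive_cst a F 1) (is_derive_id F 1); rewrite add0r.
have c0 := cos_half_gt0 (sab K0); have r0 := crad_gt0 K0.
have da : is_derive F 1 (istereo_arg K a b)
   (2 * crad K * cos ((a + csign K * b) / 2))^-1.
  rewrite /istereo_arg; apply: is_derive_eq; rewrite /GRing.scale/=.
  by field; rewrite !gt_eqF.
have dd := is_derive1_comp (is_derive1_atan (istereo_arg K a b F)) da.
rewrite (_ : (fun F => _) = (fun F => - (csign K * b) + 2 * (atan \o istereo_arg K a b) F))//.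
apply: is_derive_eq; rewrite /GRing.scale/=.
have : 0 < 1 + istereo_arg K a b F ^+ 2 by exact: oneDsqr_gt0.
by move: (istereo_arg _ _ _ _) => y y0; field; rewrite !gt_eqF.
Qed.

Lemma continuous_distereo K a b : base_strip K a b -> continuous (distereo K a b).
Proof.
move=> sab F; rewrite /distereo; case: eqVneq => [_|K0]; first exact: cvg_cst.
have c0 := cos_half_gt0 (sab K0); have r0 := crad_gt0 K0.
apply: cvgV; first by rewrite !mulf_neq0 ?gt_eqF ?oneDsqr_gt0.
apply: cvgM; first exact: cvg_cst.
apply: cvgD; first exact: cvg_cst.
have c : istereo_arg K a b x @[x --> F] --> istereo_arg K a b F.
  apply: cvgM; last exact: cvg_cst.
  apply: cvgD; last exact: cvg_cst.
  by apply: cvgM; [exact: cvg_id | exact: cvg_cst].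
exact: cvgM.
Qed.

(** By the intermediate value theorem [|f|] would have to pass through [pi / 2], a zero of the
    cosine. Composing with [y |-> s * y] reduces either sign of [s] to the interval [[0, 1]]. *)
Lemma strip_continuous (f : R -> R) : continuous f -> (forall s, 0 < cos (f s)) ->
  `|f 0| < pi / 2 -> forall s, `|f s| < pi / 2.
Proof.
move=> cf cf0 f0 s; rewrite ltNge; apply/negP => fs.
have cg : continuous (fun y => `|f (s * y)|).
  move=> y; apply: cvg_norm.
  apply: (@continuous_compR _ (fun y => s * y)) => // z.
  by apply: cvgM; [exact: cvg_cst | exact: cvg_id].
have [|||y _ fy] := @IVT R (fun y => `|f (s * y)|) 0 1 (pi / 2).
- exact: ler01.
- exact: continuous_subspaceT.
- by rewrite mulr0 mulr1 ge_min le_max (ltW f0) fs orbT.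
- by have := cf0 (s * y); rewrite -cos_norm fy cos_pihalf ltxx.
Qed.

(** The parameter for the curve [(F f(s), G f(s))] with [P = F G]. For [K > 0] the identity would
    eventually violate the last condition, so [f] has to be bounded while still increasing on the
    whole line. *)
Lemma parameter_exists K (P : R) : 0 < P -> K * P / 4 < 1 ->
  exists f f' : R -> R, [/\ forall s, is_derive s 1 f (f' s), continuous f',
    f 0 = 0 /\ f 1 = 1, forall s, 0 < f' s & forall s, K * P * f s ^+ 2 / 4 < 1].
Proof.
move=> P0 KP; have [K0|K0] := leP K 0.
  exists id, (fun _ => 1); split=> //.
  - by move=> s; exact: is_derive_id.
  - by move=> s; exact: cvg_cst.
  - move=> s; rewrite (@le_lt_trans _ _ 0)// pmulr_lle0// mulr_le0_ge0 ?sqr_ge0//.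
    by rewrite mulr_le0_ge0// ltW.
set w := K * P / 4 in KP.
have w0 : 0 < w by rewrite divr_gt0// mulr_gt0.
(* [d] solves [w (1 + d) = d], which gives [w f(s)^2 = d s^2 / (1 + d s^2) < 1] and [f(1) = 1]. *)
pose d := w / (1 - w); have d0 : 0 < d by rewrite divr_gt0// subr_gt0.
pose k := Num.sqrt (1 + d).
have k0 : 0 < k by rewrite sqrtr_gt0 addr_gt0.
pose g s := 1 + d * s ^+ 2.
have g0 s : 0 < g s by rewrite ltr_pwDl// mulr_ge0 ?sqr_ge0// ltW.
have sg0 s : 0 < Num.sqrt (g s) by rewrite sqrtr_gt0.
have sg2 s : Num.sqrt (g s) ^+ 2 = g s by rewrite sqr_sqrtr// ltW.
have dg s : is_derive s 1 g (2 * d * s).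
  by apply: is_derive_eq; rewrite /GRing.scale/=; ring.
have dsg s : is_derive s 1 (fun s => Num.sqrt (g s)) (d * s / Num.sqrt (g s)).
  have h := is_derive1_comp (is_derive1_sqrt (g0 s)) (dg s).
  rewrite (_ : d * s / _ = (2 * Num.sqrt (g s))^-1 * (2 * d * s))//.
  by field; rewrite gt_eqF.
exists (fun s => k * s * (Num.sqrt (g s))^-1), (fun s => k / (g s * Num.sqrt (g s))); split.
- move=> s.
  have := @is_deriveV R (fun s => Num.sqrt (g s)) s _ _ (lt0r_neq0 (sg0 s)) (dsg s) => h.
  have dl : is_derive s 1 (fun s => k * s) k.
    by apply: is_derive_eq; rewrite /GRing.scale/=; ring.
  have dm := is_deriveM dl h.
  apply: is_derive_eq; rewrite /GRing.scale/= (_ : k / (g s * _) = k / (Num.sqrt (g s) ^+ 2 * Num.sqrt (g s))); last by rewrite sg2.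
  have : Num.sqrt (g s) ^+ 2 = 1 + d * s ^+ 2 by rewrite sg2.
  move: (sg0 s); move: (Num.sqrt (g s)) => z z0 e.
  transitivity (k * (z ^+ 2 - d * s ^+ 2) / z ^+ 3); first by field; rewrite gt_eqF.
  have -> : z ^+ 2 - d * s ^+ 2 = 1 by rewrite e addrK.
  by field; rewrite gt_eqF.
- move=> s; apply: cvgM; first exact: cvg_cst.
  apply: cvgV; first by rewrite mulf_neq0 ?gt_eqF.
  by apply: cvgM; [exact: is_derive_continuous (dg s) | exact: is_derive_continuous (dsg s)].
- by rewrite mulr0 mul0r mulr1 /g expr1n mulr1 divff// gt_eqF.
- by move=> s; rewrite divr_gt0// mulr_gt0.
- move=> s; rewrite 2!exprMn exprVn sg2 [k ^+ 2]sqr_sqrtr; last by rewrite ltW// addr_gt0.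
  rewrite (_ : K * P * _ / 4 = w * (1 + d) * s ^+ 2 / g s); last by rewrite /w; field; rewrite gt_eqF.
  have -> : w * (1 + d) = d by rewrite /d; field; rewrite gt_eqF// subr_gt0.
  by rewrite ltr_pdivrMr// mul1r /g ltrDr.
Qed.

(** The curve starts at the base point itself, where a general arc could not be differentiated under
    the root: here [sqrt (F G)] is a multiple of [f(s)] and stays smooth at [s = 0]. *)
Lemma msep_path K p q : nu K p < nu K q -> nv K p < nv K q -> dia K p q ->
  future_causal_path K p q (msep K p q).
Proof.
move=> uu vv dq; set a := nu K p; set b := nv K p.
have sab : base_strip K a b := base_strip_pt p.
have sba : base_strip K b a := base_strip_swap sab.
have dq1 : K != 0 -> `|nu K q + csign K * b| < pi by move=> /dq[].
have dq2 : K != 0 -> `|nv K q + csign K * a| < pi by move=> /dq[].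
set F := stereo1 K a b q; set G := stereo2 K a b q.
have F0 : 0 < F by exact: stereo_gt0.
have G0 : 0 < G by exact: stereo_gt0.
have FG0 : 0 < F * G by rewrite mulr_gt0.
have KFG : K * (F * G) / 4 < 1 by have := stereo_mul_lt1 sab dq; rewrite subr_gt0.
have [f [f' [df cf' [f_0 f_1] f'0 Kf]]] := parameter_exists FG0 KFG.
pose u s := istereo K a b (F * f s); pose v s := istereo K b a (G * f s).
pose u' s := distereo K a b (F * f s) * (F * f' s).
pose v' s := distereo K b a (G * f s) * (G * f' s).
have dFf (k : R) s : is_derive s 1 (fun s => k * f s) (k * f' s).
  by have := df s => h; apply: is_derive_eq.
have cFf (k : R) : continuous (fun s => k * f s).
  by move=> s; exact: is_derive_continuous (dFf k s).
have du s : is_derive s 1 u (u' s).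
  by have := @is_derive1_comp R _ (fun s => F * f s) s _ _ (is_derive_istereo (F * f s) sab) (dFf F s).
have dv s : is_derive s 1 v (v' s).
  by have := @is_derive1_comp R _ (fun s => G * f s) s _ _ (is_derive_istereo (G * f s) sba) (dFf G s).
have cu' : continuous u'.
  move=> s; apply: cvgM.
    exact: (continuous_compR (cFf F) (continuous_distereo sab)).
  by apply: cvgM; [exact: cvg_cst | exact: cf'].
have cv' : continuous v'.
  move=> s; apply: cvgM.
    exact: (continuous_compR (cFf G) (continuous_distereo sba)).
  by apply: cvgM; [exact: cvg_cst | exact: cf'].
have u'0 s : 0 < u' s by rewrite mulr_gt0 ?distereo_gt0 ?mulr_gt0.
have v'0 s : 0 < v' s by rewrite mulr_gt0 ?distereo_gt0 ?mulr_gt0.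
have u_0 : u 0 = a by rewrite /u f_0 mulr0 -(stereo_base K a b) stereoK.
have v_0 : v 0 = b by rewrite /v f_0 mulr0 -(stereo_base K b a) stereoK.
have u_1 : u 1 = nu K q by rewrite /u f_1 mulr1 /F stereoK.
have v_1 : v 1 = nv K q by rewrite /v f_1 mulr1 /G stereoK.
have su s : K != 0 -> `|u s + csign K * b| < pi by exact: istereo_dia.
have sv s : K != 0 -> `|v s + csign K * a| < pi by exact: istereo_dia.
(* [u] and [v] are inverted separately, so they need not be the null coordinates of a point. By
   [stereo_identity] and the condition on [f] the relevant cosine never vanishes, and the curve
   starts in the strip. *)
have strip_uv : K != 0 -> forall s, `|(u s + csign K * v s) / 2| < pi / 2.
  move=> K0; apply: strip_continuous.
  - move=> s; apply: cvgM; last exact: cvg_cst.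
    apply: cvgD; first exact: is_derive_continuous (du s).
    by apply: cvgM; [exact: cvg_cst | exact: is_derive_continuous (dv s)].
  - move=> s; have := stereo_identity K a b (u s) (v s).
    have cu := cos_half_gt0 (su s K0); have cv := cos_half_gt0 (sv s K0).
    have c0 := cos_half_gt0 (sab K0).
    have eu : stereo K a b (u s) = F * f s by exact: istereoK.
    have ev : stereo K b a (v s) = G * f s by exact: istereoK.
    move: eu ev; rewrite /stereo (negPf K0) => eu ev.
    have r0 := crad_gt0 K0.
    have su2 : sin ((u s - a) / 2) = F * f s * cos ((u s + csign K * b) / 2) / (2 * crad K).
      by rewrite -eu; field; rewrite !gt_eqF.
    have sv2 : sin ((v s - b) / 2) = G * f s * cos ((v s + csign K * a) / 2) / (2 * crad K).
      by rewrite -ev; field; rewrite !gt_eqF.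
    rewrite su2 sv2 -[X in _ - X * (_ * _)](mul_crad2 K0) => e.
    rewrite -(pmulr_rgt0 _ c0) -e.
    rewrite (_ : _ - _ = cos ((u s + csign K * b) / 2) * cos ((v s + csign K * a) / 2)
      * (1 - K * (F * G) * f s ^+ 2 / 4)); last by field; rewrite gt_eqF.
    by rewrite mulr_gt0 ?mulr_gt0// subr_gt0.
  - rewrite u_0 v_0 normrM (ger0_norm (_ : 0 <= 2^-1))// ltr_pM2r//; exact: sab.
have dE s : is_derive s 1 (fun s => (u s + v s) / 2) ((u' s + v' s) / 2).
  have := du s; have := dv s => h1 h2; apply: is_derive_eq.
  by rewrite /GRing.scale/=; ring.
have dX s : is_derive s 1 (fun s => (v s - u s) / 2) ((v' s - u' s) / 2).
  have := du s; have := dv s => h1 h2; apply: is_derive_eq.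
  by rewrite /GRing.scale/=; ring.
have [|||||fc cu cv cc len] := conf_arc (K := K) dE _ dX.
- by move=> s; apply: cvgM; [apply: cvgD; [exact: cu' | exact: cv'] | exact: cvg_cst].
- by move=> s; apply: cvgM; [apply: cvgB; [exact: cv' | exact: cu'] | exact: cvg_cst].
- by move=> Kp s; have := strip_uv (lt0r_neq0 Kp) s; rewrite /csign Kp mul1r.
- move=> Kn s; have := strip_uv (ltr0_neq0 Kn) s; rewrite /csign (lt_gtF Kn) mulN1r.
  by rewrite -normrN -mulNr opprB.
- move=> s _; have h1 := u'0 s; have h2 := v'0 s; rewrite ler_norml; split; first by rewrite divr_gt0// addr_gt0.
  by lra.
set c := (fun s => of_conf _ _ _) in fc cu cv cc len.
have hu s : nu K (c s) = u s by rewrite cu; field.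
have hv s : nv K (c s) = v s by rewrite cv; field.
have c0 : c 0 = p by apply: (@null_coord_inj _ K); rewrite ?hu ?hv ?u_0 ?v_0.
have c1 : c 1 = q by apply: (@null_coord_inj _ K); rewrite ?hu ?hv ?u_1 ?v_1.
suff e : arc_length K c = msep K p q by rewrite -e -c0 -c1; exact: path_arc.
pose S := Num.sqrt (F * G).
have S0 : 0 < S by rewrite sqrtr_gt0.
have S2 : S ^+ 2 = F * G by rewrite sqr_sqrtr// ltW.
have dom s : 0 < 1 - K * (S * f s / 2) ^+ 2.
  rewrite subr_gt0 (_ : K * _ = K * S ^+ 2 * f s ^+ 2 / 4); last by field.
  by rewrite S2.
rewrite len; transitivity (2 * artan K (S * f 1 / 2) - 2 * artan K (S * f 0 / 2)).
  2: by rewrite f_0 f_1 mulr0 mul0r artan0 mulr0 subr0 mulr1.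
apply: (@Rintegral_derive R _ (fun s => 2 * artan K (S * f s / 2)) cc) => s s01.
have dSf : is_derive s 1 (fun s => S * f s / 2) (S * f' s / 2).
  by have := df s => h; apply: is_derive_eq; rewrite /GRing.scale/=; ring.
have dc := @is_derive1_comp R (artan K) (fun s => S * f s / 2) s _ _ (is_derive_artan (dom s)) dSf.
rewrite (_ : (fun s => 2 * _) = (fun s => 2 * (artan K \o (fun s => S * f s / 2)) s))//.
apply: is_derive_eq; rewrite /GRing.scale/=.
rewrite (_ : (u' s + v' s) / 2 - (v' s - u' s) / 2 = u' s); last by field.
rewrite (_ : (u' s + v' s) / 2 + (v' s - u' s) / 2 = v' s); last by field.
have dcs : base_dia K a b (c s).
  by move=> K0; rewrite hu hv; split; [exact: su | exact: sv].
have := dstereo_mul sab dcs.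
have -> : stereo1 K a b (c s) = F * f s by rewrite /stereo1 hu istereoK.
have -> : stereo2 K a b (c s) = G * f s by rewrite /stereo2 hv istereoK.
have -> : 1 - K * (F * f s * (G * f s)) / 4 = 1 - K * (S * f s / 2) ^+ 2.
  rewrite (_ : (S * f s / 2) ^+ 2 = S ^+ 2 * f s ^+ 2 / 4); last by field.
  by rewrite S2; field.
rewrite hu hv => sp.
have eu := distereoE (F * f s) sab; have ev := distereoE (G * f s) sba.
move: (dom s) sp; set D := 1 - _ => D0 sp.
(* [distereo] cancels [dstereo], so the product of the null speeds is a perfect square and the root
   disappears. *)
have h1 : u' s * v' s = (S * f' s / (cfac K (c s) * D)) ^+ 2.
  have p1 : dstereo K a b (u s) != 0.
    by rewrite gt_eqF//; apply: dstereo_gt0 => //; exact: su.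
  have p2 : dstereo K b a (v s) != 0.
    by rewrite gt_eqF//; apply: dstereo_gt0 => //; exact: sv.
  have eu' : distereo K a b (F * f s) = (dstereo K a b (u s))^-1.
    by apply: (mulfI p1); rewrite eu divff.
  have ev' : distereo K b a (G * f s) = (dstereo K b a (v s))^-1.
    by apply: (mulfI p2); rewrite ev divff.
  rewrite expr_div_n exprMn S2 -sp /u' /v' eu' ev'.
  by field; rewrite p1 p2.
have cf0 := cfac_gt0 K (c s).
rewrite h1 sqrtr_sqr ger0_norm; last by rewrite ltW// divr_gt0 ?mulr_gt0.
by field; rewrite !gt_eqF.
Qed.

End geodesic_paths.

(** * The time separation of the model spaces *)

Section time_separation.
Context {R : realType}.
Implicit Types (K a b s t F G : R) (p q r : R * R).

Lemma null_point K (u v : R) : (K != 0 -> `|u + csign K * v| < pi) ->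
  exists p, nu K p = u /\ nv K p = v.
Proof.
move=> h; exists (of_conf K ((u + v) / 2) ((v - u) / 2)).
have e : ceta K (of_conf K ((u + v) / 2) ((v - u) / 2)) = (u + v) / 2.
  apply: ceta_of_conf => Kp; have := h (lt0r_neq0 Kp).
  by rewrite /csign Kp mul1r normrM (ger0_norm (_ : 0 <= 2^-1))// ltr_pM2r.
have x : cxi K (of_conf K ((u + v) / 2) ((v - u) / 2)) = (v - u) / 2.
  apply: cxi_of_conf => Kn; have := h (ltr0_neq0 Kn).
  by rewrite /csign (lt_gtF Kn) mulN1r distrC normrM (ger0_norm (_ : 0 <= 2^-1))// ltr_pM2r.
by rewrite /nu /nv e x; split; field.
Qed.

(** For [K > 0] the mixed sum [nu q + nv p] is twice the conformal time of a corner of the diamond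
    between [p] and [q], which lies between those of [p] and [q]. *)
Lemma Jle_dia K p q : 0 <= K -> Jle K p q -> dia K p q.
Proof.
move=> K0 [hu hv] Kn0; have Kp : 0 < K by rewrite lt_def Kn0.
have := strip p Kn0; have := strip q Kn0; rewrite /csign Kp !mul1r !ltr_norml.
by move=> /andP[? ?] /andP[? ?]; split; apply/andP; split; lra.
Qed.

Lemma path_through K p q r l : Jle K r q -> future_causal_path K p r l ->
  exists2 l', future_causal_path K p q l' & l <= l'.
Proof.
move=> Jrq pr; have [<-|/eqP rq] := eqVneq r q; first by exists l.
have [l' rql] := Jle_path Jrq rq; exists (l + l'); first exact: path_cat pr rql.
by rewrite lerDl; have [] := path_Jle rql.
Qed.

Lemma sep_of_stereo K a b q W : 0 <= W ->
  stereo1 K a b q * stereo2 K a b q = (2 * W) ^+ 2 -> sep K a b q = 2 * artan K W.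
Proof.
move=> W0 e; rewrite /sep e sqrtr_sqr ger0_norm ?mulr_ge0//.
by congr (_ * artan _ _); field.
Qed.

(* Beyond the domain [dia] the path can first run close to the horizon of
   [p], where the separation from [p] tends to the diameter. *)
Lemma long_path K p q (M : R) : K < 0 -> Jle K p q -> ~ dia K p q ->
  0 < M -> M < pi * crad K ->
  exists2 l, future_causal_path K p q l & M <= l.
Proof.
move=> Kn [hu hv] ndia M0 MD; have K0 := ltr0_neq0 Kn; have r0 := crad_gt0 K0.
set a := nu K p; set b := nv K p; rewrite -/a -/b in hu hv.
have cs : csign K = -1 by rewrite /csign (lt_gtF Kn).
have sab : base_strip K a b := base_strip_pt p.
have sba : base_strip K b a := base_strip_swap sab.
(* [F G = (2 W)^2] describes the points at separation [M] from [p]. *)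
have [W W0 AW] : exists2 W, 0 < W & 2 * artan K W = M.
  have hM : M / 2 / crad K \in `](- (pi / 2)), (pi / 2)[.
    rewrite in_itv/=; apply/andP; split.
      by apply: (@lt_trans _ _ 0); rewrite ?divr_gt0// oppr_lt0 divr_gt0// pi_gt0.
    by rewrite ltr_pdivrMr//; lra.
  exists (crad K * tan (M / 2 / crad K)); last first.
    rewrite /artan (negPf K0) (lt_gtF Kn).
    have -> : crad K * tan (M / 2 / crad K) / crad K = tan (M / 2 / crad K).
      by field; rewrite gt_eqF.
    by rewrite tanK//; field; rewrite gt_eqF.
  rewrite mulr_gt0// -(@tan0 R) ltr_tan// ?divr_gt0//.
  by rewrite in_itv/= oppr_lt0 andbb divr_gt0 ?pi_gt0.
have [s1 s2] := (strip p K0, strip q K0).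
move: s1 s2; rewrite cs !mulN1r -/a -/b !ltr_norml => /andP[s1 s2] /andP[s3 s4].
have fin r : nu K r <= nu K q -> nv K r <= nv K q -> dia K p r -> a < nu K r -> b < nv K r ->
    stereo1 K a b r * stereo2 K a b r = (2 * W) ^+ 2 ->
    exists2 l, future_causal_path K p q l & M <= l.
  move=> ru rv dr ar br e; have := msep_path ar br dr.
  by rewrite /msep (sep_of_stereo (ltW W0) e) AW; apply: path_through.
have [uq|uq] := ltP (nu K q) (b + pi).
  have vq : a + pi <= nv K q.
    rewrite leNgt; apply/negP => vq; apply: ndia => _; rewrite cs !mulN1r -/a -/b !ltr_norml.
    by split; apply/andP; split; lra.
  (* The midpoint of [a] and [b + pi] keeps [u] away from the pole. The [v] that solves
     [F G = (2 W)^2] is below [a + pi], hence below [nv K q], so the point [r] precedes [q]. *)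
  pose u := Num.min (nu K q) ((a + b + pi) / 2).
  have au : a < u by rewrite lt_min; apply/andP; split; lra.
  have ub : u < b + pi by rewrite gt_min; apply/orP; right; lra.
  have uu : u <= nu K q by rewrite ge_min lexx.
  have du : K != 0 -> `|u + csign K * b| < pi by move=> _; rewrite cs mulN1r ltr_norml; lra.
  have F0 : 0 < stereo K a b u by exact: stereo_gt0.
  set F := stereo K a b u in F0.
  pose v := istereo K b a ((2 * W) ^+ 2 / F).
  have bv : b < v by apply: istereo_gt => //; rewrite divr_gt0// exprn_gt0// mulr_gt0.
  have := istereo_dia b a ((2 * W) ^+ 2 / F) K0.
  rewrite -/v cs mulN1r => dv; move: (dv); rewrite ltr_norml => /andP[v1 v2].
  have [|r [ru rv]] := @null_point K u v.
    by move=> _; rewrite cs mulN1r ltr_norml; lra.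
  apply: (fin r); rewrite ?ru ?rv//; first by lra.
    by move=> _; rewrite ru rv; split; [exact: du | rewrite cs mulN1r].
  by rewrite /stereo1 /stereo2 ru rv -/F istereoK// mulrC divfK// gt_eqF.
pose v := Num.min (nv K q) ((a + b + pi) / 2).
have bv : b < v by rewrite lt_min; apply/andP; split; lra.
have va : v < a + pi by rewrite gt_min; apply/orP; right; lra.
have vv : v <= nv K q by rewrite ge_min lexx.
have dv : K != 0 -> `|v + csign K * a| < pi by move=> _; rewrite cs mulN1r ltr_norml; lra.
have G0 : 0 < stereo K b a v by exact: stereo_gt0.
set G := stereo K b a v in G0.
pose u := istereo K a b ((2 * W) ^+ 2 / G).
have au : a < u by apply: istereo_gt => //; rewrite divr_gt0// exprn_gt0// mulr_gt0.
have := istereo_dia a b ((2 * W) ^+ 2 / G) K0.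
rewrite -/u cs mulN1r => du; move: (du); rewrite ltr_norml => /andP[u1 u2].
have [|r [ru rv]] := @null_point K u v.
  by move=> _; rewrite cs mulN1r ltr_norml; lra.
apply: (fin r); rewrite ?ru ?rv//; first by lra.
  by move=> _; rewrite ru rv; split; [rewrite cs mulN1r | exact: dv].
by rewrite /stereo1 /stereo2 ru rv -/G istereoK// divfK// gt_eqF.
Qed.

Lemma model_causE K p q : model_caus K p q <-> Jle K p q.
Proof.
split=> [[->|[l /path_Jle[]//]]|J]; first by split.
by have [->|/eqP pq] := eqVneq p q; [left | right; exact: Jle_path].
Qed.

Lemma model_tau_ge0 K p q : (0 <= model_tau K p q)%E.
Proof. by apply: ereal_sup_ubound; left. Qed.

Lemma path_le_model_tau K p q l : future_causal_path K p q l ->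
  (l%:E <= model_tau K p q)%E.
Proof. by move=> h; apply: ereal_sup_ubound; right; exists l. Qed.

Lemma model_tau_msep K p q : Jle K p q -> dia K p q ->
  model_tau K p q = (msep K p q)%:E.
Proof.
move=> J dq; have [Ju Jv] := J; have sp := @base_strip_pt R K p.
have m0 : 0 <= msep K p q by exact: sep_ge0.
apply/eqP; rewrite eq_le; apply/andP; split.
  apply: ge_ereal_sup => e [->|[l pl ->]]; rewrite lee_fin//.
  exact: path_length_le.
have [uu|uu] := ltP (nu K p) (nu K q); last first.
  have e : nu K q = nu K p by apply/eqP; rewrite eq_le uu Ju.
  rewrite /msep (@sep_of_stereo _ _ _ _ 0) ?artan0 ?mulr0 ?model_tau_ge0//.
  by rewrite /stereo1 e stereo_base mul0r expr0n.
have [vv|vv] := ltP (nv K p) (nv K q); last first.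
  have e : nv K q = nv K p by apply/eqP; rewrite eq_le vv Jv.
  rewrite /msep (@sep_of_stereo _ _ _ _ 0) ?artan0 ?mulr0 ?model_tau_ge0//.
  by rewrite /stereo2 e stereo_base mulr0 expr0n.
exact/path_le_model_tau/msep_path.
Qed.

Lemma model_tau_gt0 K p q : (0 < model_tau K p q)%E ->
  [/\ Jle K p q & nu K p + nv K p < nu K q + nv K q].
Proof.
move=> h; have [[l pl]|np] := pselect (exists l, future_causal_path K p q l).
  by have [] := path_Jle pl.
suff e : model_tau K p q = 0%E by rewrite e ltxx in h.
apply/eqP; rewrite eq_le model_tau_ge0 andbT.
by apply: ge_ereal_sup => e [->//|[l pl _]]; case: np; exists l.
Qed.

Lemma model_diameter_lt0 K : K < 0 -> model_diameter K = (pi * crad K)%:E.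
Proof. by move=> Kn; rewrite /model_diameter Kn /crad ltr0_norm. Qed.

(** Outside [dia], [long_path] supplies lengths above every number below the diameter, so the
    supremum cannot be smaller than the diameter. *)
Lemma model_tau_dia K p q : Jle K p q -> (model_tau K p q < model_diameter K)%E ->
  dia K p q.
Proof.
move=> J; have [K0 _|Kn] := leP 0 K; first exact: Jle_dia.
rewrite model_diameter_lt0// => h; apply: contrapT => nd.
have D0 : 0 < pi * crad K by rewrite mulr_gt0 ?pi_gt0 ?crad_gt0 ?ltr0_neq0.
move: h (model_tau_ge0 K p q) (@path_le_model_tau K p q).
case: (model_tau K p q) => // x; rewrite lte_fin lee_fin => xD x0 ub.
pose M := (x + pi * crad K) / 2.
have [|//|l pl Ml] := @long_path K p q M Kn J nd; rewrite /M; try lra.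
by have := ub _ pl; rewrite lee_fin; move: Ml; rewrite /M; lra.
Qed.

Lemma msep_lt_diameter K p q : ((msep K p q)%:E < model_diameter K)%E.
Proof.
rewrite /model_diameter; case: ifPn => [Kn|_]; last exact: ltry.
have r0 := crad_gt0 (ltr0_neq0 Kn).
rewrite -(ltr0_norm Kn) -/(crad K) lte_fin /msep /sep /artan (negPf (ltr0_neq0 Kn)) (lt_gtF Kn).
set w := atan _; have : w < pi / 2 by exact: atan_ltpi2.
rewrite -(ltr_pM2l r0) => h.
by rewrite (_ : pi * crad K = 2 * (crad K * (pi / 2))) ?ltr_pM2l//; field.
Qed.

(** [sn] and [csn] solve [f'' = K f] with initial values [0, 1] and [1, 0]. The sign is opposite to
    the Riemannian one because the geodesics are timelike. *)
Definition sn K s : R :=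
  if K == 0 then s else
  if 0 < K then crad K * sinh (s / crad K) else crad K * sin (s / crad K).

Definition csn K s : R :=
  if K == 0 then 1 else
  if 0 < K then cosh (s / crad K) else cos (s / crad K).

Definition chord K s : R := 4 * sn K (s / 2) ^+ 2.

(** The identity [sin^2 = tan^2 / (1 + tan^2)] in curvature [K]. For [K > 0] the logarithm is undone
    by [y = expR (ln z / 2)], for which [y^2 = z]. *)
Lemma sn_artan K W : 0 < 1 - K * W ^+ 2 ->
  sn K (artan K W) ^+ 2 = W ^+ 2 / (1 - K * W ^+ 2).
Proof.
rewrite /sn /artan; have [->|K0] := eqVneq K 0.
  by rewrite mul0r subr0 divr1.
have r0 := crad_gt0 K0; move=> h.
have [Kp|Kp] := ltP 0 K.
  have := artan_dom Kp h; rewrite ltr_norml => /andP[h1 h2].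
  have n0 : 0 < 1 - W / crad K by rewrite subr_gt0.
  have p0 : 0 < 1 + W / crad K by rewrite -ltrBlDl sub0r.
  set z := (1 + _) / _.
  have -> : crad K / 2 * ln z / crad K = 2^-1 * ln z by field; rewrite gt_eqF.
  have z0 : 0 < z by rewrite divr_gt0.
  have e : expR (2^-1 * ln z) ^+ 2 = z.
    by rewrite -expRM_natl mulrA divff// mul1r lnK.
  have e0 := expR_gt0 (2^-1 * ln z).
  rewrite /sinh expRN; move: (expR _) e e0 => y e y0.
  rewrite (_ : (crad K * ((y - y^-1) / 2)) ^+ 2 = crad K ^+ 2 * ((y ^+ 2 - 1) ^+ 2 / (4 * y ^+ 2))); last by field; rewrite gt_eqF.
  have eK : K = (crad K ^+ 2)^-1 by rewrite crad2 gtr0_norm// invrK.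
  rewrite e [X in _ = _ / (1 - X * _)]eK /z.
  have k1 : crad K - W != 0.
    rewrite (_ : crad K - W = crad K * (1 - W / crad K)) ?mulf_neq0 ?gt_eqF//.
    by field; rewrite gt_eqF.
  have k2 : crad K + W != 0.
    rewrite (_ : crad K + W = crad K * (1 + W / crad K)) ?mulf_neq0 ?gt_eqF//.
    by field; rewrite gt_eqF.
  field; rewrite k1 k2 (gt_eqF r0)/=.
  by rewrite (_ : crad K ^+ 2 - W ^+ 2 = (crad K - W) * (crad K + W)) ?mulf_neq0//; ring.
have {}Kp : K < 0 by rewrite lt_neqAle K0.
have eK : K = - (crad K ^+ 2)^-1 by rewrite crad2 ltr0_norm// invrK opprK.
rewrite [crad K * atan _]mulrC mulfK ?gt_eqF//.
set w := W / crad K; have w0 := oneDsqr_gt0 w.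
have c2 : cos (atan w) ^+ 2 = (1 + w ^+ 2)^-1.
  by rewrite cos_atan exprVn sqr_sqrtr// ltW.
rewrite exprMn sin2cos2 c2 [X in _ = _ / (1 - X * _)]eK /w.
have q0 : 0 < crad K ^+ 2 + W ^+ 2 by rewrite ltr_pwDl ?exprn_gt0 ?sqr_ge0.
field; rewrite (gt_eqF r0)/= ?mulN1r ?opprK gt_eqF//=.
Qed.

Definition chordal K p q : R :=
  - model_form K (model_map K p - model_map K q) (model_map K p - model_map K q).

Lemma model_mapE K p : model_map K p =
  if K == 0 then row3 p.1 p.2 0 else
  if 0 < K then row3 (crad K * sinh p.1) (crad K * (cosh p.1 * cos p.2)) (crad K * (cosh p.1 * sin p.2))
  else row3 (crad K * (cosh p.2 * cos p.1)) (crad K * (cosh p.2 * sin p.1)) (crad K * sinh p.2).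
Proof. by rewrite /model_map; case: p => t x; case: eqP => //; case: ifP; rewrite row3Z. Qed.

Lemma row3B (x y z x' y' z' : R) :
  row3 x y z - row3 x' y' z' = row3 (x - x') (y - y') (z - z').
Proof. by apply/rowP => i; rewrite !mxE; case: i => [[|[|[|]]]]. Qed.

Lemma cosB_gd (x y : R) : cos (gd x - gd y) * (cosh x * cosh y) = 1 + sinh x * sinh y.
Proof.
rewrite cosD sinN cosN !cos_gd !sin_gd.
by field; rewrite !gt_eqF ?cosh_gt0.
Qed.

Lemma half_sin_sin (e x e' x' : R) :
  2 * (sin ((e' - x' - (e - x)) / 2) * sin ((e' + x' - (e + x)) / 2)) =
  cos (x' - x) - cos (e' - e).
Proof.
rewrite mul2_sin_sin; congr (_ - _); last by congr cos; field.
by rewrite -cosN; congr cos; field.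
Qed.

(** [cosB_gd] turns the ambient product into a difference of cosines of conformal coordinates, and
    this is a product of sines of half the null differences. So the sign of the chord records
    causality. *)
Lemma chordal_conf K p q : chordal K p q =
  if K == 0 then (nu K q - nu K p) * (nv K q - nv K p)
  else 4 * cfac K p * cfac K q * (sin ((nu K q - nu K p) / 2) * sin ((nv K q - nv K p) / 2)).
Proof.
rewrite /chordal !model_mapE /nu /nv /ceta /cxi /cfac.
have [->|K0] := eqVneq K 0.
  by rewrite !ltxx row3B model_form3 ltxx; ring.
have [Kp|Kp] := ltP 0 K.
  rewrite !ltNge !(ltW Kp)/= row3B model_form3 ltNge (ltW Kp)/=.
  transitivity (2 * crad K ^+ 2 * (cosh p.1 * cosh q.1) *
    (2 * (sin ((gd q.1 - q.2 - (gd p.1 - p.2)) / 2) * sin ((gd q.1 + q.2 - (gd p.1 + p.2)) / 2)))); last by ring.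
  rewrite half_sin_sin.
  transitivity (2 * crad K ^+ 2 * (cosh p.1 * cosh q.1 * cos (q.2 - p.2) - (1 + sinh q.1 * sinh p.1))); last by rewrite -cosB_gd; ring.
  rewrite cosD sinN cosN.
  have := cosh2Bsinh2 p.1; have := cosh2Bsinh2 q.1; have := cos2Dsin2 p.2; have := cos2Dsin2 q.2.
  move: (cosh p.1) (cosh q.1) (sinh p.1) (sinh q.1) (cos p.2) (cos q.2) (sin p.2) (sin q.2).
  move=> C C' S S' k k' l l' h1 h2 h3 h4.
  transitivity (crad K ^+ 2 * ((S ^+ 2 + S' ^+ 2 - 2 * S * S')
     - C ^+ 2 * (k ^+ 2 + l ^+ 2) - C' ^+ 2 * (k' ^+ 2 + l' ^+ 2) + 2 * C * C' * (k * k' + l * l'))); first by ring.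
  rewrite h1 h2; have -> : S ^+ 2 = C ^+ 2 - 1 by rewrite -h4; ring.
  have -> : S' ^+ 2 = C' ^+ 2 - 1 by rewrite -h3; ring.
  by ring.
have {}Kp : K < 0 by rewrite lt_neqAle K0.
rewrite Kp row3B model_form3 Kp/=.
transitivity (2 * crad K ^+ 2 * (cosh p.2 * cosh q.2) *
    (2 * (sin ((q.1 - gd q.2 - (p.1 - gd p.2)) / 2) * sin ((q.1 + gd q.2 - (p.1 + gd p.2)) / 2)))); last by ring.
rewrite half_sin_sin.
transitivity (2 * crad K ^+ 2 * ((1 + sinh q.2 * sinh p.2) - cosh p.2 * cosh q.2 * cos (q.1 - p.1))); last by rewrite -cosB_gd; ring.
rewrite cosD sinN cosN.
have := cosh2Bsinh2 p.2; have := cosh2Bsinh2 q.2; have := cos2Dsin2 p.1; have := cos2Dsin2 q.1.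
move: (cosh p.2) (cosh q.2) (sinh p.2) (sinh q.2) (cos p.1) (cos q.1) (sin p.1) (sin q.1).
move=> C C' S S' k k' l l' h1 h2 h3 h4.
transitivity (crad K ^+ 2 * (- (S ^+ 2 + S' ^+ 2 - 2 * S * S')
   + C ^+ 2 * (k ^+ 2 + l ^+ 2) + C' ^+ 2 * (k' ^+ 2 + l' ^+ 2) - 2 * C * C' * (k * k' + l * l'))); first by ring.
rewrite h1 h2; have -> : S ^+ 2 = C ^+ 2 - 1 by rewrite -h4; ring.
have -> : S' ^+ 2 = C' ^+ 2 - 1 by rewrite -h3; ring.
by ring.
Qed.

(** Both sides equal [F G / (1 - K F G / 4)]: the left by [sn_artan], the right by [chordal_conf]
    and [stereo_mul_cos]. *)
Lemma chord_msep K p q : Jle K p q -> dia K p q -> chord K (msep K p q) = chordal K p q.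
Proof.
move=> [Ju Jv] dq; set a := nu K p; set b := nv K p.
have sab : base_strip K a b := base_strip_pt p.
have P0 := stereo_mul_ge0 sab dq Ju Jv; have D0 := stereo_mul_lt1 sab dq.
rewrite /chord /msep /sep -/a -/b (_ : 2 * _ / 2 = artan K (Num.sqrt (stereo1 K a b q * stereo2 K a b q) / 2)); last by field.
rewrite sn_artan ?sqrt_half_sqr// expr_div_n sqr_sqrtr// chordal_conf.
have [K0|K0] := eqVneq K 0.
  rewrite K0 mul0r mul0r subr0 /stereo1 /stereo2 /stereo eqxx -?K0 -/a -/b; by field.
have := stereo_mul_cos K0 sab dq; set P := stereo1 _ _ _ _ * _ => ->.
rewrite /P /stereo1 /stereo2 /stereo (negPf K0) !cfacE// -/a -/b.
have [uq vq] := dq K0; have := cos_half_gt0 uq; have := cos_half_gt0 vq.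
have := cos_half_gt0 (strip q K0); have := cos_half_gt0 (sab K0) => h1 h2 h3 h4.
by field; rewrite !gt_eqF.
Qed.

(** In this range each sine has the sign of its null difference; farther away in the universal cover
    the signs repeat periodically. *)
Lemma chordal_ge0_Jle K p q :
  (K != 0 -> `|nu K q - nu K p| < 2 * pi /\ `|nv K q - nv K p| < 2 * pi) ->
  0 <= chordal K p q -> Jle K p q \/ Jle K q p.
Proof.
move=> small; rewrite chordal_conf => h.
have [uu|uu] := leP (nu K p) (nu K q); have [vv|vv] := leP (nv K p) (nv K q).
- by left.
- move: uu; rewrite le_eqVlt => /predU1P[e|uu]; first by right; rewrite /Jle e lexx ltW.
  exfalso; move: h small; case: eqVneq => [_|K0 h /(_ isT)[]].
    by rewrite leNgt pmulr_rlt0 ?subr_gt0// subr_lt0 vv.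
  rewrite !ltr_norml => /andP[? ?] /andP[? ?]; move: h; rewrite leNgt => /negP; apply.
  rewrite pmulr_rlt0; last by rewrite !mulr_gt0 ?cfac_gt0.
  rewrite pmulr_rlt0; last by apply: sin_gt0_pi; lra.
  by rewrite -oppr_gt0 -sinN; apply: sin_gt0_pi; lra.
- move: vv; rewrite le_eqVlt => /predU1P[e|vv]; first by right; rewrite /Jle e lexx ltW.
  exfalso; move: h small; case: eqVneq => [_|K0 h /(_ isT)[]].
    by rewrite leNgt nmulr_rlt0 ?subr_lt0// subr_gt0 vv.
  rewrite !ltr_norml => /andP[? ?] /andP[? ?]; move: h; rewrite leNgt => /negP; apply.
  rewrite pmulr_rlt0; last by rewrite !mulr_gt0 ?cfac_gt0.
  rewrite nmulr_rlt0; first by apply: sin_gt0_pi; lra.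
  by rewrite -oppr_gt0 -sinN; apply: sin_gt0_pi; lra.
- by right; split; exact: ltW.
Qed.

End time_separation.

(** * Geodesics of the model spaces *)

Section model_geodesics.
Context {R : realType}.
Implicit Types (K s l : R) (p q : R * R) (c : R -> R * R).

Lemma csn2 K s : csn K s ^+ 2 - K * sn K s ^+ 2 = 1.
Proof.
rewrite /csn /sn; have [->|K0] := eqVneq K 0; first by ring.
have r0 := crad_gt0 K0; have := mul_crad2 K0; rewrite /csign.
have [Kp|Kp] := ltP 0 K => e.
  transitivity (cosh (s / crad K) ^+ 2 - K * crad K ^+ 2 * sinh (s / crad K) ^+ 2); first by ring.
  by rewrite e mul1r cosh2Bsinh2.
transitivity (cos (s / crad K) ^+ 2 - K * crad K ^+ 2 * sin (s / crad K) ^+ 2); first by ring.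
by rewrite e mulN1r opprK cos2Dsin2.
Qed.

Lemma sn0 K : sn K 0 = 0.
Proof.
rewrite /sn; case: eqP => // _; case: ifP => _; rewrite mul0r ?sinh0 ?sin0 mulr0//.
Qed.

Lemma csn0 K : csn K 0 = 1.
Proof. by rewrite /csn; case: eqP => // _; case: ifP => _; rewrite mul0r ?cosh0 ?cos0. Qed.

Lemma is_derive_sn K s : is_derive s 1 (sn K) (csn K s).
Proof.
rewrite /csn /sn; have [K0|K0] := eqVneq K 0; first exact: is_derive_id.
have r0 := crad_gt0 K0.
by case: (0 < K); apply: is_derive_eq; rewrite /GRing.scale/=; field; rewrite gt_eqF.
Qed.

Lemma is_derive_csn K s : is_derive s 1 (csn K) (K * sn K s).
Proof.
rewrite /csn /sn; have [K0|K0] := eqVneq K 0; first by rewrite K0 mul0r; exact: is_derive_cst.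
have r0 := crad_gt0 K0; have := mul_crad2 K0; rewrite /csign.
have [Kp|Kp] := ltP 0 K => e; apply: is_derive_eq; rewrite /GRing.scale/= mulrA.
  have -> : K * crad K = (crad K)^-1 by rewrite -[RHS]mul1r -e; field; rewrite gt_eqF.
  by ring.
have -> : K * crad K = - (crad K)^-1 by rewrite -mulN1r -e; field; rewrite gt_eqF.
by ring.
Qed.

Lemma chordE K s : chord K s = if K == 0 then s ^+ 2 else 2 / K * (csn K s - 1).
Proof.
rewrite /chord /sn /csn; have [K0|K0] := eqVneq K 0; first by field.
have r0 := crad_gt0 K0; have := mul_crad2 K0; rewrite /csign.
have es : s / crad K = s / 2 / crad K + s / 2 / crad K by field; rewrite gt_eqF.
have [Kp|Kp] := ltP 0 K => e.
  rewrite es coshD; have := cosh2Bsinh2 (s / 2 / crad K).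
  move: (cosh _) (sinh _) => C S h.
  have hC : C ^+ 2 = 1 + S ^+ 2 by rewrite -h; ring.
  have -> : C * C + S * S - 1 = 2 * S ^+ 2 by rewrite -expr2 hC; ring.
  rewrite exprMn; have -> : crad K ^+ 2 = K^-1 by rewrite -[RHS]mul1r -e; field.
  by field.
rewrite es cosD; have := cos2Dsin2 (s / 2 / crad K).
move: (cos _) (sin _) => C S h.
have hC : C ^+ 2 = 1 - S ^+ 2 by rewrite -h; ring.
have -> : C * C - S * S - 1 = - (2 * S ^+ 2) by rewrite -expr2 hC; ring.
rewrite exprMn; have -> : crad K ^+ 2 = - K^-1 by rewrite -mulN1r -e; field.
by field.
Qed.

Lemma sn_gt0 K s : 0 < s -> (s%:E < model_diameter K)%E -> 0 < sn K s.
Proof.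
rewrite /sn => s0; have [//|K0] := eqVneq K 0; have r0 := crad_gt0 K0.
have [Kp|Kp] := ltP 0 K => h; first by rewrite mulr_gt0// sinh_gt0 divr_gt0.
have {}Kp : K < 0 by rewrite lt_neqAle K0.
rewrite mulr_gt0//; apply: sin_gt0_pi; rewrite divr_gt0//=.
by move: h; rewrite model_diameter_lt0// lte_fin ltr_pdivrMr.
Qed.

Lemma lt_chord K s s' : 0 <= s -> s < s' -> (s'%:E < model_diameter K)%E ->
  chord K s < chord K s'.
Proof.
move=> s0 ss h; rewrite ltr_pM2l//.
suff : 0 <= sn K (s / 2) < sn K (s' / 2).
  by move=> /andP[h1 h2]; rewrite ltr_pXn2r// nnegrE// ltW// (le_lt_trans h1).
move: h; rewrite /sn; have [_ _|K0] := eqVneq K 0; first by lra.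
have r0 := crad_gt0 K0.
have lt2 : s / 2 / crad K < s' / 2 / crad K.
  have ri : 0 < (crad K)^-1 by rewrite invr_gt0.
  nra.
have [Kp|Kp] := ltP 0 K => h.
  rewrite ltr_pM2l// ltr_sinh lt2 andbT.
  rewrite mulr_ge0 ?(ltW r0)// -(@sinh0 R) leNgt ltr_sinh -leNgt.
  by rewrite !divr_ge0 ?(ltW r0).
have {}Kp : K < 0 by rewrite lt_neqAle K0.
move: h; rewrite model_diameter_lt0// lte_fin => h.
have b (y : R) : 0 <= y -> y < pi * crad K -> 0 <= y / 2 / crad K <= pi / 2.
  by move=> y0 yD; rewrite !divr_ge0 ?(ltW r0)//= ler_pdivrMr//; lra.
have /andP[a1 a2] := b s s0 (lt_trans ss h).
have /andP[b1 b2] := b s' (ltW (le_lt_trans s0 ss)) h.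
have p0 := pi_gt0 R.
rewrite ltr_pM2l// ltr_sin ?in_itv/= ?a2 ?b2 ?andbT; [|lra|lra].
rewrite lt2 andbT mulr_ge0 ?(ltW r0)//.
by apply: sin_ge0_pi; lra.
Qed.

Lemma chord_inj K s s' : 0 <= s -> 0 <= s' -> (s%:E < model_diameter K)%E ->
  (s'%:E < model_diameter K)%E -> chord K s = chord K s' -> s = s'.
Proof.
move=> s0 s0' sD sD' e; have [h|h|//] := ltgtP s s'.
  by have := lt_chord s0 h sD'; rewrite e ltxx.
by have := lt_chord s0' h sD; rewrite e ltxx.
Qed.

(* The law of cosines: the squared chord of the third side of a hinge with legs
   [a], [b] and angle [arcosh k]. *)
Definition hinge K (a b k : R) : R :=
  (if K == 0 then a ^+ 2 + b ^+ 2 else 2 / K * (csn K a * csn K b - 1))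
  - 2 * sn K a * sn K b * k.

Lemma hinge1 K a b : hinge K a b 1 = chord K (a - b).
Proof.
rewrite /hinge chordE; have [->|K0] := eqVneq K 0.
  by rewrite /sn eqxx; ring.
have -> : csn K (a - b) = csn K a * csn K b - K * (sn K a * sn K b).
  have := mul_crad2 K0; have r0 := crad_gt0 K0.
  rewrite /csn /sn (negPf K0) /csign mulrBl; have [Kp|Kp] := ltP 0 K => e.
    rewrite coshD coshN sinhN; transitivity (cosh (a / crad K) * cosh (b / crad K) - (K * crad K ^+ 2) * (sinh (a / crad K) * sinh (b / crad K))); last by ring.
    by rewrite e; ring.
  rewrite cosD cosN sinN; transitivity (cos (a / crad K) * cos (b / crad K) - (K * crad K ^+ 2) * (sin (a / crad K) * sin (b / crad K))); last by ring.
  by rewrite e; ring.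
by field.
Qed.

Lemma model_formE K (v w : 'rV[R]_3) : model_form K v w =
  - (v 0 0 * w 0 0) + (if K < 0 then -1 else 1) * (v 0 1 * w 0 1) + v 0 2 * w 0 2.
Proof. by rewrite {1}(row3_eta v) {1}(row3_eta w) model_form3. Qed.

Lemma model_form_sym K (v w : 'rV[R]_3) : model_form K v w = model_form K w v.
Proof. by rewrite !model_formE; ring. Qed.

Lemma model_form_lin K (k m : R) (v w z : 'rV[R]_3) :
  model_form K (k *: v + m *: w) z = k * model_form K v z + m * model_form K w z.
Proof. by rewrite !model_formE !mxE; ring. Qed.

Lemma model_form_map_tvec K p : K != 0 -> model_form K (model_map K p) (tvec K p) = 0.
Proof.
move=> K0; rewrite model_mapE /tvec (negPf K0); have [Kp|Kp] := ltP 0 K.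
  rewrite row3Z model_form3 ltNge (ltW Kp)/=; have e := cos2Dsin2 p.2.
  transitivity (crad K ^+ 2 * sinh p.1 * cosh p.1 * (cos p.2 ^+ 2 + sin p.2 ^+ 2 - 1)); first by ring.
  by rewrite e subrr mulr0.
have Kn : K < 0 by rewrite lt_neqAle K0.
by rewrite row3Z model_form3 Kn; ring.
Qed.

Lemma model_form_map_xvec K p : K != 0 -> model_form K (model_map K p) (xvec K p) = 0.
Proof.
move=> K0; rewrite model_mapE /xvec (negPf K0); have [Kp|Kp] := ltP 0 K.
  by rewrite row3Z model_form3 ltNge (ltW Kp)/=; ring.
have Kn : K < 0 by rewrite lt_neqAle K0.
rewrite row3Z model_form3 Kn; have e := cos2Dsin2 p.1.
transitivity (- (crad K ^+ 2 * sinh p.2 * cosh p.2 * (cos p.1 ^+ 2 + sin p.1 ^+ 2 - 1))); first by ring.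
by rewrite e subrr mulr0 oppr0.
Qed.

(** For [K != 0] the position and the two coordinate vectors form an orthogonal basis without null
    vectors. *)
Lemma model_frame_nondegenerate K p (z : 'rV[R]_3) : K != 0 ->
  model_form K z (model_map K p) = 0 -> model_form K z (tvec K p) = 0 ->
  model_form K z (xvec K p) = 0 -> z = 0.
Proof.
move=> K0; rewrite (row3_eta z) model_mapE /tvec /xvec (negPf K0).
move: (z 0 0) (z 0 1) (z 0 2) => z0 z1 z2; have r0 := crad_gt0 K0.
have z3 (y0 y1 y2 : R) : y0 = 0 -> y1 = 0 -> y2 = 0 -> row3 y0 y1 y2 = 0.
  by move=> -> -> ->; apply/rowP => i; rewrite !mxE; case: i => [[|[|[|]]]].
have [Kp|Kp] := ltP 0 K.
  rewrite !row3Z !model_form3 ltNge (ltW Kp)/=.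
  have := cosh2Bsinh2 p.1; have := cos2Dsin2 p.2; have := cosh_gt0 p.1.
  move: (cosh _) (sinh _) (cos _) (sin _) => C S k m C0 e h h1 h2 h3.
  (* [y] is the radial component of [(z1, z2)]: the first two equations form a hyperbolic rotation
     of [(y, z0)], and the third says that the angular component vanishes. *)
  pose y := z1 * k + z2 * m.
  have a1 : y * C - z0 * S = 0 by apply: (mulfI (lt0r_neq0 r0)); rewrite mulr0 -h1 /y; ring.
  have a2 : y * S - z0 * C = 0 by apply: (mulfI (lt0r_neq0 r0)); rewrite mulr0 -h2 /y; ring.
  have a3 : z2 * k - z1 * m = 0.
    by apply: (mulfI (lt0r_neq0 r0)); apply: (mulfI (lt0r_neq0 C0)); rewrite !mulr0 -h3; ring.
  have y0 : y = 0.
    transitivity ((y * C - z0 * S) * C - (y * S - z0 * C) * S); last by rewrite a1 a2; ring.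
    by rewrite -[LHS]mulr1 -h; ring.
  apply: z3.
  - transitivity ((y * C - z0 * S) * S - (y * S - z0 * C) * C); last by rewrite a1 a2; ring.
    by rewrite -[LHS]mulr1 -h; ring.
  - transitivity (y * k - (z2 * k - z1 * m) * m); last by rewrite y0 a3; ring.
    by rewrite -[LHS]mulr1 -e /y; ring.
  - transitivity (y * m + (z2 * k - z1 * m) * k); last by rewrite y0 a3; ring.
    by rewrite -[LHS]mulr1 -e /y; ring.
have Kn : K < 0 by rewrite lt_neqAle K0.
rewrite !row3Z !model_form3 Kn/=.
have := cosh2Bsinh2 p.2; have := cos2Dsin2 p.1; have := cosh_gt0 p.2.
move: (cosh _) (sinh _) (cos _) (sin _) => C S k m C0 e h h1 h2 h3.
pose y := z0 * k + z1 * m.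
have a1 : z2 * S - y * C = 0 by apply: (mulfI (lt0r_neq0 r0)); rewrite mulr0 -h1 /y; ring.
have a2 : z2 * C - y * S = 0 by apply: (mulfI (lt0r_neq0 r0)); rewrite mulr0 -h3 /y; ring.
have a3 : z0 * m - z1 * k = 0.
  by apply: (mulfI (lt0r_neq0 r0)); apply: (mulfI (lt0r_neq0 C0)); rewrite !mulr0 -h2; ring.
have y0 : y = 0.
  transitivity ((z2 * C - y * S) * S - (z2 * S - y * C) * C); last by rewrite a1 a2; ring.
  by rewrite -[LHS]mulr1 -h; ring.
apply: z3.
- transitivity (y * k + (z0 * m - z1 * k) * m); last by rewrite y0 a3; ring.
  by rewrite -[LHS]mulr1 -e /y; ring.
- transitivity (y * m - (z0 * m - z1 * k) * k); last by rewrite y0 a3; ring.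
  by rewrite -[LHS]mulr1 -e /y; ring.
- transitivity ((z2 * C - y * S) * C - (z2 * S - y * C) * S); last by rewrite a1 a2; ring.
  by rewrite -[LHS]mulr1 -h; ring.
Qed.

Lemma constant_itv (f : R -> R) l : {within `[0, l], continuous f} ->
  (forall s, 0 < s < l -> is_derive s 1 f 0) -> forall s, 0 <= s <= l -> f s = f 0.
Proof.
move=> cf df s /andP[s0 sl]; move: s0; rewrite le_eqVlt => /predU1P[<-//|s0].
have [| |x _] := @MVT R f (fun _ => 0) 0 s s0.
- move=> x; rewrite in_itv/= => /andP[x0 xs]; apply: df.
  by rewrite x0 (lt_le_trans xs).
- by apply: continuous_subspaceW cf => x/=; rewrite !in_itv/= => /andP[-> /le_trans->].
- by rewrite mul0r => /eqP; rewrite subr_eq0 => /eqP.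
Qed.

Lemma within_continuous_pt (A : set R) (f : R -> R) :
  (forall s, A s -> {for s, continuous f}) -> {within A, continuous f}.
Proof. by move=> cf; apply: continuous_in_subspaceT => x /set_mem; exact: cf. Qed.

(** Two first integrals of [z'' = K z], here [A] and [B], determine [z] by linear algebra. The
    second derivative is needed only in the open interval, which is all that a geodesic on [[0, l]]
    provides. *)
Lemma harmonic_itv K (z z1 : R -> R) l :
  (forall s, 0 <= s <= l -> is_derive s 1 z (z1 s)) ->
  (forall s, 0 <= s <= l -> {for s, continuous z1}) ->
  (forall s, 0 < s < l -> is_derive s 1 z1 (K * z s)) ->
  forall s, 0 <= s <= l -> z s = csn K s * z 0 + sn K s * z1 0.
Proof.
move=> dz cz dz1.
have cs s : {for s, continuous (sn K)} by exact: is_derive_continuous (is_derive_sn K s).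
have cc s : {for s, continuous (csn K)} by exact: is_derive_continuous (is_derive_csn K s).
have czs s : 0 <= s <= l -> {for s, continuous z} by move=> /dz /is_derive_continuous.
have A s : 0 <= s <= l -> z s * csn K s - z1 s * sn K s = z 0.
  move=> sl; transitivity (z 0 * csn K 0 - z1 0 * sn K 0).
    2: by rewrite sn0 csn0 mulr0 mulr1 subr0.
  apply: (@constant_itv (fun s => z s * csn K s - z1 s * sn K s) l) => //.
  - apply: within_continuous_pt => y; rewrite /= in_itv/= => yl.
    apply: cvgB; apply: cvgM; [exact: czs | exact: cc | exact: cz | exact: cs].
  - move=> y yl; have yl' : 0 <= y <= l by case/andP: yl => *; rewrite !ltW.
    have h1 := is_deriveM (dz y yl') (is_derive_csn K y).
    have h2 := is_deriveM (dz1 y yl) (is_derive_sn K y).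
    have h := is_deriveB h1 h2; apply: is_derive_eq.
    by rewrite /GRing.scale/=; ring.
have B s : 0 <= s <= l -> z1 s * csn K s - K * z s * sn K s = z1 0.
  move=> sl; transitivity (z1 0 * csn K 0 - K * z 0 * sn K 0).
    2: by rewrite sn0 csn0 mulr0 mulr1 subr0.
  apply: (@constant_itv (fun s => z1 s * csn K s - K * z s * sn K s) l) => //.
  - apply: within_continuous_pt => y; rewrite /= in_itv/= => yl.
    apply: cvgB; apply: cvgM; [exact: cz | exact: cc | | exact: cs].
    by apply: cvgM; [exact: cvg_cst | exact: czs].
  - move=> y yl; have yl' : 0 <= y <= l by case/andP: yl => *; rewrite !ltW.
    have h1 := is_deriveM (dz1 y yl) (is_derive_csn K y).
    have h3 : is_derive y 1 (fun y => K * z y) (K * z1 y).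
      by have := dz y yl' => hz; apply: is_derive_eq.
    have h2 := is_deriveM h3 (is_derive_sn K y).
    have h := is_deriveB h1 h2; apply: is_derive_eq.
    by rewrite /GRing.scale/=; ring.
move=> s sl; rewrite -(A s sl) -(B s sl) -[LHS]mulr1 -(csn2 K s); ring.
Qed.

End model_geodesics.

(** * Geodesics as ambient curves *)

Section geodesic_equation.
Context {R : realType}.
Implicit Types (K s l : R) (p q : R * R) (c : R -> R * R).

Lemma is_derive_coord (f : R -> 'rV[R]_3) s d i :
  is_derive s 1 f d -> is_derive s 1 (fun s => f s 0 i) (d 0 i).
Proof.
move=> h; have df : derivable f s 1 by exact: ex_derive.
apply: DeriveDef; first by have /derivable_mxP := df; apply.
have := derive_mx df; rewrite (@derive_val _ _ _ _ _ _ _ h) => ->.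
by rewrite mxE.
Qed.

Lemma derivable_tvec K c s (t' x' : R) :
  is_derive s 1 (fst \o c) t' -> is_derive s 1 (snd \o c) x' ->
  derivable (fun s => tvec K (c s)) s 1.
Proof.
have -> : c = fun s => ((fst \o c) s, (snd \o c) s).
  by apply/funext => y /=; case: (c y).
move: (fst \o c) (snd \o c) => t x.
rewrite (_ : fst \o _ = t)// (_ : snd \o _ = x)// => dt dx.
rewrite /tvec; case: (K == 0); first exact: derivable_cst.
case: (0 < K) => /=.
  rewrite (_ : (fun _ => _) = fun s => row3 (crad K * cosh (t s))
    (crad K * (sinh (t s) * cos (x s))) (crad K * (sinh (t s) * sin (x s)))).
    by apply: ex_derive; apply: is_derive_row3.
  by apply/funext => y; rewrite row3Z.
rewrite (_ : (fun _ => _) = fun s => row3 (crad K * - (cosh (x s) * sin (t s)))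
    (crad K * (cosh (x s) * cos (t s))) (crad K * 0)).
  by apply: ex_derive; apply: is_derive_row3.
by apply/funext => y; rewrite row3Z.
Qed.

Lemma derivable_xvec K c s (t' x' : R) :
  is_derive s 1 (fst \o c) t' -> is_derive s 1 (snd \o c) x' ->
  derivable (fun s => xvec K (c s)) s 1.
Proof.
have -> : c = fun s => ((fst \o c) s, (snd \o c) s).
  by apply/funext => y /=; case: (c y).
move: (fst \o c) (snd \o c) => t x.
rewrite (_ : fst \o _ = t)// (_ : snd \o _ = x)// => dt dx.
rewrite /xvec; case: (K == 0); first exact: derivable_cst.
case: (0 < K) => /=.
  rewrite (_ : (fun _ => _) = fun s => row3 (crad K * 0)
    (crad K * - (cosh (t s) * sin (x s))) (crad K * (cosh (t s) * cos (x s)))).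
    by apply: ex_derive; apply: is_derive_row3.
  by apply/funext => y; rewrite row3Z.
rewrite (_ : (fun _ => _) = fun s => row3 (crad K * (sinh (x s) * cos (t s)))
    (crad K * (sinh (x s) * sin (t s))) (crad K * cosh (x s))).
  by apply: ex_derive; apply: is_derive_row3.
by apply/funext => y; rewrite row3Z.
Qed.

Lemma is_derive_model_form K (f g : R -> 'rV[R]_3) s (df dg : 'rV[R]_3) :
  is_derive s 1 f df -> is_derive s 1 g dg ->
  is_derive s 1 (fun s => model_form K (f s) (g s))
    (model_form K df (g s) + model_form K (f s) dg).
Proof.
move=> hf hg; rewrite !model_formE.
rewrite (_ : (fun _ => _) = fun s => - (f s 0 0 * g s 0 0)
  + (if K < 0 then -1 else 1) * (f s 0 1 * g s 0 1) + f s 0 2 * g s 0 2).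
  have f0 := is_derive_coord 0 hf; have f1 := is_derive_coord 1 hf.
  have f2 := is_derive_coord 2 hf; have g0 := is_derive_coord 0 hg.
  have g1 := is_derive_coord 1 hg; have g2 := is_derive_coord 2 hg.
  by apply: is_derive_eq; rewrite /GRing.scale/=; ring.
by apply/funext => y; rewrite model_formE.
Qed.

Lemma model_form_ambient_velocity K p (t' x' : R) : K != 0 ->
  model_form K (model_map K p) (t' *: tvec K p + x' *: xvec K p) = 0.
Proof.
move=> K0; rewrite model_form_sym model_form_lin ![model_form _ _ (model_map _ _)]model_form_sym.
by rewrite model_form_map_tvec// model_form_map_xvec// !mulr0 addr0.
Qed.

(** For [K != 0] the acceleration is normal, hence a multiple of the position [g]. Differentiating
    [b(g, g') = 0] with [b(g', g') = -1] gives [b(g, g'') = 1], and [b(g, g) = 1 / K] makes the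
    factor [K]. *)
Lemma geodesic_flow K c l : model_timelike_geodesic K c l ->
  let V := derive1 (ambient_curve K c) 0 in
  [/\ forall s, 0 <= s <= l -> model_map K (c s) = csn K s *: model_map K (c 0) + sn K s *: V,
      model_form K V V = -1,
      (K != 0 -> model_form K (model_map K (c 0)) V = 0),
      (forall s, 0 <= s <= l -> derive1 (fst \o c) s != 0) &
      (forall s, 0 <= s <= l -> is_derive s 1 (fst \o c) (derive1 (fst \o c) s) /\
          {for s, continuous (derive1 (fst \o c))})].
Proof.
move=> [l0 geo] V.
pose T := derive1 (fst \o c); pose X := derive1 (snd \o c).
pose g := ambient_curve K c.
pose G s : 'rV[R]_3 := T s *: tvec K (c s) + X s *: xvec K (c s).
have dt s : 0 <= s <= l -> is_derive s 1 (fst \o c) (T s).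
  by move=> /geo[[h _] _ _ _]; exact: derivable_is_derive1.
have dx s : 0 <= s <= l -> is_derive s 1 (snd \o c) (X s).
  by move=> /geo[[_ h] _ _ _]; exact: derivable_is_derive1.
have dT s : 0 <= s <= l -> is_derive s 1 T (derive1 T s).
  by move=> /geo[_ [h _] _ _]; exact: derivable_is_derive1.
have dX s : 0 <= s <= l -> is_derive s 1 X (derive1 X s).
  by move=> /geo[_ [_ h] _ _]; exact: derivable_is_derive1.
have dg s : 0 <= s <= l -> is_derive s 1 g (G s).
  by move=> sl; exact: is_derive_ambient (dt s sl) (dx s sl).
have dgE s : 0 <= s <= l -> derive1 g s = G s by move=> /dg /derive1_val.
have dG s : 0 <= s <= l -> is_derive s 1 G ('D_1 G s).
  move=> sl; apply: derivableP.
  have ht := derivable_tvec (K := K) (dt s sl) (dx s sl).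
  have hx := derivable_xvec (K := K) (dt s sl) (dx s sl).
  have hT := dT s sl; have hX := dX s sl.
  apply/derivable_mxP => i j; rewrite ord1.
  rewrite (_ : (fun s => _) = fun s => T s * tvec K (c s) 0 j + X s * xvec K (c s) 0 j).
    have ht' := is_derive_coord j (derivableP ht).
    have hx' := is_derive_coord j (derivableP hx).
    exact: ex_derive.
  by apply/funext => y; rewrite !mxE.
have normal s : 0 < s < l -> 'D_1 G s = K *: g s.
  move=> sl; have sl' : 0 <= s <= l by case/andP: sl => *; rewrite !ltW.
  have [_ _ unit nor] := geo s sl'; rewrite -/g in unit nor.
  (* [derive1 g] is known to be [G] only on [[0, l]], so the second derivative is identified at
     interior points, through a neighborhood. *)
  have e : derive1n 2 g s = 'D_1 G s.
    rewrite -[LHS]/(derive1 (derive1 g) s) derive1E; apply: near_eq_derive.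
    have sin : s \in `]0, l[ by rewrite in_itv.
    have := near_in_itvoo sin; apply: filterS => y.
    by rewrite in_itv/= => /andP[y0 yl]; rewrite dgE// !ltW.
  have nt : model_form K ('D_1 G s) (tvec K (c s)) = 0.
    by have := nor (1, 0); rewrite e model_diffE/= scale1r scale0r addr0.
  have nx : model_form K ('D_1 G s) (xvec K (c s)) = 0.
    by have := nor (0, 1); rewrite e model_diffE/= scale1r scale0r add0r.
  rewrite dgE// in unit.
  have [K0|K0] := eqVneq K 0.
    have n0 : 'D_1 G s 0 0 = 0.
      by move: nt; rewrite model_formE /tvec K0 eqxx ltxx !row3E/=; lra.
    have n1 : 'D_1 G s 0 1 = 0.
      by move: nx; rewrite model_formE /xvec K0 eqxx ltxx !row3E/=; lra.
    have n2 : 'D_1 G s 0 2 = 0.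
      have := is_derive_coord 2 (dG s sl').
      rewrite (_ : (fun s => G s 0 2) = cst 0); last first.
        by apply/funext => y; rewrite /G /tvec /xvec K0 eqxx !mxE/= !mulr0 addr0.
      by move=> h; rewrite -(@derive_val _ _ _ _ _ _ _ h) derive_cst.
    have -> : K *: g s = 0 by rewrite K0 scale0r.
    rewrite (row3_eta ('D_1 G s)) n0 n1 n2.
    by apply/rowP => i; rewrite !mxE; case: i => [[|[|[|]]]].
  have orth y : model_form K (g y) (G y) = 0 by exact: model_form_ambient_velocity.
  have gd1 : model_form K (g s) ('D_1 G s) = 1.
    have := is_derive_model_form K (dg s sl') (dG s sl').
    rewrite (_ : (fun s => _) = cst 0); last by apply/funext => y; rewrite orth.
    move=> h; have := @derive_val _ _ _ _ _ _ _ h; rewrite derive_cst unit.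
    lra.
  have lin (z : 'rV[R]_3) : model_form K ('D_1 G s - K *: g s) z =
      model_form K ('D_1 G s) z - K * model_form K (g s) z.
    by rewrite -[X in X - _]scale1r -scaleNr model_form_lin; ring.
  apply/eqP; rewrite -subr_eq0; apply/eqP; apply: (@model_frame_nondegenerate _ K (c s)) => //.
  - rewrite lin [X in X - _]model_form_sym gd1 model_map_quadric// divff// subrr//.
  - by rewrite lin nt model_form_map_tvec// mulr0 subr0.
  - by rewrite lin nx model_form_map_xvec// mulr0 subr0.
have l00 : 0 <= (0 : R) <= l by rewrite lexx ltW.
have VE : V = G 0 by rewrite /V dgE.
split.
- move=> s sl; apply/rowP => i; rewrite !mxE.
  rewrite VE; apply: (@harmonic_itv R K (fun s => g s 0 i) (fun s => G s 0 i) l) => //.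
  + by move=> y yl; exact: is_derive_coord (dg y yl).
  + by move=> y yl; exact: is_derive_continuous (is_derive_coord i (dG y yl)).
  + move=> y yl; have yl' : 0 <= y <= l by case/andP: yl => *; rewrite !ltW.
    by have := is_derive_coord i (dG y yl'); rewrite normal// mxE.
- by have [_ _ ->] := geo 0 l00.
- by move=> K0; rewrite VE; exact: model_form_ambient_velocity.
- move=> s sl; have [_ _ + _] := geo s sl; rewrite -/g dgE// model_form_conf => h.
  apply/eqP => T0; move: h; rewrite /T T0 (_ : deta _ _ _ = 0); last first.
    by rewrite /deta mulr0; case: ifP.
  rewrite expr0n sub0r mulrN opprK => h.
  have : 0 <= cfac K (c s) ^+ 2 * dxi K (c s) (X s) ^+ 2 by rewrite mulr_ge0 ?sqr_ge0.
  by rewrite h; lra.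
- by move=> s sl; split; [exact: dt | exact: is_derive_continuous (dT s sl)].
Qed.

Lemma model_form_sqr K (k m : R) (v w : 'rV[R]_3) :
  model_form K (k *: v + m *: w) (k *: v + m *: w) =
  k ^+ 2 * model_form K v v + m ^+ 2 * model_form K w w + 2 * k * m * model_form K v w.
Proof. by rewrite !model_formE !mxE; ring. Qed.

(** The difference of the two points splits as [(csn a - csn b) P + W], where [W] combines the
    velocities and is orthogonal to the position [P] if [K != 0]. *)
Lemma chordal_geodesics K c c' l l' a b :
  model_timelike_geodesic K c l -> model_timelike_geodesic K c' l' -> c 0 = c' 0 ->
  0 <= a <= l -> 0 <= b <= l' ->
  chordal K (c a) (c' b) = hinge K a b
    (- model_form K (derive1 (ambient_curve K c) 0) (derive1 (ambient_curve K c') 0)).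
Proof.
move=> gc gc' e al bl.
have [fl V2 PV _ _] := geodesic_flow gc; have [fl' V'2 PV' _ _] := geodesic_flow gc'.
rewrite /chordal /hinge fl// fl'// -e; rewrite -e in PV'.
move: PV PV' V2 V'2 (@model_map_quadric R K (c 0)).
move: (derive1 _ 0) (derive1 _ 0) (model_map _ _) => V' V P PV PV' V2 V'2 P2.
have -> : csn K a *: P + sn K a *: V - (csn K b *: P + sn K b *: V') =
  (csn K a - csn K b) *: P + 1 *: (sn K a *: V + (- sn K b) *: V').
  by rewrite scale1r scalerBl opprD scaleNr addrACA.
set W := _ + _ *: V'.
have W2 : model_form K W W = - sn K a ^+ 2 - sn K b ^+ 2 - 2 * sn K a * sn K b * model_form K V V'.
  by rewrite model_form_sqr V2 V'2; ring.
have [K0|K0] := eqVneq K 0.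
  have -> : csn K a - csn K b = 0 by rewrite /csn K0 eqxx subrr.
  rewrite scale0r add0r scale1r W2 /sn K0 eqxx; ring.
have WP : model_form K P W = 0.
  by rewrite model_form_sym model_form_lin ![model_form K _ P]model_form_sym PV// PV'// !mulr0 addr0.
rewrite model_form_sqr P2// W2 WP.
have ha := csn2 K a; have hb := csn2 K b.
have -> : sn K a ^+ 2 = (csn K a ^+ 2 - 1) / K by rewrite -ha; field.
have -> : sn K b ^+ 2 = (csn K b ^+ 2 - 1) / K by rewrite -hb; field.
by field.
Qed.

Lemma hinge0 K s k : hinge K 0 s k = chord K s.
Proof.
rewrite /hinge chordE sn0 csn0; case: eqP => _; first by ring.
by ring.
Qed.

Lemma chordal_geodesic K c l s : model_timelike_geodesic K c l -> 0 <= s <= l ->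
  chordal K (c 0) (c s) = chord K s.
Proof.
move=> gc sl; have l0 : 0 < l by case: gc.
have l00 : 0 <= (0 : R) <= l by rewrite lexx ltW.
by rewrite (chordal_geodesics gc gc (erefl _) l00 sl) hinge0.
Qed.

(** The separation and [l] have the same chord, so it remains to exclude [l] beyond the diameter,
    where [chord] is no longer injective. *)
Lemma geodesic_length K c l : model_timelike_geodesic K c l ->
  (0 < model_tau K (c 0%R) (c l) < model_diameter K)%E ->
  [/\ Jle K (c 0) (c l), dia K (c 0) (c l) & model_tau K (c 0) (c l) = l%:E].
Proof.
move=> gc /andP[t0 tD]; have l0 : 0 < l by case: gc.
have [J tt] := model_tau_gt0 t0; have dq := model_tau_dia J tD.
split=> //; have mt := model_tau_msep J dq; rewrite mt; congr EFin.
rewrite mt lte_fin in t0.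
have ce : chord K (msep K (c 0) (c l)) = chord K l.
  by rewrite chord_msep// (chordal_geodesic gc)// lexx ltW.
apply: (chord_inj (ltW t0) (ltW l0) (msep_lt_diameter K _ _) _ ce).
rewrite /model_diameter; case: ifPn => [Kn|_]; last exact: ltry.
have K0 := ltr0_neq0 Kn; have r0 := crad_gt0 K0.
rewrite lte_fin -(ltr0_norm Kn) -/(crad K) ltNge; apply/negP => lD.
have [fl _ _ nz dt] := geodesic_flow gc.
have tE r : nu K r + nv K r = 2 * r.1.
  by rewrite /nu /nv /ceta (lt_gtF Kn); ring.
rewrite !tE ltr_pM2l// in tt.
pose T := derive1 (fst \o c).
have ct : {within `[0, l], continuous (fst \o c)}.
  by apply: within_continuous_pt => s; rewrite /= in_itv/= => /dt[/is_derive_continuous].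
(* The time derivative never vanishes, so it has one sign; the strict growth of [nu + nv] between
   the endpoints makes it positive. *)
have Tpos s : 0 <= s <= l -> 0 < T s.
  move=> sl; rewrite lt_def nz//=; apply: contraPT tt; rewrite -ltNge => Ts.
  apply/negP; rewrite -leNgt.
  have Tneg y : 0 <= y <= l -> T y < 0.
    move=> yl; rewrite ltNge; apply/negP => Ty.
    have ms : `[Num.min s y, Num.max s y] `<=` `[0, l].
      move=> w /=; rewrite !in_itv/= ge_min le_max => /andP[/orP h1 /orP h2].
      by case/andP: sl => ? ?; case/andP: yl => ? ?; case: h1; case: h2; lra.
    have [|||w wm Tw] := @IVT R T (Num.min s y) (Num.max s y) 0.
    - by rewrite ge_min le_max lexx.
    - apply: continuous_subspaceW ms _.
      by apply: within_continuous_pt => w; rewrite /= in_itv/= => /dt[].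
    - rewrite ge_min le_max; case: (leP s y) => _.
        by rewrite (ltW Ts) Ty orbT.
      by rewrite (ltW Ts) Ty orbT.
    - have wl : 0 <= w <= l by have := ms w wm; rewrite /= in_itv.
      by have := nz w wl; rewrite -/T Tw eqxx.
  apply: (@ler0_derive1_le_cc _ (fst \o c) 0 l) => //.
  - move=> y; rewrite in_itv/= => /andP[y0 yl].
    have [|h _] := dt y; first by rewrite !ltW.
    exact: ex_derive.
  - by move=> y; rewrite in_itv/= => /andP[y0 yl]; apply/ltW/Tneg; rewrite !ltW.
  - by rewrite in_itv/= lexx ltW.
  - by rewrite in_itv/= lexx ltW.
  - exact: ltW.
have mono a b : 0 <= a -> a < b -> b <= l -> (c a).1 < (c b).1.
  move=> a0 ab bl; apply: (@gtr0_derive1_lt_cc _ (fst \o c) 0 l) => //.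
  - move=> y; rewrite in_itv/= => /andP[y0 yl].
    have [|h _] := dt y; first by rewrite !ltW.
    exact: ex_derive.
  - by move=> y; rewrite in_itv/= => /andP[y0 yl]; apply/Tpos; rewrite !ltW.
  - by rewrite in_itv/= a0 (le_trans (ltW ab)).
  - by rewrite in_itv/= bl (le_trans a0 (ltW ab)).
pose D := pi * crad K.
have D0 : 0 < D by rewrite mulr_gt0 ?pi_gt0.
have h1 : (c 0).1 < (c D).1 by exact: mono.
have h2 : (c D).1 <= (c l).1.
  by move: lD; rewrite le_eqVlt => /predU1P[<-//|lD]; apply/ltW/mono => //; exact: ltW.
(* At parameter [D] the geodesic meets the antipode of its start, so time has grown by at least
   [pi]; but [dia] keeps the growth up to [c l] below [pi]. *)
have := fl D; rewrite ltW//= => /(_ lD).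
have -> : csn K D = -1.
  by rewrite /csn (negPf K0) (lt_gtF Kn) /D mulfK ?gt_eqF// cospi.
have -> : sn K D = 0.
  by rewrite /sn (negPf K0) (lt_gtF Kn) /D mulfK ?gt_eqF// sinpi mulr0.
rewrite scale0r addr0 !model_mapE (negPf K0) (lt_gtF Kn) row3Z => e.
have e0 := congr1 (fun v : 'rV[R]_3 => v 0 0) e; have e1 := congr1 (fun v : 'rV[R]_3 => v 0 1) e.
rewrite !row3E /= in e0 e1.
have s0 : sin ((c D).1 - (c 0).1) = 0.
  apply: (mulfI (lt0r_neq0 r0)); apply: (mulfI (lt0r_neq0 (cosh_gt0 (c D).2))).
  rewrite sinB; transitivity ((crad K * (cosh (c D).2 * sin (c D).1)) * cos (c 0).1
     - (crad K * (cosh (c D).2 * cos (c D).1)) * sin (c 0).1); first by ring.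
  by rewrite e0 e1; ring.
have h3 : pi <= (c D).1 - (c 0).1.
  rewrite leNgt; apply/negP => h3.
  by have := @sin_gt0_pi R ((c D).1 - (c 0).1); rewrite s0 ltxx subr_gt0 h1 h3 => /(_ isT).
have [] := dq K0; rewrite /csign (lt_gtF Kn) !mulN1r !ltr_norml => /andP[_ d1] /andP[_ d2].
have := tE (c 0); have := tE (c l); lra.
Qed.

End geodesic_equation.

(** * Explicit geodesics from the origin *)

Section hinge_existence.
Context {R : realType}.
Implicit Types (K s l : R) (p q : R * R) (c : R -> R * R).

(** The acceleration of such a curve is [K] times its position, hence normal or zero; finding a
    geodesic reduces to lifting an ambient curve to the coordinates [(t, x)]. *)
Lemma geodesic_of_ambient K c (T X : R -> R) (V : 'rV[R]_3) :
  (forall s, is_derive s 1 (fst \o c) (T s) /\ derivable T s 1) ->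
  (forall s, is_derive s 1 (snd \o c) (X s) /\ derivable X s 1) ->
  (forall s, model_map K (c s) = csn K s *: model_map K (c 0) + sn K s *: V) ->
  model_form K V V = -1 -> (K != 0 -> model_form K (model_map K (c 0)) V = 0) ->
  derive1 (ambient_curve K c) 0 = V /\
  forall l, 0 < l -> model_timelike_geodesic K c l.
Proof.
move=> dT dX fl V2 PV; set P := model_map K (c 0) in fl PV.
have gE : ambient_curve K c = fun s => csn K s *: P + sn K s *: V by apply/funext.
have dlin (f h : R -> R) (f' h' : R) s : is_derive s 1 f f' -> is_derive s 1 h h' ->
    is_derive s 1 (fun s => f s *: P + h s *: V) (f' *: P + h' *: V).
  move=> df dh.
  rewrite (_ : (fun s => _) = fun s => row3 (f s * P 0 0 + h s * V 0 0)
    (f s * P 0 1 + h s * V 0 1) (f s * P 0 2 + h s * V 0 2)); last first.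
    by apply/funext => y; rewrite -row3_lin -!row3_eta.
  rewrite (row3_eta P) (row3_eta V) row3_lin.
  by apply: is_derive_row3; apply: is_derive_eq; rewrite /GRing.scale/= ?row3E/=; ring.
have d1 : derive1 (ambient_curve K c) = fun s => (K * sn K s) *: P + csn K s *: V.
  apply/funext => s; apply: derive1_val; rewrite gE.
  by apply: dlin; [exact: is_derive_csn | exact: is_derive_sn].
have d2 s : derive1n 2 (ambient_curve K c) s = K *: model_map K (c s).
  rewrite -[LHS]/(derive1 (derive1 (ambient_curve K c)) s) d1 fl scalerDr !scalerA.
  apply: derive1_val; apply: dlin; last exact: is_derive_csn.
  by have := is_derive_sn K s => h; apply: is_derive_eq.
split; first by rewrite d1 sn0 csn0 mulr0 scale0r add0r scale1r.
move=> l l0; split=> // s _; split.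
- by split; [have [h _] := dT s | have [h _] := dX s]; exact: ex_derive.
- have -> : derive1 (fst \o c) = T by apply/funext => y; apply: derive1_val; case: (dT y).
  have -> : derive1 (snd \o c) = X by apply/funext => y; apply: derive1_val; case: (dX y).
  by split; [case: (dT s) | case: (dX s)].
- rewrite d1 model_form_sqr V2; have e := csn2 K s.
  have [K0|K0] := eqVneq K 0.
    move: e; rewrite K0 !mul0r subr0 => e.
    by rewrite expr0n mul0r mulr0 !mul0r add0r addr0 e mul1r.
  rewrite PV// model_map_quadric//.
  transitivity (- (csn K s ^+ 2 - K * sn K s ^+ 2)); last by rewrite e.
  by field.
- move=> v; rewrite d2 model_diffE; have [->|K0] := eqVneq K 0.
    by rewrite scale0r model_formE !mxE !mul0r oppr0 mulr0 !addr0.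
  rewrite -[K *: _]addr0 -[X in _ + X](scale0r V) model_form_lin.
  by rewrite model_form_ambient_velocity// mulr0 mul0r addr0.
Qed.

(** The future unit vector of rapidity [th] tangent at the image of [(0, 0)]; the tangent plane
    there is spanned by different ambient axes in the three cases. *)
Definition hinge_velocity K (th : R) : 'rV[R]_3 :=
  if K == 0 then row3 (cosh th) (sinh th) 0 else
  if 0 < K then row3 (cosh th) 0 (sinh th) else row3 0 (cosh th) (sinh th).

Lemma hinge_velocity_form K (th th' : R) :
  model_form K (hinge_velocity K th) (hinge_velocity K th') = - cosh (th - th').
Proof.
rewrite coshD coshN sinhN /hinge_velocity; have [->|K0] := eqVneq K 0.
  by rewrite model_form3 ltxx; ring.
have [Kp|Kp] := ltP 0 K; first by rewrite model_form3 ltNge (ltW Kp)/=; ring.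
have Kn : K < 0 by rewrite lt_neqAle K0.
by rewrite model_form3 Kn; ring.
Qed.

Lemma hinge_velocity_unit K (th : R) :
  model_form K (hinge_velocity K th) (hinge_velocity K th) = -1.
Proof. by rewrite hinge_velocity_form subrr cosh0. Qed.

Lemma derivable_inv_sqrt (f : R -> R) s (d : R) : is_derive s 1 f d -> 0 < f s ->
  derivable (fun s => (Num.sqrt (f s))^-1) s 1.
Proof.
move=> df f0; have h := is_derive1_comp (is_derive1_sqrt f0) df.
apply: derivableV; first by rewrite gt_eqF// sqrtr_gt0.
exact: ex_derive.
Qed.

Lemma sin_atan (y : R) : sin (atan y) = y * cos (atan y).
Proof.
rewrite -{2}(atanK y) /tan divfK// gt_eqF//; apply: cos_gt0_strip.
by rewrite ltr_norml atan_gtNpi2 atan_ltpi2.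
Qed.

Lemma gd0 : gd (0 : R) = 0.
Proof. by rewrite /gd sinh0 atan0. Qed.

Lemma asinh0 : asinh (0 : R) = 0.
Proof. by rewrite -{1}(@sinh0 R) sinhK. Qed.

Lemma nu_origin K : nu K (0, 0) = 0.
Proof. by rewrite /nu /ceta /cxi/= gd0; do 2 case: ifP => _; rewrite subrr. Qed.

Lemma nv_origin K : nv K (0, 0) = 0.
Proof. by rewrite /nv /ceta /cxi/= gd0; do 2 case: ifP => _; rewrite addr0. Qed.

Lemma abs_sinh_le (th : R) : `|sinh th| <= cosh th.
Proof.
have := cosh2Bsinh2 th; have := cosh_gt0 th => c0 e.
by apply: ler_of_sqr; rewrite ?(ltW c0)// real_normK ?num_real//; lra.
Qed.

Lemma hinge_curve0 (th : R) :
  exists c, [/\ c 0 = (0, 0), derive1 (ambient_curve 0 c) 0 = hinge_velocity 0 th,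
    forall l, 0 < l -> model_timelike_geodesic 0 c l &
    forall s, 0 <= s -> Jle 0 (0, 0) (c s)].
Proof.
pose c (s : R) := (s * cosh th, s * sinh th).
exists c; have c0 : c 0 = (0, 0) by rewrite /c !mul0r.
have [||||| dV geo] := @geodesic_of_ambient 0 c (fun _ => cosh th) (fun _ => sinh th) (hinge_velocity 0 th).
- move=> s; split; last exact: derivable_cst.
  rewrite (_ : _ \o _ = fun s => s * cosh th)//; apply: is_derive_eq.
  by rewrite /GRing.scale/=; ring.
- move=> s; split; last exact: derivable_cst.
  rewrite (_ : _ \o _ = fun s => s * sinh th)//; apply: is_derive_eq.
  by rewrite /GRing.scale/=; ring.
- move=> s; rewrite c0 !model_mapE /hinge_velocity /csn /sn !eqxx/= row3_lin.
  by congr row3; ring.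
- exact: hinge_velocity_unit.
- by rewrite eqxx.
split=> // s s0; rewrite /Jle nu_origin nv_origin /nu /nv /ceta /cxi ltxx/=.
have := abs_sinh_le th; rewrite ler_norml => /andP[h1 h2].
by rewrite -mulrBr -mulrDr !mulr_ge0//; lra.
Qed.

Lemma hinge_curve_pos K (th : R) : 0 < K ->
  exists c, [/\ c 0 = (0, 0), derive1 (ambient_curve K c) 0 = hinge_velocity K th,
    forall l, 0 < l -> model_timelike_geodesic K c l &
    forall s, 0 <= s -> Jle K (0, 0) (c s)].
Proof.
move=> Kp; have K0 := lt0r_neq0 Kp; have r0 := crad_gt0 K0.
set k := cosh th; set m := sinh th.
have k0 : 0 < k := cosh_gt0 th.
have km : k ^+ 2 = 1 + m ^+ 2 by rewrite -(cosh2Bsinh2 th) subrK.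
pose S s := sinh (s / crad K); pose C s := cosh (s / crad K).
have C0 s : 0 < C s := cosh_gt0 _.
have CS s : C s ^+ 2 = 1 + S s ^+ 2 by rewrite -(cosh2Bsinh2 (s / crad K)) subrK.
(* The solution of [sinh t = k S], [cosh t cos x = C], [cosh t sin x = m S]. *)
pose c (s : R) := (asinh (k * S s), atan (m * (S s / C s))).
have dS s : is_derive s 1 S (C s / crad K).
  by apply: is_derive_eq; rewrite /GRing.scale/= /C; ring.
have dC s : is_derive s 1 C (S s / crad K).
  by apply: is_derive_eq; rewrite /GRing.scale/= /S; ring.
have dkS s : is_derive s 1 (fun s => k * S s) (k * (C s / crad K)).
  by have := dS s => h; apply: is_derive_eq.
have N0 s : 0 < C s ^+ 2 + m ^+ 2 * S s ^+ 2.
  by rewrite ltr_pwDl ?exprn_gt0// mulr_ge0 ?sqr_ge0.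
have N1 s : 1 + (k * S s) ^+ 2 = C s ^+ 2 + m ^+ 2 * S s ^+ 2.
  by rewrite exprMn km CS; ring.
have c0 : c 0 = (0, 0) by rewrite /c /S mul0r sinh0 mulr0 asinh0 mul0r mulr0 atan0.
exists c.
have [||||| dV geo] := @geodesic_of_ambient K c
  (fun s => (Num.sqrt (1 + (k * S s) ^+ 2))^-1 * (k * (C s / crad K)))
  (fun s => m / crad K * (C s ^+ 2 + m ^+ 2 * S s ^+ 2)^-1) (hinge_velocity K th).
- move=> s; split.
    exact: (@is_derive1_comp R (@asinh R) (fun s => k * S s) s _ _ (is_derive_asinh _) (dkS s)).
  have h1 : is_derive s 1 (fun s => 1 + (k * S s) ^+ 2) (2 * (k * S s) * (k * (C s / crad K))).
    by have := dkS s => h; apply: is_derive_eq; rewrite /GRing.scale/=; ring.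
  apply: derivableM; first by apply: (derivable_inv_sqrt h1); rewrite N1.
  by have := dC s => h; exact: ex_derive.
- move=> s; split; last first.
    apply: derivableM; first exact: derivable_cst.
    apply: derivableV; first by rewrite gt_eqF.
    by have := dC s => h; have := dS s => h'; exact: ex_derive.
  have hV := @is_deriveV R C s _ _ (lt0r_neq0 (C0 s)) (dC s).
  have hm := is_deriveM (dS s) hV.
  have hmm : is_derive s 1 (fun s => m * (S s / C s)) (m / (crad K * C s ^+ 2)).
    rewrite (_ : (fun s => _) = fun s => m * (S * (fun s => (C s)^-1)) s)//.
    apply: is_derive_eq; rewrite /GRing.scale/=.
    have : C s ^+ 2 - S s ^+ 2 = 1 by exact: cosh2Bsinh2.
    move: (C0 s); move: (C s) (S s) => y z y0 e.
    transitivity (m * (y ^+ 2 - z ^+ 2) / (crad K * y ^+ 2)); last by rewrite e mulr1.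
    by field; rewrite !gt_eqF.
  have := @is_derive1_comp R (@atan R) (fun s => m * (S s / C s)) s _ _ (is_derive1_atan _) hmm.
  rewrite (_ : _ * _ = m / crad K * (C s ^+ 2 + m ^+ 2 * S s ^+ 2)^-1)//.
  have := N0 s; have := C0 s; move: (C s) (S s) => y z y0 n0.
  have q0 : 0 < 1 + (m * (z / y)) ^+ 2 by exact: oneDsqr_gt0.
  have -> : (1 + (m * (z / y)) ^+ 2)^-1 = y ^+ 2 / (y ^+ 2 + m ^+ 2 * z ^+ 2).
    by field; rewrite exprMn !gt_eqF.
  by field; rewrite exprMn (gt_eqF n0) (gt_eqF r0) (gt_eqF y0).
- move=> s; rewrite c0 !model_mapE /hinge_velocity (negPf K0) Kp/= row3_lin.
  rewrite /csn /sn (negPf K0) Kp -/(S s) -/(C s) -/k -/m asinhK sinh0 cosh0 cos0 sin0 !mul1r !mulr0 !mulr1 !add0r !addr0.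
  have cc : cosh (asinh (k * S s)) * cos (atan (m * (S s / C s))) = C s.
    rewrite cosh_asinh N1 cos_atan.
    have -> : 1 + (m * (S s / C s)) ^+ 2 = (C s ^+ 2 + m ^+ 2 * S s ^+ 2) / C s ^+ 2.
      by field; rewrite gt_eqF.
    rewrite sqrtrM ?(ltW (N0 s))// sqrtrV ?sqr_ge0// sqrtr_sqr (gtr0_norm (C0 s)).
    by field; rewrite !gt_eqF// sqrtr_gt0.
  congr row3; first by ring.
    by rewrite cc mulrC.
  rewrite sin_atan; transitivity (crad K * (m * (S s / C s)) *
    (cosh (asinh (k * S s)) * cos (atan (m * (S s / C s))))); first by ring.
  by rewrite cc; field; rewrite gt_eqF.
- exact: hinge_velocity_unit.
- move=> _; rewrite c0 model_mapE (negPf K0) Kp/= sinh0 cosh0 cos0 sin0 /hinge_velocity (negPf K0) Kp.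
  by rewrite model_form3; ring.
split=> // s s0; rewrite /Jle nu_origin nv_origin /nu /nv /ceta /cxi Kp (lt_gtF Kp)/= /gd asinhK.
have S0 : 0 <= S s.
  by rewrite /S -(@sinh0 R) leNgt ltr_sinh -leNgt divr_ge0// ltW.
have C1 : 1 <= C s := cosh_ge1 _.
have := abs_sinh_le th; rewrite -/m -/k ler_norml => /andP[h1 h2].
have t0 : 0 <= S s / C s by rewrite divr_ge0// ltW.
have t1 : S s / C s <= S s by rewrite ler_pdivrMr// ler_peMr.
have kS : k * (S s / C s) <= k * S s by rewrite ler_pM2l.
rewrite subr_ge0 -[X in _ <= _ + X]opprK subr_ge0 -atanN.
split; apply: le_atan; nra.
Qed.

Lemma hinge_curve_neg K (th : R) : K < 0 ->
  exists c, [/\ c 0 = (0, 0), derive1 (ambient_curve K c) 0 = hinge_velocity K th,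
    forall l, 0 < l -> model_timelike_geodesic K c l &
    forall s, 0 <= s -> s < pi * crad K -> Jle K (0, 0) (c s) /\ dia K (0, 0) (c s)].
Proof.
move=> Kn; have K0 := ltr0_neq0 Kn; have r0 := crad_gt0 K0.
set k := cosh th; set m := sinh th.
have k0 : 0 < k := cosh_gt0 th.
have km : k ^+ 2 = 1 + m ^+ 2 by rewrite -(cosh2Bsinh2 th) subrK.
pose S s := sin (s / crad K); pose C s := cos (s / crad K).
have CS s : C s ^+ 2 + S s ^+ 2 = 1 := cos2Dsin2 _.
have M0 s : 0 < C s ^+ 2 + k * S s ^+ 2.
  have := CS s; have := sqr_ge0 (S s); have := sqr_ge0 (C s).
  move: (C s ^+ 2) (S s ^+ 2) => y z; nra.
have N0 s : 0 < C s ^+ 2 + k ^+ 2 * S s ^+ 2.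
  have := CS s; have := sqr_ge0 (S s); have := sqr_ge0 (C s).
  have : 0 < k ^+ 2 by rewrite exprn_gt0.
  move: (C s ^+ 2) (S s ^+ 2) => y z; nra.
have N1 s : 1 + (m * S s) ^+ 2 = C s ^+ 2 + k ^+ 2 * S s ^+ 2.
  by rewrite exprMn km -[X in X + _](CS s); ring.
(* The ambient equations give [tan t = k tan (s / crad K)], whose branch must follow the universal
   cover. The difference [t - s / crad K] stays within [pi / 2] of zero, and [D] is its tangent. *)
pose D s := (k - 1) * (S s * C s) / (C s ^+ 2 + k * S s ^+ 2).
have D2 s : 1 + D s ^+ 2 = (C s ^+ 2 + k ^+ 2 * S s ^+ 2) / (C s ^+ 2 + k * S s ^+ 2) ^+ 2.
  rewrite /D; have := M0 s; have := CS s; move: (C s) (S s) => y z e n0.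
  transitivity ((y ^+ 2 + z ^+ 2) * (y ^+ 2 + k ^+ 2 * z ^+ 2) / (y ^+ 2 + k * z ^+ 2) ^+ 2).
    by field; rewrite gt_eqF.
  by rewrite e mul1r.
pose c (s : R) := (s / crad K + atan (D s), asinh (m * S s)).
have dS s : is_derive s 1 S (C s / crad K).
  by apply: is_derive_eq; rewrite /GRing.scale/= /C; ring.
have dC s : is_derive s 1 C (- S s / crad K).
  by apply: is_derive_eq; rewrite /GRing.scale/= /S; ring.
have dmS s : is_derive s 1 (fun s => m * S s) (m * (C s / crad K)).
  by have := dS s => h; apply: is_derive_eq.
have c0 : c 0 = (0, 0) by rewrite /c /D /S mul0r sin0 mulr0 asinh0 !mul0r mulr0 mul0r atan0 addr0.
have dM s : is_derive s 1 (fun s => C s ^+ 2 + k * S s ^+ 2) (2 * (k - 1) * (S s * C s) / crad K).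
  by have := dC s => h; have := dS s => h'; apply: is_derive_eq; rewrite /GRing.scale/=; ring.
have ND s : cosh (asinh (m * S s)) * cos (atan (D s)) = C s ^+ 2 + k * S s ^+ 2.
  rewrite cosh_asinh N1 cos_atan D2 sqrtrM ?(ltW (N0 s))// sqrtrV ?sqr_ge0//.
  by rewrite sqrtr_sqr (gtr0_norm (M0 s)); field; rewrite !gt_eqF// sqrtr_gt0.
have amb1 s : cosh (c s).2 * cos (c s).1 = C s.
  rewrite /c/= cosD -/(C s) -/(S s) sin_atan.
  transitivity ((C s - S s * D s) * (cosh (asinh (m * S s)) * cos (atan (D s)))); first by ring.
  rewrite ND /D; have := M0 s; have := CS s; move: (C s) (S s) => y z e n0.
  transitivity (y * (y ^+ 2 + z ^+ 2)); last by rewrite e mulr1.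
  by field; rewrite gt_eqF.
have amb2 s : cosh (c s).2 * sin (c s).1 = k * S s.
  rewrite /c/= sinD -/(C s) -/(S s) sin_atan.
  transitivity ((S s + C s * D s) * (cosh (asinh (m * S s)) * cos (atan (D s)))); first by ring.
  rewrite ND /D; have := M0 s; have := CS s; move: (C s) (S s) => y z e n0.
  transitivity (k * z * (y ^+ 2 + z ^+ 2)); last by rewrite e mulr1.
  by field; rewrite gt_eqF.
exists c.
have [||||| dV geo] := @geodesic_of_ambient K c
  (fun s => k / crad K * (C s ^+ 2 + k ^+ 2 * S s ^+ 2)^-1)
  (fun s => (Num.sqrt (1 + (m * S s) ^+ 2))^-1 * (m * (C s / crad K))) (hinge_velocity K th).
- move=> s; split; last first.
    apply: derivableM; first exact: derivable_cst.
    apply: derivableV; first by rewrite gt_eqF.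
    by have := dC s => h; have := dS s => h'; exact: ex_derive.
  have hV := @is_deriveV R (fun s => C s ^+ 2 + k * S s ^+ 2) s _ _ (lt0r_neq0 (M0 s)) (dM s).
  have hn : is_derive s 1 (fun s => (k - 1) * (S s * C s)) ((k - 1) * ((C s ^+ 2 - S s ^+ 2) / crad K)).
    by have := dC s => h; have := dS s => h'; apply: is_derive_eq; rewrite /GRing.scale/=; ring.
  have hD := is_deriveM hn hV.
  have hDD : is_derive s 1 D ((k - 1) * (C s ^+ 2 - k * S s ^+ 2) / (crad K * (C s ^+ 2 + k * S s ^+ 2) ^+ 2)).
    apply: is_derive_eq; rewrite /GRing.scale/=.
    have := M0 s; have := CS s; move: (C s) (S s) => y z e n0.
    transitivity ((k - 1) * (y ^+ 2 - k * z ^+ 2) * (y ^+ 2 + z ^+ 2) / (crad K * (y ^+ 2 + k * z ^+ 2) ^+ 2)); last by rewrite e mulr1.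
    by field; rewrite !gt_eqF.
  have hA := @is_derive1_comp R (@atan R) D s _ _ (is_derive1_atan _) hDD.
  rewrite (_ : fst \o c = fun s => (crad K)^-1 * s + (@atan R \o D) s); last first.
    by apply/funext => y; rewrite /c/= mulrC.
  apply: is_derive_eq; rewrite /GRing.scale/= D2.
  have := M0 s; have := N0 s; have := CS s; move: (C s) (S s) => y z e n0 m0.
  transitivity ((crad K)^-1 * (y ^+ 2 + k ^+ 2 * z ^+ 2 + (k - 1) * (y ^+ 2 - k * z ^+ 2)) / (y ^+ 2 + k ^+ 2 * z ^+ 2)).
    by field; rewrite exprMn ?(gt_eqF n0) ?(gt_eqF r0) ?(gt_eqF m0).
  transitivity (k * (y ^+ 2 + z ^+ 2) / (crad K * (y ^+ 2 + k ^+ 2 * z ^+ 2))).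
    by field; rewrite exprMn ?(gt_eqF n0) ?(gt_eqF r0) ?(gt_eqF m0).
  by rewrite e mulr1; field; rewrite exprMn ?(gt_eqF n0) ?(gt_eqF r0).
- move=> s; split.
    exact: (@is_derive1_comp R (@asinh R) (fun s => m * S s) s _ _ (is_derive_asinh _) (dmS s)).
  have h1 : is_derive s 1 (fun s => 1 + (m * S s) ^+ 2) (2 * (m * S s) * (m * (C s / crad K))).
    by have := dmS s => h; apply: is_derive_eq; rewrite /GRing.scale/=; ring.
  apply: derivableM; first by apply: (derivable_inv_sqrt h1); rewrite N1.
  by have := dC s => h; exact: ex_derive.
- move=> s; rewrite c0 !model_mapE /hinge_velocity (negPf K0) (lt_gtF Kn) amb1 amb2 row3_lin.
  rewrite /csn /sn (negPf K0) (lt_gtF Kn) -/(S s) -/(C s) /c /= asinhK sinh0 cosh0 cos0 sin0 -/k -/m.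
  by congr row3; ring.
- exact: hinge_velocity_unit.
- move=> _; rewrite c0 model_mapE (negPf K0) (lt_gtF Kn)/= sinh0 cosh0 cos0 sin0 /hinge_velocity (negPf K0) (lt_gtF Kn).
  by rewrite model_form3 Kn; ring.
split=> // s s0 sD.
move: s0; rewrite le_eqVlt => /predU1P[<-|s0].
  rewrite c0; split; first by split.
  by move=> _; rewrite nu_origin nv_origin mulr0 addr0 normr0 pi_gt0.
have sg : 0 < s / crad K < pi by rewrite divr_gt0//= ltr_pdivrMr.
have S0 : 0 < S s by exact: sin_gt0_pi.
have p0 := pi_gt0 R.
have [dl dr] : - (pi / 2) < atan (D s) /\ atan (D s) < pi / 2.
  by rewrite atan_gtNpi2 atan_ltpi2.
(* With [t] between [- pi / 2] and [3 pi / 2], a positive sine forces [0 < t < pi]. *)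
have st : 0 < sin (c s).1.
  by rewrite -(pmulr_rgt0 _ (cosh_gt0 (c s).2)) amb2 mulr_gt0.
have tl : - (pi / 2) < (c s).1 < pi + pi / 2 by rewrite /c/=; lra.
have t0 : 0 < (c s).1.
  rewrite ltNge; apply/negP => h; move: st; apply/negP; rewrite -leNgt -oppr_ge0 -sinN.
  by apply: sin_ge0_pi; lra.
have tp : (c s).1 < pi.
  rewrite ltNge; apply/negP => h; move: st; apply/negP; rewrite -leNgt.
  have := @sin_ge0_pi R ((c s).1 - pi); rewrite sinB cospi sinpi mulr0 subr0 mulrN1 oppr_ge0.
  by apply; lra.
set xi := cxi K (c s).
have xiE : xi = gd (c s).2 by rewrite /xi /cxi Kn.
have xl : `|xi| < pi / 2 by rewrite xiE gd_lt.
have cxi0 := cos_gt0_strip xl.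
(* As [|C s| < 1], this equation puts [|xi|] below both [t] and [pi - t], from which [Jle] and [dia]
   follow. *)
have ct : cos (c s).1 = C s * cos `|xi|.
  rewrite cos_norm xiE cos_gd -(amb1 s); field.
  by rewrite gt_eqF ?cosh_gt0.
have C1 : C s < 1.
  have := CS s; have : 0 < S s ^+ 2 by rewrite exprn_gt0.
  by move=> h1 h2; rewrite ltNge; apply/negP => h; nra.
have C2 : -1 < C s.
  have := CS s; have : 0 < S s ^+ 2 by rewrite exprn_gt0.
  by move=> h1 h2; rewrite ltNge; apply/negP => h; nra.
have in1 : (c s).1 \in `[0, pi] by rewrite in_itv/= !ltW.
have xn := normr_ge0 xi.
have in2 : `|xi| \in `[0, pi] by rewrite in_itv/= xn; lra.
have in3 : pi - (c s).1 \in `[0, pi].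
  by move: t0 tp; move: (c s).1 => t t0 tp; rewrite in_itv/=; lra.
have h1 : `|xi| < (c s).1.
  by rewrite -(ltr_cos in2 in1) ct -[ltRHS]mul1r ltr_pM2r// cos_norm.
have h2 : `|xi| < pi - (c s).1.
  rewrite -(ltr_cos in2 in3) cosB cospi sinpi mul0r addr0 mulN1r ct -mulNr.
  by rewrite -[ltRHS]mul1r ltr_pM2r ?cos_norm//; lra.
have := ler_norm xi; have := ler_norm (- xi); rewrite normrN => x1 x2.
have eE : ceta K (c s) = (c s).1 by rewrite /ceta (lt_gtF Kn).
rewrite /Jle /dia /base_dia nu_origin nv_origin mulr0 !addr0 /nu /nv eE -/xi.
by split; [split; lra | move=> _; rewrite !ltr_norml; split; lra].
Qed.

Lemma hinge_curve K (th : R) :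
  exists c, [/\ c 0 = (0, 0), derive1 (ambient_curve K c) 0 = hinge_velocity K th,
    forall l, 0 < l -> model_timelike_geodesic K c l &
    forall s, 0 <= s -> (s%:E < model_diameter K)%E ->
      Jle K (0, 0) (c s) /\ dia K (0, 0) (c s)].
Proof.
have [K0|K0|K0] := ltgtP 0 K.
- have [c [h1 h2 h3 h4]] := hinge_curve_pos th K0; exists c; split=> // s s0 _.
  by split; [exact: h4 | apply: Jle_dia (h4 _ s0); exact: ltW].
- have [c [h1 h2 h3 h4]] := hinge_curve_neg th K0; exists c; split=> // s s0.
  by rewrite model_diameter_lt0// lte_fin; exact: h4.
- rewrite -K0; have [c [h1 h2 h3 h4]] := hinge_curve0 th; exists c; split=> // s s0 _.
  by split; [exact: h4 | apply: Jle_dia (h4 _ s0)].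
Qed.

Lemma model_tau_geodesic K c l s : model_timelike_geodesic K c l -> 0 <= s <= l ->
  (s%:E < model_diameter K)%E -> Jle K (c 0) (c s) -> dia K (c 0) (c s) ->
  model_tau K (c 0) (c s) = s%:E.
Proof.
move=> gc sl sD J d; rewrite model_tau_msep//; congr EFin.
have s0 : 0 <= s by case/andP: sl.
have m0 : 0 <= msep K (c 0) (c s).
  by have [? ?] := J; apply: sep_ge0 => //; exact: base_strip_pt.
apply: (@chord_inj _ K) => //; first exact: msep_lt_diameter.
by rewrite chord_msep// (chordal_geodesic gc).
Qed.

End hinge_existence.

(** * Comparison angles *)

Section comparison_angles.
Context {R : realType}.
Implicit Types (K a b e k s : R) (p q r : R * R).

(** The law of cosines solved for the angle: the [k] at which a hinge with legs [a], [b] closes with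
    third side [e]. *)
Definition kappa K a b e : R := (hinge K a b 0 - chord K e) / (2 * sn K a * sn K b).

Lemma hingeE K a b k : hinge K a b k = hinge K a b 0 - 2 * sn K a * sn K b * k.
Proof. by rewrite /hinge; ring. Qed.

Lemma hingeC K a b k : hinge K a b k = hinge K b a k.
Proof. by rewrite /hinge; case: eqP => _; ring. Qed.

Lemma hinge_chord K a b e k : 0 < sn K a -> 0 < sn K b ->
  (hinge K a b k = chord K e) <-> k = kappa K a b e.
Proof.
move=> sa sb; rewrite hingeE /kappa; split=> [<-|->]; field; by rewrite !gt_eqF.
Qed.

Lemma le_kappa K a b e k : 0 < sn K a -> 0 < sn K b ->
  (k <= kappa K a b e) = (chord K e <= hinge K a b k).
Proof.
move=> sa sb; rewrite /kappa ler_pdivlMr ?mulr_gt0// [hinge K a b k]hingeE.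
by apply/idP/idP; lra.
Qed.

Lemma kappa_le K a b e k : 0 < sn K a -> 0 < sn K b ->
  (kappa K a b e <= k) = (hinge K a b k <= chord K e).
Proof.
move=> sa sb; rewrite /kappa ler_pdivrMr ?mulr_gt0// [hinge K a b k]hingeE.
by apply/idP/idP; lra.
Qed.

Lemma chord_ge0 K s : 0 <= chord K s.
Proof. by rewrite mulr_ge0// sqr_ge0. Qed.

Lemma chord0 K : chord K 0 = 0.
Proof. by rewrite /chord mul0r sn0 expr0n mulr0. Qed.

Lemma le_chord K s s' : 0 <= s -> s <= s' -> (s'%:E < model_diameter K)%E ->
  chord K s <= chord K s'.
Proof.
by move=> s0; rewrite le_eqVlt => /predU1P[->//|ss' sD]; apply/ltW/lt_chord.
Qed.

Lemma lt_model_diameter K s s' : s <= s' -> (s'%:E < model_diameter K)%E ->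
  (s%:E < model_diameter K)%E.
Proof. by move=> ss; apply: le_lt_trans; rewrite lee_fin. Qed.

(** The reverse triangle inequality gives [e <= b - a], and [b - a] is the third side of the hinge
    with [k = 1]. *)
Lemma kappa_ge1 K a b e : 0 < a -> 0 < e + a -> a + e <= b -> 0 <= e ->
  (b%:E < model_diameter K)%E -> 1 <= kappa K a b e.
Proof.
move=> a0 ea ab e0 bD; have b0 : 0 < b by lra.
have aD : (a%:E < model_diameter K)%E by apply: lt_model_diameter bD; lra.
rewrite le_kappa ?sn_gt0// hingeC hinge1; apply: le_chord => //; first by lra.
by apply: lt_model_diameter bD; lra.
Qed.

Lemma dia_of_Jle K p q r : Jle K p q -> Jle K q r -> dia K p r -> dia K q r.
Proof.
move=> [u1 v1] [u2 v2] d; have [K0|Kn] := leP 0 K; first by apply: Jle_dia.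
move=> K0; move: (d K0) (strip q K0).
rewrite /csign (lt_gtF Kn) !mulN1r !ltr_norml.
by move=> [/andP[? ?] /andP[? ?]] /andP[? ?]; split; lra.
Qed.

Lemma model_tau_le K p q r : Jle K q r -> (model_tau K p q <= model_tau K p r)%E.
Proof.
move=> J; apply: ge_ereal_sup => e [->|[l pl ->]]; first exact: model_tau_ge0.
have [l' pl' ll'] := path_through J pl.
by apply: (@le_trans _ _ l'%:E); rewrite ?lee_fin//; exact: path_le_model_tau.
Qed.

(** The clause for [k = 1] is there for degenerate triangles, whose comparison points must coincide.
    [hinge_curve] is only existential, so two uses of it need not return the same curve. *)
Definition hinge_pair K k (c c' : R -> R * R) : Prop :=
  [/\ (forall l, 0 < l -> model_timelike_geodesic K c l) /\
      (forall l, 0 < l -> model_timelike_geodesic K c' l),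
      c 0 = c' 0,
      - model_form K (derive1 (ambient_curve K c) 0) (derive1 (ambient_curve K c') 0) = k,
      (k = 1 -> c = c') &
      forall s, 0 <= s -> (s%:E < model_diameter K)%E ->
      [/\ Jle K (c 0) (c s), dia K (c 0) (c s), Jle K (c 0) (c' s) & dia K (c 0) (c' s)]].

Lemma hinge_pair_exists K k : 1 <= k -> exists c c', hinge_pair K k c c'.
Proof.
move=> k1; have [c [c0 dc gc Jc]] := hinge_curve K 0.
have [k1e|k1n] := eqVneq k 1.
  exists c, c; split=> //; first by rewrite dc k1e hinge_velocity_unit opprK.
  by move=> s s0 sD; have [] := Jc s s0 sD; rewrite c0.
have [c' [c'0 dc' gc' Jc']] := hinge_curve K (arcosh k).
exists c, c'; split.
- exact: (conj gc gc').
- by rewrite c0 c'0.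
- by rewrite dc dc' hinge_velocity_form sub0r coshN cosh_arcosh// opprK.
- by move=> e; rewrite e eqxx in k1n.
- by move=> s s0 sD; have [] := Jc s s0 sD; have [] := Jc' s s0 sD; rewrite c0.
Qed.

Lemma hinge_pair_sym K k c c' : hinge_pair K k c c' -> hinge_pair K k c' c.
Proof.
move=> [[gc gc'] c0 ck k1 Jc]; split.
- exact: (conj gc' gc).
- by rewrite c0.
- by rewrite model_form_sym.
- by move=> /k1.
- by move=> s s0 sD; have [] := Jc s s0 sD; rewrite -c0.
Qed.

Section hinge_pair_theory.
Variables (K k : R) (c c' : R -> R * R).
Hypothesis cc' : hinge_pair K k c c'.

Lemma hinge_pair_side s : 0 < s -> (s%:E < model_diameter K)%E ->
  model_tau K (c 0) (c s) = s%:E.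
Proof.
move=> s0 sD; have [[gc _] _ _ _ /(_ s (ltW s0) sD)[J d _ _]] := cc'.
by apply: (model_tau_geodesic (gc s s0)) => //; rewrite lexx ltW.
Qed.

Lemma hinge_pair_chordal a b : 0 < a -> 0 < b -> chordal K (c a) (c' b) = hinge K a b k.
Proof.
move=> a0 b0; have [[gc gc'] c0 <- _ _] := cc'.
by rewrite (chordal_geodesics (gc a a0) (gc' b b0)) ?lexx ?(ltW a0) ?(ltW b0).
Qed.

Lemma hinge_pair_order a b : 0 < a -> 0 < b -> (a%:E < model_diameter K)%E ->
  (b%:E < model_diameter K)%E -> 0 <= hinge K a b k ->
  Jle K (c a) (c' b) \/ Jle K (c' b) (c a).
Proof.
move=> a0 b0 aD bD h; have [_ _ _ _ Jc] := cc'.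
have [_ da _ _] := Jc a (ltW a0) aD; have [_ _ _ db] := Jc b (ltW b0) bD.
apply: chordal_ge0_Jle; last by rewrite hinge_pair_chordal.
move=> K0; have [] := da K0; have [] := db K0; rewrite !ltr_norml.
by move=> /andP[? ?] /andP[? ?] /andP[? ?] /andP[? ?]; split; lra.
Qed.

Lemma hinge_pair_sep a b : 0 < a -> 0 < b -> (a%:E < model_diameter K)%E ->
  (b%:E < model_diameter K)%E -> Jle K (c a) (c' b) ->
  exists m, [/\ model_tau K (c a) (c' b) = m%:E, 0 <= m,
    (m%:E < model_diameter K)%E & chord K m = hinge K a b k].
Proof.
move=> a0 b0 aD bD J; have [_ _ _ _ Jc] := cc'.
have [Ja _ _ _] := Jc a (ltW a0) aD; have [_ _ _ db] := Jc b (ltW b0) bD.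
have d : dia K (c a) (c' b) := dia_of_Jle Ja J db.
exists (msep K (c a) (c' b)); split; first exact: model_tau_msep.
- by have [? ?] := J; apply: sep_ge0 => //; exact: base_strip_pt.
- exact: msep_lt_diameter.
- by rewrite chord_msep// hinge_pair_chordal.
Qed.

End hinge_pair_theory.

(** * Comparison angles in a Lorentzian pre-length space *)

Context {X : metricType R} (L : lorentzian_prelength X).
Implicit Types x y z : X.

(** A loop makes [tau x x] positive, and then [tau x x + tau x x <= tau x x] makes it infinite. *)
Lemma tau_no_loop x y : (tau L x x < +oo)%E -> chron L x y -> ~ caus L y x.
Proof.
move=> fx xy yx; have t0 : (0 < tau L x y)%E by apply/tau_chron.
have tx : (0 < tau L x x)%E.
  apply: (lt_le_trans t0); apply: le_trans (tau_rtriangle (chron_caus xy) yx).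
  by rewrite leeDl// tau_ge0.
have := tau_rtriangle (caus_refl L x) (caus_refl L x).
move: tx fx; case: (tau L x x) => // t; rewrite lte_fin -EFinD lee_fin => t1 _; lra.
Qed.

Lemma tau_eq0 x y : ~ chron L x y -> tau L x y = 0%E.
Proof.
move=> n; apply/eqP; rewrite eq_le tau_ge0 andbT leNgt; apply/negP => h; apply: n.
exact/tau_chron.
Qed.

(** Whatever the witnesses, [geodesic_length] identifies their parameter lengths with [a] and [b],
    and the chord of the third side then fixes the product of the velocities. *)
Lemma comparison_angle_unique K x y z w a b e :
  is_comparison_angle L K x y z w ->
  tau L x y = a%:E -> tau L x z = b%:E -> 0 < a -> 0 < b ->
  (a%:E < model_diameter K)%E -> (b%:E < model_diameter K)%E ->
  caus L y z -> tau L y z = e%:E -> (e%:E < model_diameter K)%E ->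
  w = arcosh `|kappa K a b e|.
Proof.
move=> [x' [y' [z' [cy [ly [cz [lz [[pxy pyz pxz] [gy cy0 cyl] [gz cz0 czl] ->]]]]]]]].
move=> xy xz a0 b0 aD bD yz tyz eD.
have [txy' _ _ _] := pxy; have [txz' _ _ _] := pxz; have [tyz' _ cyz _] := pyz.
have [_ _ hy] : [/\ Jle K (cy 0) (cy ly), dia K (cy 0) (cy ly) & model_tau K (cy 0) (cy ly) = ly%:E].
  by apply: geodesic_length => //; rewrite cy0 cyl txy' xy lte_fin a0.
have [_ _ hz] : [/\ Jle K (cz 0) (cz lz), dia K (cz 0) (cz lz) & model_tau K (cz 0) (cz lz) = lz%:E].
  by apply: geodesic_length => //; rewrite cz0 czl txz' xz lte_fin b0.
have ly_a : ly = a by move: hy; rewrite cy0 cyl txy' xy => -[].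
have lz_b : lz = b by move: hz; rewrite cz0 czl txz' xz => -[].
have J : Jle K y' z' by apply/model_causE; exact: cyz.
have tt : model_tau K y' z' = e%:E by rewrite tyz' tyz.
have d : dia K y' z' by apply: model_tau_dia => //; rewrite tt.
have me : msep K y' z' = e by move: tt; rewrite model_tau_msep// => -[].
rewrite -normrN; congr (arcosh `|_|); apply/hinge_chord; rewrite ?sn_gt0//.
rewrite -me chord_msep// -cyl -czl -ly_a -lz_b.
have ly0 : 0 < ly by case: gy.
have lz0 : 0 < lz by case: gz.
by rewrite (chordal_geodesics gy gz) ?cy0 ?cz0 ?lexx ?(ltW ly0) ?(ltW lz0).
Qed.

Lemma comparison_angle_sym K x y z : comparison_angle L K x y z = comparison_angle L K x z y.
Proof.
rewrite /comparison_angle; congr xget; apply/seteqP.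
have sub y1 y2 w : is_comparison_angle L K x y1 y2 w -> is_comparison_angle L K x y2 y1 w.
  move=> [x' [y' [z' [cy [ly [cz [lz [[pxy [h1 h2 h3 h4] pxz] gy gz ->]]]]]]]].
  exists x', z', y', cz, lz, cy, ly; split.
  - by split; [exact: pxz | split | exact: pxy].
  - exact: gz.
  - exact: gy.
  - by rewrite model_form_sym.
by split=> w; exact: sub.
Qed.

(** A nonnegative hinge only says that [c a] and [c' b] are causally related in some order. The
    wrong order forces [b <= a]; with [a + e <= b] this leaves [a = b], [e = 0], [k = 1], and the
    points coincide. *)
Lemma hinge_comparison_triangle K k c c' x y z a b e :
  hinge_pair K k c c' -> (tau L x x < +oo)%E -> (tau L y y < +oo)%E -> (tau L z z < +oo)%E ->
  tau L x y = a%:E -> tau L x z = b%:E -> 0 < a -> 0 < b ->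
  (a%:E < model_diameter K)%E -> (b%:E < model_diameter K)%E ->
  caus L y z -> tau L y z = e%:E -> (e%:E < model_diameter K)%E ->
  k = kappa K a b e ->
  comparison_triangle L K x y z (c 0) (c a) (c' b).
Proof.
move=> cc fx fy fz xy xz a0 b0 aD bD yz tyz eD kE.
have cc' := hinge_pair_sym cc.
have [_ c0 _ k1 Jc] := cc.
have [Ja _ _ _] := Jc a (ltW a0) aD; have [_ _ Jb _] := Jc b (ltW b0) bD.
have e0 : 0 <= e by rewrite -lee_fin -tyz tau_ge0.
have chxy : chron L x y by apply/tau_chron; rewrite xy lte_fin.
have chxz : chron L x z by apply/tau_chron; rewrite xz lte_fin.
have back p q : Jle K p q -> model_tau K q p = 0%E.
  move=> [u v]; apply/eqP; rewrite eq_le model_tau_ge0 andbT leNgt; apply/negP.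
  by move=> /model_tau_gt0[_]; lra.
have side d s w : Jle K (c 0) (d s) -> model_tau K (c 0) (d s) = s%:E ->
    tau L x w = s%:E -> chron L x w -> comparison_pair L K x w (c 0) (d s).
  move=> J t xw ch; have nc := tau_no_loop fx ch; split.
  - by rewrite t xw.
  - by rewrite (back _ _ J) tau_eq0// => h; apply: nc; exact: chron_caus h.
  - by move=> _; apply/model_causE.
  - by [].
have abe : a + e <= b.
  by have := tau_rtriangle (chron_caus chxy) yz; rewrite xy tyz xz -EFinD lee_fin.
have hE : hinge K a b k = chord K e by apply/hinge_chord; rewrite ?sn_gt0.
have eqab : b <= a -> c a = c' b.
  move=> ba; have ab : a = b by lra.
  have e00 : e = 0 by lra.
  rewrite -k1 ?ab// kE; symmetry; apply/hinge_chord; rewrite ?sn_gt0//.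
  by rewrite hinge1 ab e00 subrr.
have ta : model_tau K (c 0) (c a) = a%:E by exact: hinge_pair_side cc _ a0 aD.
have tb : model_tau K (c 0) (c' b) = b%:E by rewrite c0; exact: hinge_pair_side cc' _ b0 bD.
have J : Jle K (c a) (c' b).
  have h0 : 0 <= hinge K a b k by rewrite hE chord_ge0.
  have [//|J] := hinge_pair_order cc a0 b0 aD bD h0.
  have ba : b <= a.
    by have := @model_tau_le K (c 0) _ _ J; rewrite ta tb lee_fin.
  by rewrite eqab//; split.
split.
- exact: side.
- have [m [tm m0 mD cm]] := hinge_pair_sep cc a0 b0 aD bD J.
  have me : m = e by apply: (chord_inj m0 e0 mD eD); rewrite cm.
  split.
  + by rewrite tm me tyz.
  + by rewrite (back _ _ J) tau_eq0// => zy; exact: (tau_no_loop fz zy).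
  + by move=> _; apply/model_causE.
  + move=> zy; apply/model_causE; rewrite eqab; first by split.
    have := tau_rtriangle (chron_caus chxz) zy; rewrite xy xz.
    have := tau_ge0 L z y; case: (tau L z y) => [t| |]//.
    by rewrite -EFinD !lee_fin; lra.
- exact: side.
Qed.

Lemma comparison_angleE K x y z a b e :
  (tau L x x < +oo)%E -> (tau L y y < +oo)%E -> (tau L z z < +oo)%E ->
  tau L x y = a%:E -> tau L x z = b%:E -> 0 < a -> 0 < b -> (b%:E < model_diameter K)%E ->
  caus L y z -> tau L y z = e%:E ->
  1 <= kappa K a b e /\ comparison_angle L K x y z = arcosh (kappa K a b e).
Proof.
move=> fx fy fz xy xz a0 b0 bD yz tyz.
have e0 : 0 <= e by rewrite -lee_fin -tyz tau_ge0.
have chxy : chron L x y by apply/tau_chron; rewrite xy lte_fin.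
have abe : a + e <= b.
  by have := tau_rtriangle (chron_caus chxy) yz; rewrite xy tyz xz -EFinD lee_fin.
have aD : (a%:E < model_diameter K)%E by apply: lt_model_diameter bD; lra.
have eD : (e%:E < model_diameter K)%E by apply: lt_model_diameter bD; lra.
have k1 : 1 <= kappa K a b e by apply: kappa_ge1 => //; lra.
split=> //; have [c [c' cc]] := hinge_pair_exists K k1.
have := hinge_comparison_triangle cc fx fy fz xy xz a0 b0 aD bD yz tyz eD (erefl _).
have [[gc gc'] c0 fk _ _] := cc => tri.
rewrite /comparison_angle; apply: xget_unique; last first.
  move=> w /comparison_angle_unique /(_ xy xz a0 b0 aD bD yz tyz eD) ->.
  by rewrite ger0_norm//; lra.
exists (c 0), (c a), (c' b), c, a, c', b; split.
- exact: tri.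
- split; [exact: gc | exact: erefl | exact: erefl].
- split; [exact: gc' | exact/esym | exact: erefl].
- by rewrite -normrN fk ger0_norm//; lra.
Qed.

End comparison_angles.

(** * Monotonicity *)

Section monotonicity.
Context {R : realType} {X : metricType R} (L : lorentzian_prelength X) (K : R).
Implicit Types (x y z p q : X) (U S : set X) (a b e k s t : R).

Lemma maximal_geodesic_dom p q a b (g : R -> X) : maximal_geodesic L p q a b g -> a < b.
Proof.
move=> [[_ [[s [t [/= sab tab st]]] _] _ _] _ _ _].
move: sab tab; rewrite !in_itv/= => /andP[h1 _] /andP[_ h2].
exact: le_lt_trans h1 (lt_le_trans st h2).
Qed.

Lemma side_endpoints U p q S : side_in L U p q S -> U p /\ U q.
Proof.
move=> [a [b [g [[mg gU] _]]]]; have ab := maximal_geodesic_dom mg.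
have [_ ga gb _] := mg; split; apply: gU.
  by exists a => //; rewrite /= in_itv/= lexx ltW.
by exists b => //; rewrite /= in_itv/= lexx ltW.
Qed.

(** The approximation from the past combines lower semicontinuity of [tau] with continuity of the
    side; it is chronological because maximal geodesics in [U] are timelike. *)
Lemma side_point U p q S w :
  strictly_timelike_geodesically_connected L U -> side_in L U p q S ->
  chron L p q -> S w -> w <> p ->
  [/\ U w, chron L p w, caus L w q &
   forall r, (r%:E < tau L p w)%E -> exists w',
     [/\ S w', chron L p w', chron L w' w & (r%:E < tau L p w')%E]].
Proof.
move=> [_ _ stc] sd pq Sw wp; have [Up Uq] := side_endpoints sd.
move: sd => [a [b [g [mgU SE]]]].
have [_ _ _ tl] := stc _ _ _ _ _ Up Uq pq mgU.
have [mg gU] := mgU; have ab := maximal_geodesic_dom mg.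
have [[_ _ lip cg] ga gb _] := mg.
move: Sw; rewrite SE => -[t /= tab gt].
have /andP[at_ tb] : a <= t <= b by move: tab; rewrite in_itv.
have a_t : a < t.
  by rewrite lt_neqAle at_ andbT; apply/eqP => e; apply: wp; rewrite -gt -e.
have aab : [set` `[a, b]] a by rewrite /= in_itv/= lexx ltW.
have bab : [set` `[a, b]] b by rewrite /= in_itv/= lexx ltW.
split.
- by apply: gU; exists t.
- by rewrite -ga -gt; apply: tl.
- rewrite -gt -gb; move: tb; rewrite le_eqVlt => /predU1P[->|tb]; first exact: caus_refl.
  exact: cg.
- move=> r rt.
  have [V nV hV] := @tau_lsc _ _ L (p, w) r rt.
  have [[A B] /= [nA nB] AB] := nV.
  have [kk [W nW hW]] := lip t tab.
  move: nB => /nbhs_ballP[ep /= ep0 epB].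
  move: nW => /nbhs_ballP[dl /= dl0 dlW].
  (* The three bounds keep [t - h] in the Lipschitz neighborhood, after [a], and its image within
     [ep] of [w]; [|kk| + 1] is positive whatever the sign of [kk]. *)
  pose h := Num.min (dl / 2) (Num.min ((t - a) / 2) (ep / (2 * (`|kk| + 1)))).
  have k1 : 0 < `|kk| + 1 by rewrite ltr_pwDr.
  have h0 : 0 < h by rewrite !lt_min !divr_gt0 ?subr_gt0// mulr_gt0.
  have h1 : h <= dl / 2 by rewrite ge_min lexx.
  have h2 : h <= (t - a) / 2 by rewrite !ge_min lexx orbT.
  have h3 : h <= ep / (2 * (`|kk| + 1)) by rewrite !ge_min lexx !orbT.
  have tha : a < t - h by lra.
  have thab : [set` `[a, b]] (t - h) by rewrite /= in_itv/=; lra.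
  exists (g (t - h)); split.
  + by exists (t - h).
  + by rewrite -ga; apply: tl.
  + by rewrite -gt; apply: tl => //; lra.
  + apply: (hV (p, g (t - h))); apply: AB; split => /=; first exact: nbhs_singleton.
    apply: epB; rewrite ballEmdist/= -gt.
    have Wt : W t by apply: dlW; exact: ballxx.
    have Wth : W (t - h).
      apply: dlW; rewrite -ball_normE/= opprB addrCA subrr addr0 gtr0_norm//.
      by lra.
    apply: (le_lt_trans (hW _ _ Wt Wth tab thab)).
    rewrite opprB addrCA subrr addr0 gtr0_norm//.
    apply: (@le_lt_trans _ _ ((`|kk| + 1) * h)).
      rewrite ler_pM2r//; have := ler_norm kk; lra.
    apply: (@le_lt_trans _ _ (ep / 2)); last by lra.
    rewrite mulrC -ler_pdivlMr//; apply: (le_trans h3).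
    by rewrite invfM mulrA.
Qed.

Lemma continuous_hinge b k : continuous (fun a => hinge K a b k).
Proof.
have cs := fun a => is_derive_continuous (is_derive_sn K a).
have cc := fun a => is_derive_continuous (is_derive_csn K a).
move=> a; rewrite /hinge; apply: cvgB.
  case: (K == 0).
    apply: cvgD; last exact: cvg_cst.
    exact: exprn_continuous.
  apply: cvgM; first exact: cvg_cst.
  apply: cvgB; last exact: cvg_cst.
  by apply: cvgM; [exact: cc | exact: cvg_cst].
apply: cvgM; last exact: cvg_cst.
apply: cvgM; last exact: cvg_cst.
by apply: cvgM; [exact: cvg_cst | exact: cs].
Qed.

(* [cmp_pt] stands for the correspondence with the points of a comparison
   triangle. *)
Definition model_side U x S (d : R -> R * R) (cmp_pt : X -> R * R -> Prop) : Prop :=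
  forall q, S q -> q <> x -> exists s,
  [/\ U q /\ chron L x q, tau L x q = s%:E, 0 < s /\ (s%:E < model_diameter K)%E,
      cmp_pt q (d s) &
      forall r, r < s -> exists q' s', [/\ S q' /\ q' <> x, tau L x q' = s'%:E,
         chron L q' q & r < s' <= s]].

Lemma tau_finE x y : (tau L x y < +oo)%E -> exists2 e, tau L x y = e%:E & 0 <= e.
Proof.
by have := tau_ge0 L x y; case: (tau L x y) => // e e0 _; exists e.
Qed.

Section comparison.
Variables (U : set X) (x : X) (S S' : set X) (d d' : R -> R * R) (k : R).
Variable cmp_pt : X -> R * R -> Prop.
Hypothesis finU : forall p q, U p -> U q -> (tau L p q < +oo)%E.
Hypothesis dd' : hinge_pair K k d d'.
Hypothesis sideS : model_side U x S d cmp_pt.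
Hypothesis sideS' : model_side U x S' d' cmp_pt.
Variables (q q' : X) (s s' : R).
Hypotheses (Sq : S q) (Sq' : S' q') (qx : q <> x) (q'x : q' <> x).
Hypotheses (qs : tau L x q = s%:E) (qs' : tau L x q' = s'%:E).

(** A positive [tau q q'] passes to the model points, which are therefore ordered, and the hinge is
    the chord of their separation. *)
Lemma hinge_chord_below_chron :
  (forall p1 p2 v1 v2, cmp_pt p1 v1 -> cmp_pt p2 v2 ->
     (tau L p1 p2 <= model_tau K v1 v2)%E) ->
  forall e, tau L q q' = e%:E -> 0 < e -> chord K e <= hinge K s s' k.
Proof.
move=> curv e te e0.
have [s1 [[Uq ch] t1 [s0 sD] cq _]] := sideS Sq qx.
have [s2 [[Uq' ch'] t2 [s0' sD'] cq' _]] := sideS' Sq' q'x.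
have es : s1 = s by move: t1; rewrite qs => -[].
have es' : s2 = s' by move: t2; rewrite qs' => -[].
subst s1 s2.
have := curv _ _ _ _ cq cq'; rewrite te => le1.
have [J _] : [/\ Jle K (d s) (d' s') & nu K (d s) + nv K (d s) < nu K (d' s') + nv K (d' s')].
  by apply: model_tau_gt0; apply: lt_le_trans le1; rewrite lte_fin.
have [m [tm m0 mD <-]] := hinge_pair_sep dd' s0 s0' sD sD' J.
by move: le1; rewrite tm lee_fin => le1; apply: le_chord => //; exact: ltW.
Qed.

Lemma hinge_chord_above :
  (forall p1 p2 v1 v2, cmp_pt p1 v1 -> cmp_pt p2 v2 ->
     (model_tau K v1 v2 <= tau L p1 p2)%E) ->
  forall e, caus L q q' -> tau L q q' = e%:E -> hinge K s s' k <= chord K e.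
Proof.
move=> curv e qq' te.
have [s1 [[Uq ch] t1 [s0 sD] cq _]] := sideS Sq qx.
have [s2 [[Uq' ch'] t2 [s0' sD'] cq' _]] := sideS' Sq' q'x.
have es : s1 = s by move: t1; rewrite qs => -[].
have es' : s2 = s' by move: t2; rewrite qs' => -[].
subst s1 s2.
have [h|h] := leP (hinge K s s' k) 0; first exact: le_trans h (chord_ge0 _ _).
have eD : (e%:E < model_diameter K)%E.
  apply: lt_model_diameter sD'.
  have := tau_rtriangle (chron_caus ch) qq'; rewrite qs te qs' -EFinD lee_fin; lra.
have [J|J] := hinge_pair_order dd' s0 s0' sD sD' (ltW h).
  have [m [tm m0 mD <-]] := hinge_pair_sep dd' s0 s0' sD sD' J.
  by have := curv _ _ _ _ cq cq'; rewrite tm te lee_fin => le1; exact: le_chord.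
(* The reverse order: the positive hinge makes [m] positive, so the curvature bound gives [q' << q],
   which closes a loop with [q <= q']. *)
have [m [tm m0 mD cm]] := hinge_pair_sep (hinge_pair_sym dd') s0' s0 sD' sD J.
have mpos : 0 < m.
  rewrite lt_neqAle m0 andbT; apply/eqP => m00; move: h.
  by rewrite hingeC -cm -m00 chord0 ltxx.
have := curv _ _ _ _ cq' cq; rewrite tm => le1.
have q'q : chron L q' q by apply/tau_chron; apply: lt_le_trans le1; rewrite lte_fin.
by have := tau_no_loop (finU Uq' Uq') q'q qq'.
Qed.

End comparison.

(* When [q] and [q'] are null related, the comparison of their time
   separations gives nothing; [q] is replaced by earlier points of its side,
   which are timelike related to [q']. *)
Lemma hinge_chord_below U x S S' (d d' : R -> R * R) k (cmp_pt : X -> R * R -> Prop) :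
  (forall p q, U p -> U q -> (tau L p q < +oo)%E) ->
  hinge_pair K k d d' -> model_side U x S d cmp_pt -> model_side U x S' d' cmp_pt ->
  (forall p1 p2 v1 v2, cmp_pt p1 v1 -> cmp_pt p2 v2 ->
     (tau L p1 p2 <= model_tau K v1 v2)%E) ->
  forall q q' s s' e, S q -> S' q' -> q <> x -> q' <> x ->
  tau L x q = s%:E -> tau L x q' = s'%:E -> caus L q q' -> tau L q q' = e%:E ->
  chord K e <= hinge K s s' k.
Proof.
move=> finU dd' sS sS' curv q q' s s' e Sq Sq' qx q'x qs qs' qq' te.
have e0 : 0 <= e by rewrite -lee_fin -te tau_ge0.
move: e0; rewrite le_eqVlt => /predU1P[e00|e0]; last first.
  exact: (hinge_chord_below_chron dd' sS sS' Sq Sq').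
rewrite -e00 chord0 leNgt; apply/negP => hneg.
have [s1 [[Uq ch] t1 [s0 sD] _ apx]] := sS q Sq qx.
have [s2 [[Uq' ch'] _ _ _ _]] := sS' q' Sq' q'x.
have es : s1 = s by move: t1; rewrite qs => -[].
subst s1.
(* A negative hinge stays negative slightly earlier on the side, whereas an earlier point [w] has
   [w << q <= q'] and so a nonnegative hinge. *)
have nr : \forall t \near s, hinge K t s' k < 0.
  exact: (cvgr_lt (hinge K s s' k) (@continuous_hinge s' k s) 0 hneg).
move: nr => /nbhs_ballP[dl /= dl0 near0].
have [|w [t [[Sw wx] tw ww /andP[t1' t2']]]] := apx (s - dl); first by rewrite ltrBlDr ltrDl.
have ht : hinge K t s' k < 0.
  by apply: near0; rewrite -ball_normE/= ger0_norm ?subr_ge0//; lra.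
have [_ [[Uw _] _ _ _ _]] := sS w Sw wx.
have [f tf f0] := tau_finE (finU w q' Uw Uq').
have fpos : 0 < f.
  rewrite -lte_fin -tf; apply: lt_le_trans (tau_rtriangle (chron_caus ww) qq').
  by rewrite te -e00 adde0; apply/tau_chron.
have := hinge_chord_below_chron dd' sS sS' Sw Sq' wx q'x tw qs' curv tf fpos.
by have := chord_ge0 K f; lra.
Qed.

Lemma corresponding_model_side U x y S (c : R -> R * R) a (cmp_pt : X -> R * R -> Prop) :
  (forall p q, U p -> U q -> (tau L p q < +oo)%E) ->
  strictly_timelike_geodesically_connected L U -> side_in L U x y S ->
  chron L x y -> tau L x y = a%:E -> (a%:E < model_diameter K)%E ->
  (forall l, 0 < l -> model_timelike_geodesic K c l) ->
  (forall s, 0 < s -> (s%:E < model_diameter K)%E -> model_tau K (c 0) (c s) = s%:E) ->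
  (forall q v, corresponding_on_side L K x y S (c 0) (c a) q v -> cmp_pt q v) ->
  model_side U x S c cmp_pt.
Proof.
move=> finU stc sd xy ta aD gc tc hc q Sq qx.
have [Ux Uy] := side_endpoints sd.
have [Uq xq qy apx] := side_point stc sd xy Sq qx.
have [s ts s00] := tau_finE (finU x q Ux Uq).
have s0 : 0 < s by rewrite -lte_fin -ts; apply/tau_chron.
have sa : s <= a.
  have := tau_rtriangle (chron_caus xq) qy; rewrite ts ta => h.
  by rewrite -lee_fin; apply: le_trans h; rewrite leeDl// tau_ge0.
have a0 : 0 < a by lra.
have sD := lt_model_diameter sa aD.
exists s; split=> //.
- apply: hc; split=> //; last by rewrite tc.
  by exists c, a, s; split=> //; [exact: gc | rewrite s00].
- move=> r rs; have [|w [Sw xw wq tw]] := apx r; first by rewrite ts lte_fin.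
  have wx : w <> x.
    by move=> e; apply: (tau_no_loop (finU x x Ux Ux) xw); rewrite e; exact: caus_refl.
  have [Uw _ _ _] := side_point stc sd xy Sw wx.
  have [t tt t0] := tau_finE (finU x w Ux Uw).
  exists w, t; split=> //; move: tw; rewrite tt lte_fin => ->/=.
  have := tau_rtriangle (chron_caus xw) (chron_caus wq); rewrite tt ts => h.
  by rewrite -lee_fin; apply: le_trans h; rewrite leeDl// tau_ge0.
Qed.

(** The two bounds differ only in the inequality between chord and hinge, which is isolated as the
    second premise. There [k] belongs to the large triangle and [s], [s'], [e] to the small one. *)
Lemma monotonicity_of_curvature (cmp : \bar R -> \bar R -> Prop) (cmpR : R -> R -> Prop) :
  timelike_curvature_bounded cmp L K ->
  (forall U x S S' (d d' : R -> R * R) k (cmp_pt : X -> R * R -> Prop),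
    (forall p q, U p -> U q -> (tau L p q < +oo)%E) ->
    hinge_pair K k d d' -> model_side U x S d cmp_pt -> model_side U x S' d' cmp_pt ->
    (forall p1 p2 v1 v2, cmp_pt p1 v1 -> cmp_pt p2 v2 ->
       cmp (tau L p1 p2) (model_tau K v1 v2)) ->
    forall q q' s s' e, S q -> S' q' -> q <> x -> q' <> x ->
    tau L x q = s%:E -> tau L x q' = s'%:E -> caus L q q' -> tau L q q' = e%:E ->
    0 < sn K s -> 0 < sn K s' -> 1 <= kappa K s s' e -> 1 <= k ->
    cmpR (arcosh (kappa K s s' e)) (arcosh k)) ->
  future_timelike_monotonicity cmpR L K.
Proof.
move=> curv core p; have [U [[oU Up] fc stc tri]] := curv p.
exists U; split=> //; first exact: open_nbhs_nbhs.
have [finU _] := fc.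
move=> x y z Sxy Syz Sxz y' z' T [sb1 sb2 sb3] Sz' Sy' y'x xz' rel.
have [[xy yz] [f1 f2 f3] sxy syz sxz] := T.
have [Ux Uy] := side_endpoints sxy; have [_ Uz] := side_endpoints sxz.
have xz : chron L x z := chron_trans xy yz.
have [a ta a00] := tau_finE f1; have [b tb b00] := tau_finE f3; have [e te e00] := tau_finE f2.
have a0 : 0 < a by rewrite -lte_fin -ta; apply/tau_chron.
have b0 : 0 < b by rewrite -lte_fin -tb; apply/tau_chron.
have aD : (a%:E < model_diameter K)%E by rewrite -ta.
have bD : (b%:E < model_diameter K)%E by rewrite -tb.
have eD : (e%:E < model_diameter K)%E by rewrite -te.
have fx := finU x x Ux Ux; have fy := finU y y Uy Uy; have fz := finU z z Uz Uz.
have [k1 ang] := comparison_angleE fx fy fz ta tb a0 b0 bD (chron_caus yz) te.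
rewrite ang; set k := kappa K a b e in k1 *.
have [c [c' cc]] := hinge_pair_exists K k1.
have ct := hinge_comparison_triangle cc fx fy fz ta tb a0 b0 aD bD (chron_caus yz) te eD erefl.
have [[gc gc'] c0 _ _ _] := cc; have cc' := hinge_pair_sym cc.
pose cmp_pt := corresponding_points L K x y z Sxy Syz Sxz (c 0) (c a) (c' b).
have sideY : model_side U x Sxy c cmp_pt.
  apply: (corresponding_model_side finU stc sxy xy ta aD gc).
    by move=> s s0 sD; exact: hinge_pair_side cc _ s0 sD.
  by move=> q v h; apply: Or31.
have sideZ : model_side U x Sxz c' cmp_pt.
  apply: (corresponding_model_side finU stc sxz xz tb bD gc').
    by move=> s s0 sD; exact: hinge_pair_side cc' _ s0 sD.
  by move=> q v h; apply: Or33; rewrite c0.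
have curv' p1 p2 v1 v2 : cmp_pt p1 v1 -> cmp_pt p2 v2 -> cmp (tau L p1 p2) (model_tau K v1 v2).
  by move=> h1 h2; apply: (tri _ _ _ _ _ _ _ _ _ _ _ _ _ T _ ct h1 h2); split.
have z'x : z' <> x by move=> h; apply: xz'.
have [s [[Uy' xy'] ts [s0 sD] _ _]] := sideY y' Sy' y'x.
have [t [[Uz' xz''] tt [t0 tD] _ _]] := sideZ z' Sz' z'x.
have fy' := finU _ _ Uy' Uy'; have fz' := finU _ _ Uz' Uz'.
have ss := sn_gt0 s0 sD; have st := sn_gt0 t0 tD.
(* Either point may be the earlier one; symmetry of the angle and of [hinge_pair] lets the sides be
   exchanged. *)
case: rel => rel.
  have [e' te' _] := tau_finE (finU _ _ Uy' Uz').
  have [k1' ->] := comparison_angleE fx fy' fz' ts tt s0 t0 tD rel te'.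
  exact: (core U x Sxy Sxz c c' k cmp_pt finU cc sideY sideZ curv' y' z').
have [e' te' _] := tau_finE (finU _ _ Uz' Uy').
have [k1' ang'] := comparison_angleE fx fz' fy' tt ts t0 s0 sD rel te'.
rewrite comparison_angle_sym ang'.
exact: (core U x Sxz Sxy c' c k cmp_pt finU cc' sideZ sideY curv' z' y').
Qed.

End monotonicity.

Theorem theorem3p10 (R : realType) (X : metricType R)
    (L : lorentzian_prelength X) (K : R)
    (hX : locally_strictly_timelike_geodesically_connected L) :
  (timelike_curvature_bounded_below L K ->
   future_timelike_monotonicity_below L K) /\
  (timelike_curvature_bounded_above L K ->
   future_timelike_monotonicity_above L K).
Proof.
split=> curv; apply: (monotonicity_of_curvature curv).
- move=> U x S S' d d' k cmp_pt fin dd' sS sS' cv q q' s s' e Sq Sq' qx q'x ts ts' qq' te ss ss' k1' k1.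
  apply: le_arcosh => //; rewrite le_kappa//.
  exact: (hinge_chord_below fin dd' sS sS' cv Sq Sq').
- move=> U x S S' d d' k cmp_pt fin dd' sS sS' cv q q' s s' e Sq Sq' qx q'x ts ts' qq' te ss ss' k1' k1.
  apply: le_arcosh => //; rewrite kappa_le//.
  exact: (hinge_chord_above fin dd' sS sS' Sq Sq' qx q'x ts ts' cv qq' te).
Qed.
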